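(* Let $\delta<0$ and $z_k=\sum_{i>k}s_i(y_{i+\delta}+y_{i+\delta-1}-y_{i-1})$ for $k\ge0$. (a) If $\limsup_kr_k<1$, then $$\frac{N_n-\theta(m(n))}{\sqrt{\sum_{k=0}^{m(n)}z_kr_k/y_k}}\xrightarrow{D}N(0,1)\quad(n\to\infty).$$ (b) If $\lim_kr_k=1$ and $\lim_k(1-r_k)/(1-r_{k-1})=1$, then $$\frac{N_n-\theta(m(n))}{\sqrt{\sum_{k=0}^{m(n)}(1-r_k)^{2\delta}}}\xrightarrow{D}N(0,1)\quad(n\to\infty).$$
   Context: Let $\{X_n,n\ge1\}$ be independent, identically distributed random variables with values in $\mathbb{Z}_+=\{0,1,2,\dots\}$ such that $p_k=P[X_1=k]>0$ for every $k\in\mathbb{Z}_+$ (set $p_m=0$ for integers $m\le -1$). For $k\in\mathbb{Z}_+$ let $y_k=\sum_{i>k}p_i$, and set $y_m=1$ for integers $m\le-1$. Let $r_k=p_k/y_{k-1}$, $k\in\mathbb{Z}_+$, and $m(t)=\min\{j\in\mathbb{Z}_+: y_j<1/t\}$ for $t>0$. For the fixed integer $\delta$ define $s_k=p_{k+\delta}/y_{k-1}$ and $\theta(k)=\sum_{i=0}^k s_i$ for $k\in\mathbb{Z}_+$. Let $M_0=0$ and $M_n=\max\{X_1,\dots,X_n\}$ for $n\ge1$, and let $N_n=\sum_{k=1}^n\mathbf{1}_{\{X_k>M_{k-1}+\delta\}}$ be the number of $\delta$-records among the first $n$ observations. $N(0,\sigma^2)$ denotes the centered normal law with variance $\sigma^2$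 and $\xrightarrow{D}$ convergence in distribution. *)

(* Defs.v *)
From HB Require Import structures.
From mathcomp Require Import all_boot all_order all_algebra.
From mathcomp Require Import all_classical all_reals all_analysis.
Set Implicit Arguments. Unset Strict Implicit. Unset Printing Implicit Defensive.
Import Order.TTheory GRing.Theory Num.Theory.
Import numFieldNormedType.Exports.
Local Open Scope classical_set_scope.
Local Open Scope ring_scope.

Section defs.
Variable R : realType.
Variable p : nat -> R.   (* p k = P[X_1 = k] *)
Variable delta : int.

Definition pz (m : int) : R := if m is Posz k then p k else 0.

Definition ytail (k : nat) : R := limn (fun n => \sum_(k.+1 <= i < n) p i).

Definition yz (m : int) : R := if m is Posz k then ytail k else 1.

Definition rr (k : nat) : R := p k / yz (k%:Z - 1).

Definition ss (k : nat) : R := pz (k%:Z + delta) / yz (k%:Z - 1).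

Definition theta (k : nat) : R := \sum_(i < k.+1) ss i.

Definition zz (k : nat) : R :=
  limn (fun n => \sum_(k.+1 <= i < n)
     (ss i * (yz (i%:Z + delta) + yz (i%:Z + delta - 1) - yz (i%:Z - 1)))).

Definition mm (t : R) : nat :=
  match pselect (exists j : nat, ytail j < t^-1) with
  | left h => ex_minn h
  | right _ => 0%N
  end.
End defs.

Section rv.
Variables (T : Type) (X : nat -> T -> nat) (delta : int).
(* Observations are indexed from 0: X 0, X 1, ... play the roles of
   X_1, X_2, ... in the paper. *)

Definition Mx (k : nat) (t : T) : nat := \max_(i < k) X i t.

Definition Nrec (n : nat) (t : T) : nat :=
  \sum_(k < n) ((Mx k t)%:Z + delta < (X k t)%:Z)%R.
End rv.

Definition mutually_independent d (T : measurableType d) (R : realType)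
    (P : probability T R) (X : nat -> T -> nat) : Prop :=
  forall (J : seq nat) (B : nat -> set nat), uniq J ->
    P (\big[setI/setT]_(i <- J) (X i @^-1` B i)) =
    (\prod_(i <- J) P (X i @^-1` B i))%E.

(* Main.v *)
(* Write y_k = P[X > k].  While the running maximum sits at level k, an
   observation exceeding k + delta is a delta-record; it leaves the level with
   probability q_k = y_k / y_(k + delta), so the level contributes a geometric
   number of delta-records, and level k is visited with probability r_k,
   independently of the others.  The total contribution of the levels up to K is
   therefore a sum of independent variables I_k (1 + G_k), with I_k Bernoulli(r_k)
   and G_k geometric(q_k), whose mean and variance telescope to theta(K) and to
   the normalizations of the theorem up to boundary terms.  Lindeberg's
   replacement argument gives its asymptotic normality.

   The independence of the levels is used in an analytic form: for a test function
   g, the value H(k, c) of g after all levels up to K are exhausted, starting from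
   maximum k and count c, is harmonic for the chain (maximum, count), hence has
   constant mean in time.  At time n the maximum lies with high probability
   between m(n / A) and m(A n); this range carries a bounded mean number of levels,
   so that H(M_n, N_n) is close to g(N_n). *)
Require Import Defs.
From HB Require Import structures.
From mathcomp Require Import all_boot all_order all_algebra.
From mathcomp Require Import all_classical all_reals all_analysis.
From mathcomp Require Import measurable_realfun.
From mathcomp Require Import ring lra zify.
Import Order.TTheory GRing.Theory Num.Theory.
Import numFieldNormedType.Exports.
Local Open Scope classical_set_scope.
Local Open Scope ring_scope.
Set Implicit Arguments. Unset Strict Implicit. Unset Printing Implicit Defensive.

(** * Taylor expansion and test functions *)

Section taylor.
Context {R : realType}.
Implicit Types (f g : R -> R) (x y h B M : R).

(** No conditional expectation and no product space is needed. The chain is averaged by a finite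
    recursion, the independence of the observations enters only through cylinder probabilities, and
    sums of independent normal variables are replaced by the semigroup property of Gaussian
    averages.

    Logistic functions serve as test functions: their derivatives are explicit polynomials in the
    function itself, which keeps all constants explicit, and an indicator lies below such a function
    up to a factor [1 + expR (- l)].

    Only upper bounds are ever proved, for the event [stat <= x] and for its complement. Truncating
    the chain and leaving the likely range of the maximum then merely add small positive errors.

    The two cases are reduced to the same conditions on the gap ratios [1 / q k]: they are
    negligible against the standard deviation, and comparable over the likely range. Under (a) they
    are bounded. Under (b) they tend to infinity, but the part of the range beyond [mm p n] shrinks
    to at most one level. *)

Lemma increment_le f f' x h B :
  (forall y, is_derive y (1 : R) f (f' y)) ->
  (forall y, `|y - x| <= `|h| -> `|f' y| <= B) ->
  `|f (x + h) - f x| <= B * `|h|.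
Proof.
move=> df f'B.
have cf a b : {within `[a, b], continuous f}.
  apply/continuous_subspaceT => y; apply/differentiable_continuous.
  by apply/derivable1_diffP; case: (df y).
have [h0|h0] := leP 0 h.
  have [|c] := @MVT_segment R f f' x (x + h) _ (fun y _ => df y) (cf _ _).
    by rewrite lerDl.
  rewrite in_itv /= => /andP[xc ch] ->.
  rewrite normrM [x + h - x]addrC addKr ler_wpM2r// f'B//.
  by rewrite !ger0_norm ?subr_ge0// lerBlDl.
have [|c] := @MVT_segment R f f' (x + h) x _ (fun y _ => df y) (cf _ _).
  by rewrite gerDl ltW.
rewrite in_itv /= => /andP[xc ch] E.
rewrite -normrN opprB E normrM opprD addrA subrr sub0r normrN ler_wpM2r// f'B//.
rewrite ler0_norm ?subr_le0// ltr0_norm// opprB; lra.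
Qed.

(** Each order is [increment_le] applied to the remainder as a function of the endpoint; this yields
    [M] rather than [M / 6] and avoids an integral remainder. *)
Lemma taylor3 f f1 f2 f3 x h M :
  (forall y, is_derive y (1 : R) f (f1 y)) ->
  (forall y, is_derive y (1 : R) f1 (f2 y)) ->
  (forall y, is_derive y (1 : R) f2 (f3 y)) ->
  (forall y, `|y - x| <= `|h| -> `|f3 y| <= M) ->
  `|f (x + h) - f x - h * f1 x - h ^+ 2 / 2 * f2 x| <= M * `|h| ^+ 3.
Proof.
move=> d1 d2 d3 f3M.
have M0 : 0 <= M by apply: le_trans (f3M x _); rewrite ?subrr ?normr0.
have b2 y : `|y - x| <= `|h| -> `|f2 y - f2 x| <= M * `|h|.
  move=> yh; rewrite -[y in f2 y](subrKC x).
  apply: (@le_trans _ _ (M * `|y - x|)); last by rewrite ler_wpM2l.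
  by apply: (@increment_le f2 f3) => // z zy; apply: f3M; exact: le_trans yh.
have b1 y : `|y - x| <= `|h| ->
    `|f1 y - f1 x - (y - x) * f2 x| <= M * `|h| * `|h|.
  move=> yh; pose F z := f1 z - (z - x) * f2 x.
  have -> : f1 y - f1 x - (y - x) * f2 x = F (x + (y - x)) - F x.
    by rewrite /F subrKC subrr mul0r subr0 addrAC.
  apply: (@le_trans _ _ (M * `|h| * `|y - x|)).
    apply: (@increment_le F (fun z => f2 z - f2 x)); last first.
      by move=> z zy; apply: b2; exact: le_trans yh.
    move=> z; rewrite /F.
    have -> : (fun z => f1 z - (z - x) * f2 x) =
      f1 - (id - cst x) * cst (f2 x) by [].
    apply: is_derive_eq.
    rewrite !fctE /= /GRing.scale /=; ring.
  by rewrite ler_wpM2l// mulr_ge0.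
pose F z := f z - (z - x) * f1 x - (z - x) ^+ 2 / 2 * f2 x.
have -> : f (x + h) - f x - h * f1 x - h ^+ 2 / 2 * f2 x = F (x + h) - F x.
  rewrite /F (_ : x + h - x = h); [|by ring].
  rewrite subrr; ring.
have -> : M * `|h| ^+ 3 = M * `|h| * `|h| * `|h| by ring.
apply: (@increment_le F (fun z => f1 z - f1 x - (z - x) * f2 x)).
  move=> z; rewrite /F.
  have -> : (fun z => f z - (z - x) * f1 x - (z - x) ^+ 2 / 2 * f2 x) =
    f - (id - cst x) * cst (f1 x) - (id - cst x) ^+ 2 * cst (2^-1) * cst (f2 x).
    by [].
  apply: is_derive_eq.
  by rewrite !fctE /= /GRing.scale /=; field.
by move=> z zx; exact: b1.
Qed.

(** A smooth decreasing cut-off, near 1 at -oo and near 0 at +oo. As a function [y] it has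
    derivative [- y (1 - y)], so bounds on all derivatives follow from [0 < y <= 1]. *)
Definition logistic (u : R) := (1 + expR u)^-1.

Lemma logistic_gt0 u : 0 < logistic u.
Proof. by rewrite invr_gt0 addr_gt0 ?expR_gt0. Qed.

Lemma logistic_le1 u : logistic u <= 1.
Proof. by rewrite invf_le1 ?addr_gt0 ?expR_gt0// lerDl expR_ge0. Qed.

Lemma is_derive_logistic u :
  is_derive u (1 : R) logistic (- (logistic u * (1 - logistic u))).
Proof.
have e0 : 1 + expR u != 0 by rewrite gt_eqF// addr_gt0 ?expR_gt0.
have H := is_deriveV (f := cst 1 + expR) e0.
apply: (is_derive_eq (H _ _ _)).
have -> : (cst 1 + expR) u = 1 + expR u by []. rewrite /logistic /GRing.scale /= add0r.
by field.
Qed.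

Definition logistic1 (u : R) := - (logistic u * (1 - logistic u)).
Definition logistic2 (u : R) :=
  logistic u * (1 - logistic u) * (1 - 2 * logistic u).

Lemma logistic_lip u k : `|logistic (u + k) - logistic u| <= `|k|.
Proof.
rewrite -[leRHS]mul1r; apply: (@increment_le logistic logistic1) => [y|y _].
  exact: is_derive_logistic.
rewrite normrN ger0_norm.
  have := logistic_le1 y; have := logistic_gt0 y; nra.
by rewrite mulr_ge0// ?subr_ge0 ?logistic_le1// ltW// logistic_gt0.
Qed.

Lemma logistic_taylor u k :
  `|logistic (u + k) - logistic u - k * logistic1 u - k ^+ 2 / 2 * logistic2 u|
  <= `|k| ^+ 3.
Proof.
(* The third derivative; [1 - 6 l + 6 l ^+ 2] stays in [-1/2, 1] for [l] in [0, 1]. *)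
pose f3 y := logistic1 y * (1 - 6 * logistic y + 6 * logistic y ^+ 2).
rewrite -[leRHS]mul1r; apply: (@taylor3 logistic logistic1 logistic2 f3) => y.
- exact: is_derive_logistic.
- have dl := is_derive_logistic y.
  have -> : logistic1 = - (logistic * (cst 1 - logistic)) by [].
  apply: is_derive_eq; rewrite /logistic2 /GRing.scale !fctE /=; ring.
- have dl := is_derive_logistic y.
  have -> : logistic2 =
     logistic * (cst 1 - logistic) * (cst 1 - cst 2 * logistic) by [].
  apply: is_derive_eq; rewrite /f3 /logistic1 /GRing.scale !fctE /=; ring.
- move=> _; rewrite /f3 /logistic1.
  have l0 := logistic_gt0 y; have l1 := logistic_le1 y.
  set l := logistic y in l0 l1 *; rewrite normrM normrN -[leRHS]mul1r.
  by apply: ler_pM => //; rewrite ler_norml; nra.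
Qed.

Lemma logistic1_le1 u : `|logistic1 u| <= 1.
Proof.
have l0 := logistic_gt0 u; have l1 := logistic_le1 u; rewrite /logistic1.
by rewrite normrN ler_norml; nra.
Qed.

Lemma logistic2_le1 u : `|logistic2 u| <= 1.
Proof.
have l0 := logistic_gt0 u; have l1 := logistic_le1 u; rewrite /logistic2.
rewrite normrM -[leRHS]mulr1; apply: ler_pM => //; rewrite ler_norml; nra.
Qed.

Lemma continuous_logistic : continuous (logistic : R -> R).
Proof.
move=> u; apply/differentiable_continuous/derivable1_diffP.
by case: (is_derive_logistic u).
Qed.

End taylor.

(* [g1] and [g2] play the role of the first two derivatives of [g]. *)
Record test_fun {R : realType} (L C : R) (g g1 g2 : R -> R) : Prop := TestFun {
  test_bnd : forall x, 0 <= g x <= 1;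
  test_lip : forall x h, `|g (x + h) - g x| <= L * `|h|;
  test_cont1 : continuous g1;
  test_cont2 : continuous g2;
  test_bnd1 : exists B, forall x, `|g1 x| <= B;
  test_bnd2 : exists B, forall x, `|g2 x| <= B;
  test_taylor : forall x h,
    `|g (x + h) - g x - h * g1 x - h ^+ 2 / 2 * g2 x| <= C * `|h| ^+ 3 }.

Section test_fun.
Context {R : realType}.

Lemma test_fun_logistic (al be : R) :
  test_fun `|al| (`|al| ^+ 3) (fun x => logistic (al * x + be))
    (fun x => al * logistic1 (al * x + be))
    (fun x => al ^+ 2 * logistic2 (al * x + be)).
Proof.
have ca : continuous (fun x : R => al * x + be).
  by move=> x; apply: cvgD; [apply: cvgM; [exact: cvg_cst|exact: cvg_id]|exact: cvg_cst].
have cl : continuous (fun x => logistic (al * x + be)).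
  by move=> x; apply: (continuous_comp (ca x)); exact: continuous_logistic.
split.
- by move=> x; rewrite logistic_le1 andbT ltW// logistic_gt0.
- move=> x h; rewrite -normrM.
  by rewrite (_ : al * (x + h) + be = al * x + be + al * h) ?logistic_lip//; ring.
- move=> x; apply: cvgM; first exact: cvg_cst.
  apply: cvgN; apply: cvgM; first exact: cl.
  by apply: cvgB; [exact: cvg_cst|exact: cl].
- move=> x; apply: cvgM; first exact: cvg_cst.
  apply: cvgM; first apply: cvgM; first exact: cl.
    by apply: cvgB; [exact: cvg_cst|exact: cl].
  apply: cvgB; [exact: cvg_cst|apply: cvgM; [exact: cvg_cst|exact: cl]].
- by exists `|al| => x; rewrite normrM ler_piMr// logistic1_le1.
- by exists `|al ^+ 2| => x; rewrite normrM ler_piMr// logistic2_le1.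
- move=> x h; rewrite -exprMn -normrM.
  have := logistic_taylor (al * x + be) (al * h).
  rewrite (_ : al * (x + h) + be = al * x + be + al * h); last by ring.
  congr (`| _ | <= _); ring.
Qed.

Lemma lip_continuous (L : R) (g : R -> R) : (forall x h, `|g (x + h) - g x| <= L * `|h|) ->
  continuous g.
Proof.
move=> gL x; apply/cvgrPdist_lt => e e0.
have L0 : 0 <= L by have := le_trans (normr_ge0 _) (gL 0 1); rewrite normr1 mulr1.
near=> y.
rewrite distrC -(subrKC x y); apply: (le_lt_trans (gL x (y - x))).
have : `|y - x| < e / (L + 1).
  rewrite distrC; near: y; apply/nbhs_ballP; exists (e / (L + 1)) => //=.
  by rewrite divr_gt0// ltr_wpDl.
rewrite ltr_pdivlMr ?ltr_wpDl// => h; apply: le_lt_trans h.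
by rewrite mulrC ler_wpM2l// lerDl.
Unshelve. all: by end_near. Qed.

Lemma test_fun_continuous (L C : R) g g1 g2 :
  test_fun L C g g1 g2 -> continuous g.
Proof. by move=> tg; exact: lip_continuous (test_lip tg). Qed.

End test_fun.

(** * Gaussian averages *)

Section gauss.
Context {R : realType}.
Notation mu := (@lebesgue_measure R).
Notation phi := (normal_pdf (0 : R) 1).
Implicit Types (h g : R -> R).

Definition gmean h : R := \int[mu]_z (h z * phi z).
Definition gint h := mu.-integrable setT (fun z => (h z * phi z)%:E).

Lemma phiE z : phi z = normal_peak (1 : R) * expR (- z ^+ 2 / 2).
Proof. by rewrite normal_pdfE ?oner_eq0// /normal_fun subr0 expr1n. Qed.

Lemma phi_ge0 z : 0 <= phi z. Proof. exact: normal_pdf_ge0. Qed.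

Lemma measurable_phi : measurable_fun setT phi.
Proof. exact: measurable_normal_pdf. Qed.

(** Completing the square: exponential tilting by [t] moves the centre of the normal density to
    [t]. *)
Lemma mgfE t z : expR (t * z) * phi z = expR (t ^+ 2 / 2) * normal_pdf t 1 z.
Proof.
rewrite phiE normal_pdfE ?oner_eq0// /normal_fun !(mulrCA _ (normal_peak _)).
congr (_ * _); rewrite -!expRD; congr expR; rewrite expr1n; by field.
Qed.

Lemma gint_exp t : gint (fun z => expR (t * z)).
Proof.
rewrite /gint; under eq_fun do rewrite mgfE EFinM.
by apply: integrableZl => //; exact: integrable_normal_pdf.
Qed.

Lemma gmean_exp t : gmean (fun z => expR (t * z)) = expR (t ^+ 2 / 2).
Proof.
rewrite /gmean; under eq_Rintegral do rewrite mgfE.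
rewrite RintegralZl//; last exact: integrable_normal_pdf.
by rewrite /Rintegral integral_normal_pdf mulr1.
Qed.

Lemma gintZ k h : gint h -> gint (fun z => k * h z).
Proof.
move=> ih; rewrite /gint; under eq_fun do rewrite -mulrA EFinM.
exact: integrableZl.
Qed.

Lemma gintD h g : gint h -> gint g -> gint (fun z => h z + g z).
Proof.
move=> ih ig; rewrite /gint; under eq_fun do rewrite mulrDl EFinD.
exact: integrableD.
Qed.

Lemma gintB h g : gint h -> gint g -> gint (fun z => h z - g z).
Proof.
move=> ih ig; rewrite /gint; under eq_fun do rewrite mulrBl EFinB.
exact: integrableB.
Qed.

Lemma gmeanZ k h : gint h -> gmean (fun z => k * h z) = k * gmean h.
Proof.
move=> ih; rewrite /gmean -RintegralZl//.
by apply: eq_Rintegral => z _; rewrite mulrA.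
Qed.

Lemma gmeanD h g : gint h -> gint g ->
  gmean (fun z => h z + g z) = gmean h + gmean g.
Proof.
move=> ih ig; rewrite /gmean -RintegralD//.
by apply: eq_Rintegral => z _; rewrite mulrDl.
Qed.

Lemma gmeanB h g : gint h -> gint g ->
  gmean (fun z => h z - g z) = gmean h - gmean g.
Proof.
move=> ih ig; rewrite /gmean -RintegralB//.
by apply: eq_Rintegral => z _; rewrite mulrBl.
Qed.

Lemma le_gmean h g : gint h -> gint g -> (forall z, h z <= g z) ->
  gmean h <= gmean g.
Proof.
by move=> ih ig hg; apply: le_Rintegral => // z _; rewrite ler_wpM2r ?phi_ge0.
Qed.

Lemma gint_le h g : measurable_fun setT h -> gint g ->
  (forall z, `|h z| <= g z) -> gint h.
Proof.
move=> mh ig hg; apply: (le_integrable _ _ _ ig) => //.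
  by apply/measurable_EFinP; apply: measurable_funM => //; exact: measurable_phi.
move=> z _; rewrite !abse_EFin lee_fin !normrM ler_wpM2r//.
by apply: le_trans (hg z) _; rewrite ler_norm.
Qed.

Lemma le_norm_gmean h g : gint h -> gint g -> (forall z, `|h z| <= g z) ->
  `|gmean h| <= gmean g.
Proof.
move=> ih ig hg; rewrite ler_norml; apply/andP; split; last first.
  by apply: le_gmean => // z; apply: le_trans (ler_norm _) (hg z).
rewrite -mulN1r -gmeanZ//; apply: le_gmean => // [|z]; first exact: gintZ.
by rewrite mulN1r lerNl; apply: le_trans (hg z); rewrite -normrN ler_norm.
Qed.

Lemma gint_cst c : gint (fun=> c).
Proof.
have /(gintZ c) := gint_exp 0; congr gint; apply/funext => z.
by rewrite mul0r expR0 mulr1.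
Qed.

Lemma gmean_cst c : gmean (fun=> c) = c.
Proof.
transitivity (gmean (fun z => c * expR (0 * z))).
  by congr gmean; apply/funext => z; rewrite mul0r expR0 mulr1.
by rewrite gmeanZ ?gmean_exp ?expr0n/= ?mul0r ?expR0 ?mulr1//; exact: gint_exp.
Qed.

Lemma gint_bounded h B : measurable_fun setT h -> (forall z, `|h z| <= B) -> gint h.
Proof. by move=> mh hB; apply: gint_le (gint_cst B) hB. Qed.

(* Dominates every polynomial and [expR \o `|_|]. *)
Definition gdom (z : R) := expR (2 * z) + expR (- 2 * z).

Lemma gint_dom : gint gdom. Proof. by apply: gintD; exact: gint_exp. Qed.

Lemma exp_abs_le (u : R) : expR `|u| <= expR u + expR (- u).
Proof.
have [u0|u0] := ger0P u; first by rewrite lerDl expR_ge0.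
by rewrite lerDr expR_ge0.
Qed.

Lemma cube_exp_le (z : R) : `|z| ^+ 3 * expR `|z| <= 6 * gdom z.
Proof.
have H : `|z| ^+ 3 <= 6 * expR `|z|.
  have := expR_ge1Dxn 2 (normr_ge0 z); rewrite (_ : 3`! = 6)%N//.
  set a := `|z| ^+ 3; set b := expR _; lra.
apply: (@le_trans _ _ (6 * expR `|z| * expR `|z|)).
  by rewrite ler_wpM2r ?expR_ge0.
rewrite -mulrA -expRD ler_wpM2l//.
have -> : `|z| + `|z| = `|2 * z| by rewrite normrM ger0_norm//; ring.
by apply: le_trans (exp_abs_le _) _; rewrite /gdom mulNr.
Qed.

Lemma poly_dom (z : R) : [/\ `|z| <= 6 * gdom z, z ^+ 2 <= 6 * gdom z &
  `|z| ^+ 3 <= 6 * gdom z].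
Proof.
have g1 : 1 <= gdom z.
  have := exp_abs_le (2 * z); rewrite -mulNr; apply: le_trans.
  by rewrite -expR0 ler_expR.
have e1 : 1 <= expR `|z| by rewrite -expR0 ler_expR.
have H : `|z| ^+ 3 <= 6 * gdom z.
  by apply: le_trans (cube_exp_le z); rewrite ler_peMr ?exprn_ge0.
have a0 := normr_ge0 z; rewrite -[z ^+ 2]real_normK ?num_real//.
by move: `|z| a0 H => a a0 H; split => //; have [a1|a1] := leP a 1; nra.
Qed.

Lemma measurable_pow n : measurable_fun setT (fun z : R => z ^+ n).
Proof. by apply: measurable_funX; exact: measurable_id. Qed.

Lemma gint_id : gint id.
Proof. by apply: gint_le (gintZ 6 gint_dom) _ => // z; case: (poly_dom z). Qed.

Lemma gint_sq : gint (fun z => z ^+ 2).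
Proof.
apply: gint_le (measurable_pow 2) (gintZ 6 gint_dom) _ => z.
by rewrite ger0_norm ?sqr_ge0//; case: (poly_dom z).
Qed.

Lemma gint_cube : gint (fun z => `|z| ^+ 3).
Proof.
apply: gint_le (gintZ 6 gint_dom) _ => [|z].
  by apply: measurable_funX; exact: normr_measurable.
by rewrite ger0_norm ?exprn_ge0//; case: (poly_dom z).
Qed.

Lemma exp_taylor (u : R) : `|expR u - 1 - u - u ^+ 2 / 2| <= expR `|u| * `|u| ^+ 3.
Proof.
have d := @is_derive_expR R.
have := @taylor3 R expR expR expR expR 0 u (expR `|u|) d d d.
rewrite add0r expR0 !mulr1; apply=> y.
rewrite subr0 => yu; rewrite ger0_norm ?expR_ge0// ler_expR.
exact: le_trans (ler_norm _) yu.
Qed.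

Lemma squeeze0 (a K : R) : (forall t, 0 < t <= 1 -> `|a| <= K * t) -> a = 0.
Proof.
move=> H; apply/eqP; rewrite -normr_eq0 eq_le normr_ge0 andbT.
have K0 : 0 <= K by have := H 1; rewrite ltr01 lexx mulr1 => /(_ isT); apply: le_trans.
apply/ler_addgt0Pr => e e0; rewrite add0r.
have m0 : 0 < Num.min 1 (e / (K + 1)) by rewrite lt_min ltr01 divr_gt0// ltr_wpDl.
apply: (le_trans (H (Num.min 1 (e / (K + 1))) _)); first by rewrite m0 ge_min lexx.
apply: (@le_trans _ _ (K * (e / (K + 1)))).
  by rewrite ler_wpM2l// ge_min lexx orbT.
by rewrite mulrA ler_pdivrMr ?ltr_wpDl// mulrDr mulr1 mulrC lerDl ltW.
Qed.

(** Both moments are read off the moment generating function. Comparing [gmean_exp] with the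
    termwise mean of the expansion of [expR (t * z)] shows that [t ^+ 2 / 2 * (1 - m2) - t * m1] is
    of third order in [t]. Adding the bounds at [t] and [- t] isolates [m2], and [m1] follows. *)
Lemma gauss_moments : gmean id = 0 /\ gmean (fun z => z ^+ 2) = 1.
Proof.
set m1 := gmean id; set m2 := gmean _; set W := gmean gdom.
have W0 : 0 <= W.
  have := le_gmean (gint_cst 0) gint_dom; rewrite gmean_cst; apply=> z.
  by rewrite addr_ge0 ?expR_ge0.
have main t : `|t| <= 1 -> `|t ^+ 2 / 2 * (1 - m2) - t * m1| <= (6 * W + 1) * `|t| ^+ 3.
  move=> t1.
  have i1 := gintB (gintB (gint_exp t) (gint_cst 1)) (gintZ t gint_id).
  have i2 := gintB i1 (gintZ (t ^+ 2 / 2) gint_sq).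
  have : `|gmean (fun z => expR (t * z) - 1 - t * z - t ^+ 2 / 2 * z ^+ 2)|
      <= gmean (fun z => `|t| ^+ 3 * (6 * gdom z)).
    apply: le_norm_gmean => // [|z]; first exact: (gintZ _ (gintZ 6 gint_dom)).
    have := exp_taylor (t * z).
    rewrite (_ : (t * z) ^+ 2 / 2 = t ^+ 2 / 2 * z ^+ 2); last by ring.
    move=> /le_trans; apply; rewrite normrM exprMn mulrCA ler_wpM2l ?exprn_ge0//.
    apply: le_trans (cube_exp_le z); rewrite mulrC ler_wpM2l ?exprn_ge0//.
    by rewrite ler_expR ler_piMl.
  rewrite (gmeanB i1 (gintZ _ gint_sq)) (gmeanB _ (gintZ _ gint_id)); last first.
    exact: (gintB (gint_exp t) (gint_cst 1)).
  rewrite (gmeanB (gint_exp t) (gint_cst 1)) gmean_exp gmean_cst.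
  rewrite (gmeanZ _ gint_id) (gmeanZ _ gint_sq).
  rewrite (gmeanZ _ (gintZ _ gint_dom)) (gmeanZ _ gint_dom) -/m1 -/m2 -/W.
  have t3 : 0 <= `|t| ^+ 3 by rewrite exprn_ge0.
  have t2e : t ^+ 2 = `|t| ^+ 2 by rewrite real_normK ?num_real.
  have t2 : t ^+ 2 <= 1 by rewrite t2e expr_le1.
  have t4 : t ^+ 4 <= `|t| ^+ 3.
    have -> : t ^+ 4 = (t ^+ 2) ^+ 2 by ring.
    have -> : (t ^+ 2) ^+ 2 = `|t| ^+ 3 * `|t| by rewrite t2e; ring.
    by rewrite ler_piMr.
  have s1 := expR_ge1Dx (t ^+ 2 / 2).
  (* With [u = t ^+ 2 / 2 <= 1 / 2], the bound [1 - u <= expR (- u)] gives [expR u <= 1 / (1 - u) <=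
     1 + u + 2 u ^+ 2]. *)
  have s2 : expR (t ^+ 2 / 2) <= 1 + t ^+ 2 / 2 + t ^+ 4 / 2.
    have E : expR (t ^+ 2 / 2) * expR (- (t ^+ 2 / 2)) = 1 by rewrite -expRD subrr expR0.
    have := expR_ge1Dx (- (t ^+ 2 / 2)); have e0 := expR_gt0 (t ^+ 2 / 2).
    have -> : t ^+ 4 = t ^+ 2 * t ^+ 2 by ring.
    have := sqr_ge0 t; nra.
  rewrite !ler_norml => /andP[l u]; apply/andP; split; nra.
have m20 : 1 - m2 = 0.
  apply: (@squeeze0 _ (2 * (6 * W + 1))) => t /andP[t0 t1].
  have at1 : `|t| <= 1 by rewrite ger0_norm// ltW.
  have := main t at1; have := main (- t); rewrite normrN => /(_ at1).
  rewrite sqrrN (ger0_norm (ltW t0)) => A B.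
  have : `|t ^+ 2 * (1 - m2)| <= 2 * (6 * W + 1) * t ^+ 3.
    have -> : t ^+ 2 * (1 - m2) = (t ^+ 2 / 2 * (1 - m2) - - t * m1) +
       (t ^+ 2 / 2 * (1 - m2) - t * m1) by field.
    by apply: le_trans (ler_normD _ _) _; lra.
  have -> : 2 * (6 * W + 1) * t ^+ 3 = t ^+ 2 * (2 * (6 * W + 1) * t) by ring.
  by rewrite normrM ger0_norm ?sqr_ge0// ler_pM2l// exprn_gt0.
split; last by apply/eqP; rewrite eq_sym -subr_eq0 m20.
apply: (@squeeze0 _ (6 * W + 1)) => t /andP[t0 t1].
have at1 : `|t| <= 1 by rewrite ger0_norm// ltW.
have := main t at1; rewrite m20 mulr0 sub0r normrN normrM (ger0_norm (ltW t0)) => A.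
have : t * `|m1| <= t * ((6 * W + 1) * t ^+ 2) by apply: le_trans A _; rewrite le_eqVlt; apply/orP; left; apply/eqP; ring.
rewrite ler_pM2l// => /le_trans; apply.
have tt : t ^+ 2 <= t by rewrite expr2 ler_piMl// ltW.
by apply: ler_wpM2l => //; lra.
Qed.

(** The heat semigroup: convolution of [g] with the centred normal law of variance [v], equal to [g]
    at [v = 0]. *)
Definition gsmooth v g x : R := gmean (fun z => g (x + Num.sqrt v * z)).

Definition gcube : R := gmean (fun z => `|z| ^+ 3).

Lemma measurable_affine g a b : measurable_fun setT g ->
  measurable_fun setT (fun z : R => g (a + b * z)).
Proof.
move=> mg; by apply: measurableT_comp => //; apply: measurable_funD => //; apply: measurable_funM.
Qed.

Lemma gint_affine g a b B : measurable_fun setT g -> (forall z, `|g z| <= B) ->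
  gint (fun z => g (a + b * z)).
Proof. by move=> mg gB; apply: (gint_bounded (B := B)) => //; exact: measurable_affine. Qed.

(** The linear term has mean 0 and the quadratic one mean [v / 2 * c2]. The coefficients are free
    rather than derivatives because [g] will itself be a Gaussian average. *)
Lemma gsmooth_taylor (v x c1 c2 C B : R) g : 0 <= v ->
  measurable_fun setT g -> (forall z, `|g z| <= B) ->
  (forall k : R, `|g (x + k) - g x - k * c1 - k ^+ 2 / 2 * c2| <= C * `|k| ^+ 3) ->
  `|gsmooth v g x - g x - v / 2 * c2| <= C * gcube * Num.sqrt v ^+ 3.
Proof.
move=> v0 mg gB gT; set s := Num.sqrt v; have s0 : 0 <= s by rewrite sqrtr_ge0.
have [m1 m2] := gauss_moments.
have ig := gint_affine x s mg gB.
have i1 := gintZ (s * c1) gint_id.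
have i2 := gintZ (s ^+ 2 / 2 * c2) gint_sq.
have -> : gsmooth v g x - g x - v / 2 * c2 =
    gmean (fun z => g (x + s * z) - g x - s * c1 * z - s ^+ 2 / 2 * c2 * z ^+ 2).
  rewrite (gmeanB (gintB (gintB ig (gint_cst _)) i1) i2).
  rewrite (gmeanB (gintB ig (gint_cst _)) i1) (gmeanB ig (gint_cst _)).
  rewrite (gmeanZ _ gint_id) (gmeanZ _ gint_sq) m1 m2 gmean_cst sqr_sqrtr//.
  by rewrite mulr0 subr0 mulr1.
have -> : C * gcube * s ^+ 3 = gmean (fun z => C * s ^+ 3 * `|z| ^+ 3).
  by rewrite gmeanZ ?gint_cube// /gcube; ring.
apply: le_norm_gmean; [exact: (gintB (gintB (gintB ig (gint_cst _)) i1) i2)|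
  exact: (gintZ _ gint_cube)|move=> z].
have := gT (s * z); rewrite normrM exprMn (ger0_norm s0).
rewrite mulrA; congr (`| _ | <= _); ring.
Qed.

Lemma gmeanE h : gint h -> (gmean h)%:E = (\int[mu]_z (h z * phi z)%:E)%E.
Proof. by move=> ih; rewrite /gmean /Rintegral fineK//; exact: integrable_fin_num. Qed.

Lemma affine_subst (a b : R) (G : R -> R) : 0 < a -> continuous G ->
  (forall z, 0 <= G z) ->
  (\int[mu]_z (G z)%:E = \int[mu]_u (G ((u + b) * a) * a)%:E)%E.
Proof.
move=> a0 cG G0; pose F (u : R) := (u + b) * a.
have dF (u : R) : is_derive u (1 : R) F a.
  have -> : F = (id + cst b) * cst a by [].
  by apply: is_derive_eq; rewrite /GRing.scale /= mulr0 add0r addr0 mulr1.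
have F'E : F^`()%classic = cst a.
  by apply/funext => u; rewrite derive1E; apply: derive_val.
rewrite (@increasing_ge0_integration_by_substitutionT R F G)//.
- by apply: eq_integral => u _; rewrite F'E.
- by move=> x y xy; rewrite ltr_pM2r// ltrD2r.
- by rewrite F'E => ?; exact: cvg_cst.
- by rewrite F'E; exact: is_cvg_cst.
- by rewrite F'E; exact: is_cvg_cst.
- by apply: (gt0_cvgMlNy (M := a)) => //; exact: cvg_addrr_Ny.
- by apply: (gt0_cvgMly (M := a)) => //; exact: cvg_addrr.
Qed.

(** Both sides are the joint density of [Z] and [U = (a Z + b Z1) / s] for independent standard
    normal [Z], [Z1]: on the left through [U] given [Z], on the right through [Z] given [U], which
    is normal with mean [a u / s] and deviation [b / s]. *)
Lemma normal_pdf_mul (a b z u : R) : 0 < a -> 0 < b -> let s := Num.sqrt (a ^+ 2 + b ^+ 2) in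
  phi z * (phi ((u - a * z / s) * (s / b)) * (s / b)) =
  phi u * normal_pdf (a * u / s) (b / s) z.
Proof.
move=> a0 b0 s.
have s2 : s ^+ 2 = a ^+ 2 + b ^+ 2 by rewrite sqr_sqrtr// addr_ge0// sqr_ge0.
have s0 : 0 < s by rewrite sqrtr_gt0 addr_gt0// exprn_gt0.
rewrite !phiE normal_pdfE ?gt_eqF ?divr_gt0// /normal_fun.
have -> : normal_peak (b / s) = normal_peak 1 * (s / b).
  rewrite /normal_peak -!mulrnAr expr1n mul1r sqrtrM ?sqr_ge0// sqrtr_sqr.
  by rewrite gtr0_norm ?divr_gt0// invfM invf_div mulrC.
set P := normal_peak 1.
set E1 := - z ^+ 2 / 2; set E2 := - _ ^+ 2 / 2; set E3 := - u ^+ 2 / 2.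
set E4 := - _ ^+ 2 / _.
have E : expR E1 * expR E2 = expR E3 * expR E4.
  rewrite -!expRD; congr expR; rewrite /E1 /E2 /E3 /E4 -mulr_natr.
  have bs : s ^+ 2 - a ^+ 2 - b ^+ 2 = 0 by rewrite s2; ring.
  apply/eqP; rewrite -subr_eq0; apply/eqP.
  transitivity ((s ^+ 2 - a ^+ 2 - b ^+ 2) * (z ^+ 2 - u ^+ 2) / (2 * b ^+ 2)).
    by field; rewrite !gt_eqF.
  by rewrite bs !mul0r.
transitivity (P * P * (s / b) * (expR E1 * expR E2)); first by ring.
by rewrite E; ring.
Qed.

(** Tonelli, hence [g >= 0], allows integrating first in [z]; once the density is factored by
    [normal_pdf_mul], this inner integral is the total mass of a normal law. *)
Lemma gsmooth_semigroup (v w x B : R) g : 0 <= v -> 0 <= w -> continuous g ->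
  (forall z, 0 <= g z <= B) ->
  gsmooth v (gsmooth w g) x = gsmooth (v + w) g x.
Proof.
move=> v0 w0 cg gB.
have mg : measurable_fun setT g by exact: continuous_measurable_fun.
have g0 z : 0 <= g z by case/andP: (gB z).
have gB' z : `|g z| <= B by case/andP: (gB z) => ? ?; rewrite ger0_norm.
(* Zero variances are set apart, since the factorization of the density needs two positive
   deviations. *)
have [v00|vn0] := eqVneq v 0.
  rewrite /gsmooth v00 add0r sqrtr0.
  under [X in gmean X]eq_fun do rewrite mul0r addr0.
  by rewrite gmean_cst.
have [w00|wn0] := eqVneq w 0.
  rewrite /gsmooth w00 addr0 sqrtr0; congr gmean; apply/funext => z.
  under eq_fun do rewrite mul0r addr0.
  by rewrite gmean_cst.
set a := Num.sqrt v; set b := Num.sqrt w.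
have a0 : 0 < a by rewrite sqrtr_gt0 lt_neqAle eq_sym vn0.
have b0 : 0 < b by rewrite sqrtr_gt0 lt_neqAle eq_sym wn0.
have sE : Num.sqrt (v + w) = Num.sqrt (a ^+ 2 + b ^+ 2) by rewrite !sqr_sqrtr.
rewrite /gsmooth -/a -/b sE; set s := Num.sqrt _.
have s0 : 0 < s by rewrite sqrtr_gt0 addr_gt0// exprn_gt0.
have ig c d : gint (fun z => g (c + d * z)) by exact: gint_affine gB'.
have gE h : gmean h = fine (\int[mu]_z (h z * phi z)%:E)%E by [].
rewrite [LHS]gE [RHS]gE; congr fine.
pose f (zu : R * R) : R := g (x + s * zu.2) * (phi zu.2 * normal_pdf (a * zu.2 / s) (b / s) zu.1).
have fE z u : f (z, u) = g (x + s * u) * (phi ((u - a * z / s) * (s / b)) * (s / b) * phi z).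
  by rewrite /f/= -normal_pdf_mul// [_ * phi z]mulrC.
have f0 zu : 0 <= f zu.
  by rewrite /f !mulr_ge0 ?normal_pdf_ge0//; case/andP: (gB (x + s * zu.2)).
transitivity (\int[mu]_z \int[mu]_u (f (z, u))%:E)%E.
  apply: eq_integral => z _.
  have cG : continuous (fun z' => g (x + a * z + b * z') * phi z').
    move=> z'; apply: cvgM; last exact: continuous_normal_pdf.
    apply: (@continuous_comp _ _ _ (fun z' => x + a * z + b * z') g); last exact: cg.
    by apply: cvgD; [exact: cvg_cst|apply: cvgM; [exact: cvg_cst|exact: cvg_id]].
  rewrite EFinM gmeanE// (@affine_subst (s / b) (- (a * z / s)) _ _ cG); first last.
  - by move=> z'; rewrite mulr_ge0 ?phi_ge0//; case/andP: (gB (x + a * z + b * z')).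
  - by rewrite divr_gt0.
  rewrite -ge0_integralZr//; first last.
  - by rewrite lee_fin phi_ge0.
  - by move=> u _; rewrite lee_fin !mulr_ge0 ?g0 ?phi_ge0 ?invr_ge0 ?(ltW s0) ?(ltW b0).
  - apply/measurable_EFinP/measurable_funM => //; apply: measurable_funM.
      apply: measurableT_comp => //; apply: measurable_funD => //.
      apply: measurable_funM => //; apply: measurable_funM => //.
      exact: measurable_funD.
    apply: measurableT_comp => //; first exact: measurable_phi.
    by apply: measurable_funM => //; exact: measurable_funD.
  apply: eq_integral => u _; rewrite -EFinM fE; congr EFin.
  have -> : x + a * z + b * ((u - a * z / s) * (s / b)) = x + s * u.
    by field; rewrite !gt_eqF.
  by rewrite !mulrA.
transitivity (\int[mu]_u \int[mu]_z (f (z, u))%:E)%E.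
  apply: (@fubini_tonelli _ _ _ _ R mu mu (fun zu => (f zu)%:E)) => [|zu]; last by rewrite lee_fin.
  apply/measurable_EFinP.
  have -> : f = fun zu => g (x + s * zu.2) *
      (phi ((zu.2 - a * zu.1 / s) * (s / b)) * (s / b) * phi zu.1).
    by apply/funext => -[z u]; rewrite fE.
  apply: measurable_funM.
    apply: measurableT_comp => //; apply: measurable_funD => //.
    exact: measurable_funM.
  apply: measurable_funM; last first.
    by apply: measurableT_comp => //; exact: measurable_phi.
  apply: measurable_funM => //; apply: measurableT_comp; first exact: measurable_phi.
  apply: measurable_funM => //; apply: measurable_funB => //.
  by apply: measurable_funM => //; exact: measurable_funM.
apply: eq_integral => u _.
under eq_integral do rewrite /f/= mulrA EFinM.
rewrite ge0_integralZl//; first last.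
- by rewrite lee_fin mulr_ge0 ?phi_ge0//; case/andP: (gB (x + s * u)).
- by move=> z _; rewrite lee_fin normal_pdf_ge0.
- by apply/measurable_EFinP; exact: measurable_normal_pdf.
by rewrite integral_normal_pdf mule1.
Qed.

End gauss.

(** * Geometric averages *)

Section geometric.
Context {R : realType}.
Variable q : R.
Hypotheses (q0 : 0 < q) (q1 : q <= 1).
Implicit Types (u v : nat -> R).

Definition geo_weight (j : nat) : R := q * (1 - q) ^+ j.

Definition geo u : R := limn (series (fun j => geo_weight j * u j)).

Let w0 j : 0 <= geo_weight j.
Proof. by rewrite mulr_ge0 ?(ltW q0)// exprn_ge0// subr_ge0. Qed.

Let jp (j : nat) : R := j%:R + 1.

Let jp1 j : 1 <= jp j. Proof. by rewrite lerDr. Qed.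

(* If [F j = q * u j + (1 - q) * F (j + 1)] then the weighted sums of [u]
   telescope; the three lemmas below use polynomial solutions [F]. *)
Let telesc u (F : nat -> R) n :
  (forall j, F j = q * u j + (1 - q) * F j.+1) ->
  series (fun j => geo_weight j * u j) n = F 0%N - (1 - q) ^+ n * F n.
Proof.
move=> E; elim: n => [|n IH]; first by rewrite /series/= big_geq// expr0 mul1r subrr.
rewrite seriesSr /= IH /geo_weight (E n) exprS; ring.
Qed.

(** [F] is a strict supersolution: it exceeds [q * (j + 1) ^+ 3 + (1 - q) * F (j + 1)] by
    [3 j + 2 + 3 / q]. The partial sums therefore stay below [F 0], and every sequence of cubic
    growth becomes summable. *)
Lemma geo_sum3_le n : series (fun j => geo_weight j * jp j ^+ 3) n <= 6 / q ^+ 3.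
Proof.
pose F (j : nat) : R := j%:R ^+ 3 + 3 * j%:R ^+ 2 / q + 6 * j%:R / q ^+ 2 + 6 / q ^+ 3.
suff H : series (fun j => geo_weight j * jp j ^+ 3) n + (1 - q) ^+ n * F n <= F 0%N.
  have F0 : 0 <= (1 - q) ^+ n * F n.
    rewrite mulr_ge0 ?exprn_ge0 ?subr_ge0// !addr_ge0// ?mulr_ge0 ?invr_ge0 ?exprn_ge0//; exact: ltW.
  have -> : 6 / q ^+ 3 = F 0%N by rewrite /F !mulr0n; ring.
  by apply: le_trans H; rewrite lerDl.
elim: n => [|n IH]; first by rewrite /series/= big_geq// expr0 mul1r add0r.
apply: le_trans IH; rewrite seriesSr /= -addrA lerD2l /geo_weight (exprS _ n).
have -> : q * (1 - q) ^+ n * jp n ^+ 3 + (1 - q) * (1 - q) ^+ n * F n.+1 =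
  (1 - q) ^+ n * (q * jp n ^+ 3 + (1 - q) * F n.+1) by ring.
rewrite ler_wpM2l ?exprn_ge0 ?subr_ge0// /F -natr1 /jp -subr_ge0.
set x := n%:R : R; have x0 : 0 <= x by rewrite ler0n.
have -> : x ^+ 3 + 3 * x ^+ 2 / q + 6 * x / q ^+ 2 + 6 / q ^+ 3 -
  (q * (x + 1) ^+ 3 + (1 - q) * ((x + 1) ^+ 3 + 3 * (x + 1) ^+ 2 / q + 6 * (x + 1) / q ^+ 2 + 6 / q ^+ 3))
  = 3 * x + 2 + 3 / q by field; rewrite gt_eqF.
by rewrite !addr_ge0 ?mulr_ge0 ?invr_ge0// ltW.
Qed.

Lemma geo_cvg u C : (forall j, `|u j| <= C * jp j ^+ 3) ->
  cvgn (series (fun j => geo_weight j * u j)).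
Proof.
move=> uC; apply: normed_cvg.
apply: (@series_le_cvg _ _ (fun j => C * (geo_weight j * jp j ^+ 3))) => [j|j|j|].
- exact: normr_ge0.
- have C0 : 0 <= C by have := le_trans (normr_ge0 _) (uC 0%N); rewrite /jp add0r expr1n mulr1.
  apply: mulr_ge0 => //; apply: mulr_ge0 => //.
  by rewrite exprn_ge0// (le_trans _ (jp1 j)).
- by rewrite /= normrM ger0_norm// mulrCA ler_wpM2l.
rewrite (_ : (fun j => C * _) = C *: (fun j => geo_weight j * jp j ^+ 3))//.
apply: is_cvg_seriesZ; apply: nondecreasing_is_cvgn.
  apply: nondecreasing_series => j _ _.
  by apply: mulr_ge0 => //; rewrite exprn_ge0// (le_trans _ (jp1 j)).
by exists (6 / q ^+ 3) => _ [n _ <-]; exact: geo_sum3_le.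
Qed.

Let pow0 (F : nat -> R) C : (forall j, `|F j| <= C * jp j ^+ 3) ->
  (1 - q) ^+ n * F n @[n --> \oo] --> 0.
Proof.
move=> FC; have := cvg_series_cvg_0 (geo_cvg FC).
move=> /(cvgM (cvg_cst q^-1)); rewrite mulr0; apply: cvg_trans.
by apply: near_eq_cvg; near=> n; rewrite /geo_weight/= !mulrA mulVf ?gt_eqF// mul1r.
Unshelve. all: by end_near. Qed.

Let telesc_cvg u (F : nat -> R) C :
  (forall j, F j = q * u j + (1 - q) * F j.+1) ->
  (forall j, `|F j| <= C * jp j ^+ 3) ->
  series (fun j => geo_weight j * u j) @ \oo --> F 0%N.
Proof.
move=> FE FC.
rewrite (_ : series _ = fun n => F 0%N - (1 - q) ^+ n * F n); last first.
  by apply/funext => n; exact: telesc.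
rewrite -[X in _ --> X]subr0; apply: cvgB; [exact: cvg_cst|exact: pow0 FC].
Qed.

Lemma geo_cvg1 : series (fun j => geo_weight j * 1) @ \oo --> (1 : R).
Proof.
apply: (@telesc_cvg (fun=> 1) (fun=> 1) 1) => j; first by ring.
by rewrite normr1 mul1r exprn_ege1.
Qed.

Lemma geo_cvg_mean : series (fun j => geo_weight j * jp j) @ \oo --> q^-1.
Proof.
have -> : q^-1 = 0%:R + q^-1 by rewrite add0r.
apply: (@telesc_cvg jp (fun j => j%:R + q^-1) (1 + q^-1)) => j.
  by rewrite -natr1 /jp; field; rewrite gt_eqF.
have i0 : 0 <= q^-1 by rewrite invr_ge0 ltW.
have x0 : 0 <= j%:R :> R by [].
rewrite ger0_norm; last by rewrite addr_ge0.
rewrite /jp; move: (j%:R) x0 (q^-1) i0 => x x0 i i0.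
have c2 : x <= (x + 1) ^+ 3.
  have -> : (x + 1) ^+ 3 = x + (x ^+ 3 + 3 * x ^+ 2 + 2 * x + 1) by ring.
  by rewrite lerDl !addr_ge0// ?mulr_ge0 ?exprn_ge0.
have c3 : 1 <= (x + 1) ^+ 3 by rewrite exprn_ege1// lerDr.
move: (_ ^+ 3) c2 c3 => y c2 c3; nra.
Qed.

Lemma geo_cvg_sqr :
  series (fun j => geo_weight j * jp j ^+ 2) @ \oo --> (2 - q) / q ^+ 2.
Proof.
pose F (j : nat) : R := j%:R ^+ 2 + 2 * j%:R / q + (2 - q) / q ^+ 2.
have -> : (2 - q) / q ^+ 2 = F 0%N by rewrite /F !mulr0n; ring.
apply: (@telesc_cvg (fun j => jp j ^+ 2) F (1 + 2 / q + (2 - q) / q ^+ 2)) => j.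
  by rewrite /F -natr1 /jp; field; rewrite gt_eqF.
have a0 : 0 <= 2 / q by rewrite divr_ge0 ?(ltW q0).
have b0 : 0 <= (2 - q) / q ^+ 2 by apply: divr_ge0; [have := q1; lra|rewrite exprn_ge0// ltW].
rewrite /F (_ : 2 * j%:R / q = (2 / q) * j%:R); last by ring.
have x0 : 0 <= j%:R :> R by [].
rewrite /jp; move: (j%:R) x0 (2 / q) a0 ((2 - q) / _) b0 => x x0 a a0 b b0.
rewrite ger0_norm; last by rewrite !addr_ge0// ?mulr_ge0 ?exprn_ge0.
have c1 : x ^+ 2 <= (x + 1) ^+ 3.
  have -> : (x + 1) ^+ 3 = x ^+ 2 + (x ^+ 3 + 2 * x ^+ 2 + 3 * x + 1) by ring.
  by rewrite lerDl !addr_ge0// ?mulr_ge0 ?exprn_ge0.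
have c2 : x <= (x + 1) ^+ 3.
  have -> : (x + 1) ^+ 3 = x + (x ^+ 3 + 3 * x ^+ 2 + 2 * x + 1) by ring.
  by rewrite lerDl !addr_ge0// ?mulr_ge0 ?exprn_ge0.
have c3 : 1 <= (x + 1) ^+ 3 by rewrite exprn_ege1// lerDr.
move: (_ ^+ 3) c1 c2 c3 => y c1 c2 c3; nra.
Qed.

Lemma geo_le u C A1 A2 A3 D : 0 <= D -> (forall j, `|u j| <= C * jp j ^+ 3) ->
  (forall j, u j <= A1 + A2 * jp j + A3 * jp j ^+ 2 + D * jp j ^+ 3) ->
  geo u <= A1 + A2 / q + A3 * ((2 - q) / q ^+ 2) + D * (6 / q ^+ 3).
Proof.
move=> D0 uC uA.
pose S n := A1 * series (fun j => geo_weight j * 1) n +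
   A2 * series (fun j => geo_weight j * jp j) n +
   A3 * series (fun j => geo_weight j * jp j ^+ 2) n + D * (6 / q ^+ 3).
have cS : S @ \oo --> A1 * 1 + A2 / q + A3 * ((2 - q) / q ^+ 2) + D * (6 / q ^+ 3).
  apply: cvgD; last exact: cvg_cst.
  by do ![apply: cvgD]; (apply: cvgM; [exact: cvg_cst|]);
    [exact: geo_cvg1|exact: geo_cvg_mean|exact: geo_cvg_sqr].
rewrite -[X in X + _ / q]mulr1 -(cvg_lim _ cS)//.
apply: ler_lim; [exact: geo_cvg uC|by apply/cvg_ex; eexists; exact: cS|].
near=> n; rewrite /S.
apply: (@le_trans _ _ (A1 * series (fun j => geo_weight j * 1) n +
   A2 * series (fun j => geo_weight j * jp j) n +
   A3 * series (fun j => geo_weight j * jp j ^+ 2) n +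
   D * series (fun j => geo_weight j * jp j ^+ 3) n)); last first.
  by rewrite lerD2l ler_wpM2l// geo_sum3_le.
rewrite /series/= !mulr_sumr -!big_split/=; apply: ler_sum => j _.
have := ler_wpM2l (w0 j) (uA j); move=> /le_trans; apply.
by rewrite le_eqVlt; apply/orP; left; apply/eqP; ring.
Unshelve. all: by end_near. Qed.

(** Decomposition at the first trial, the identity that makes [chain_value] harmonic. *)
Lemma geo_shift u C : (forall j, `|u j| <= C) ->
  geo u = q * u 0%N + (1 - q) * geo (fun j => u j.+1).
Proof.
move=> uC.
have H v : (forall j, `|v j| <= C) -> forall j, `|v j| <= C * jp j ^+ 3.
  move=> vC j; apply: le_trans (vC j) _; rewrite ler_peMr ?exprn_ege1//.
  exact: le_trans (normr_ge0 _) (vC 0%N).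
have c1 : cvgn (series (fun j => geo_weight j * u j.+1)) by exact: geo_cvg (H _ _).
apply: cvg_lim => //; rewrite -cvg_shiftS /=.
rewrite (_ : (fun n => _) = fun n => q * u 0%N +
    (1 - q) * series (fun j => geo_weight j * u j.+1) n); last first.
  apply/funext => n; rewrite /series/= big_nat_recl//= {1}/geo_weight expr0 mulr1.
  congr (_ + _); rewrite mulr_sumr; apply: eq_bigr => j _; rewrite /geo_weight exprS; ring.
by apply: cvgD; [exact: cvg_cst|apply: cvgM => //; exact: cvg_cst].
Qed.

Lemma geoB u v C : (forall j, `|u j| <= C * jp j ^+ 3) ->
  (forall j, `|v j| <= C * jp j ^+ 3) ->
  geo (fun j => u j - v j) = geo u - geo v.
Proof.
move=> /geo_cvg uC /geo_cvg vC; rewrite /geo -lim_seriesB//; congr (limn (series _)).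
by apply/funext => j; rewrite mulrBr.
Qed.

Lemma geoN u C : (forall j, `|u j| <= C * jp j ^+ 3) ->
  geo (fun j => - u j) = - geo u.
Proof.
move=> /geo_cvg uC; rewrite /geo -lim_seriesN//; congr (limn (series _)).
by apply/funext => j; rewrite mulrN.
Qed.

(* [jp j] is the size of a geometric variable conditioned to be positive, so the
   three coefficients are its moments of order 0, 1, 2, and [6 / q ^+ 3] bounds
   the third one. *)
Lemma geo_approx u C A1 A2 A3 D E : 0 <= D -> (forall j, `|u j| <= C) ->
  (forall j, `|u j - (A1 + A2 * jp j + A3 * jp j ^+ 2)| <= D * jp j ^+ 3 + E) ->
  `|geo u - (A1 + A2 / q + A3 * ((2 - q) / q ^+ 2))| <= D * (6 / q ^+ 3) + E.
Proof.
move=> D0 uC uA.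
have C0 : 0 <= C by exact: le_trans (normr_ge0 _) (uC 0%N).
have uC' j : `|u j| <= C * jp j ^+ 3.
  by apply: le_trans (uC j) _; rewrite ler_peMr ?exprn_ege1.
have uC2 j : `|- u j| <= C * jp j ^+ 3 by rewrite normrN.
have H1 := geo_le (A1 := A1 + E) (A2 := A2) (A3 := A3) D0 uC'.
have H2 := geo_le (A1 := - A1 + E) (A2 := - A2) (A3 := - A3) D0 uC2.
have {}H1 : geo u <= A1 + E + A2 / q + A3 * ((2 - q) / q ^+ 2) + D * (6 / q ^+ 3).
  by apply: H1 => j; have := uA j; rewrite ler_distl => /andP[_]; lra.
have {}H2 : - geo u <= - A1 + E - A2 / q - A3 * ((2 - q) / q ^+ 2) + D * (6 / q ^+ 3).
  rewrite -(geoN uC') -!mulNr.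
  by apply: H2 => j; have := uA j; rewrite ler_distl => /andP[+ _]; lra.
rewrite ler_distl; move: H1 H2; set a := A2 / q; set b := A3 * _; set c := D * _.
by move=> H1 H2; apply/andP; split; lra.
Qed.

Lemma geo_dist u v C e : (forall j, `|u j| <= C) -> (forall j, `|v j| <= C) ->
  (forall j, `|u j - v j| <= e) -> `|geo u - geo v| <= e.
Proof.
move=> uC vC uve.
have C0 : 0 <= C by exact: le_trans (normr_ge0 _) (uC 0%N).
have H (z : nat -> R) : (forall j, `|z j| <= C) -> forall j, `|z j| <= C * jp j ^+ 3.
  by move=> zC j; apply: le_trans (zC j) _; rewrite ler_peMr ?exprn_ege1.
have e0 : 0 <= e by exact: le_trans (normr_ge0 _) (uve 0%N).
have uv j : `|u j - v j| <= e * jp j ^+ 3.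
  by apply: le_trans (uve j) _; rewrite ler_peMr ?exprn_ege1.
have uv' j : `|- (u j - v j)| <= e * jp j ^+ 3 by rewrite normrN.
have L (z : nat -> R) : (forall j, `|z j| <= e * jp j ^+ 3) ->
    (forall j, z j <= e) -> geo z <= e.
  move=> ze1 ze2; have := geo_le (A1 := e) (A2 := 0) (A3 := 0) (lexx 0) ze1.
  by rewrite !mul0r !addr0; apply=> j; rewrite !mul0r !addr0.
rewrite -(geoB (H _ uC) (H _ vC)) ler_norml; apply/andP; split.
  rewrite lerNl -(geoN uv); apply: L => // j.
  by rewrite (le_trans (ler_norm _))// normrN.
by apply: L => // j; rewrite (le_trans (ler_norm _)).
Qed.

Lemma geo_cst c : geo (fun=> c) = c.
Proof.
apply/eqP; rewrite -subr_eq0 -normr_le0.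
have := @geo_approx (fun=> c) `|c| c 0 0 0 0 (lexx _).
by rewrite !mul0r !addr0; apply=> // j; rewrite !mul0r !addr0 subrr normr0.
Qed.

End geometric.

(** * Lindeberg replacement for the level sums *)

Section lindeberg.
Context {R : realType}.
Implicit Types (F g : R -> R) (x : R).

(* Law of [xi = I * (1 + G)] with [I] Bernoulli of parameter [r] and [G]
   geometric of success probability [q], acting by convolution. *)
Definition level_op (r q : R) F x : R :=
  (1 - r) * F x + r * geo q (fun j => F (x + 1 + j%:R)).

Lemma level_op_dist (r q : R) F1 F2 x C e : 0 < q -> q <= 1 -> 0 <= r -> r <= 1 ->
  (forall y, `|F1 y| <= C) -> (forall y, `|F2 y| <= C) ->
  (forall y, `|F1 y - F2 y| <= e) ->
  `|level_op r q F1 x - level_op r q F2 x| <= e.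
Proof.
move=> q0 q1 r0 r1 F1C F2C F12; rewrite /level_op.
have := @geo_dist R q q0 q1 (fun j => F1 (x + 1 + j%:R)) (fun j => F2 (x + 1 + j%:R)) C e
  (fun=> F1C _) (fun=> F2C _) (fun=> F12 _).
have := F12 x; move: (geo q _) (geo q _) => g1 g2.
rewrite !ler_distl => /andP[a b] /andP[c d].
by apply/andP; split; nra.
Qed.

Lemma level_op_bnd (r q : R) F x : 0 < q -> q <= 1 -> 0 <= r -> r <= 1 ->
  (forall y, 0 <= F y <= 1) -> 0 <= level_op r q F x <= 1.
Proof.
move=> q0 q1 r0 r1 F01.
have HF y : `|F y - 2^-1| <= 2^-1.
  by rewrite ler_distl; have /andP[] := F01 y; lra.
have n1 y : `|F y| <= 1 by have /andP[? ?] := F01 y; rewrite ger0_norm.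
have n2 : `|2^-1 : R| <= 1 by rewrite ger0_norm ?invr_ge0// invf_le1// ler1n.
have := @level_op_dist r q F (fun=> 2^-1) x 1 2^-1 q0 q1 r0 r1 n1 (fun=> n2) HF.
rewrite {2}/level_op geo_cst// ler_distl => /andP[]; lra.
Qed.

(** Expanding at the mean [z] cancels the first-order term and leaves half the variance
    [r * (2 - q - r) / q ^+ 2]. In the constant 7, the part 6 comes from the third moment of the
    positive geometric variable and 1 from the cube of the mean, [(r / q) ^+ 3 <= r / q ^+ 3]. *)
Lemma level_op_taylor (r q x c1 c2 C : R) g : 0 < q -> q <= 1 -> 0 <= r -> r <= 1 ->
  0 <= C -> (forall y, 0 <= g y <= 1) -> let z := x + r / q in
  (forall h, `|g (z + h) - g z - h * c1 - h ^+ 2 / 2 * c2| <= C * `|h| ^+ 3) ->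
  `|level_op r q g x - g z - r * (2 - q - r) / q ^+ 2 / 2 * c2|
  <= 7 * C * (r / q ^+ 3).
Proof.
move=> q0 q1 r0 r1 C0 g01 z gT.
set m := r / q; have m0 : 0 <= m by rewrite divr_ge0// ltW.
have gn y : `|g y| <= 1 by have /andP[? ?] := g01 y; rewrite ger0_norm.
have e0 : `|g x - (g z - m * c1 + m ^+ 2 / 2 * c2)| <= C * m ^+ 3.
  have := gT (- m); rewrite normrN (ger0_norm m0) sqrrN.
  have -> : z + - m = x by rewrite /z -/m addrK.
  by congr (`| _ | <= _); ring.
(* Second-order expansion at [z] of [g (x + 1 + j)], in powers of [j + 1]. *)
pose A1 := g z - m * c1 + m ^+ 2 / 2 * c2.
pose A2 := c1 - m * c2.
pose A3 := c2 / 2.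
have eg : `|geo q (fun j => g (x + 1 + j%:R)) -
    (A1 + A2 / q + A3 * ((2 - q) / q ^+ 2))| <= C * (6 / q ^+ 3) + C * m ^+ 3.
  apply: (geo_approx q0 q1 C0 (fun=> gn _)) => j.
  set k : R := j%:R + 1; have k0 : 0 <= k by rewrite addr_ge0.
  have := gT (k - m); have -> : z + (k - m) = x + 1 + j%:R.
    by rewrite /z -/m /k; ring.
  have -> : g (x + 1 + j%:R) - g z - (k - m) * c1 - (k - m) ^+ 2 / 2 * c2 =
    g (x + 1 + j%:R) - (A1 + A2 * k + A3 * k ^+ 2) by rewrite /A1 /A2 /A3; field.
  move=> /le_trans; apply; rewrite -mulrDr ler_wpM2l//.
  have k3 : 0 <= k ^+ 3 by rewrite exprn_ge0.
  have m3 : 0 <= m ^+ 3 by rewrite exprn_ge0.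
  have [km|km] := leP m k.
    apply: (@le_trans _ _ (k ^+ 3)); last by rewrite lerDl.
    by rewrite ler_pXn2r ?nnegrE// ger0_norm ?subr_ge0//; lra.
  apply: (@le_trans _ _ (m ^+ 3)); last by rewrite lerDr.
  by rewrite ler_pXn2r ?nnegrE// ltr0_norm ?subr_lt0//; lra.
have m3 : m ^+ 3 <= r / q ^+ 3.
  rewrite /m expr_div_n ler_wpM2r ?invr_ge0 ?exprn_ge0 ?(ltW q0)//.
  by rewrite -[leRHS]expr1 ler_wiXn2l.
have -> : level_op r q g x - g z - r * (2 - q - r) / q ^+ 2 / 2 * c2 =
  (1 - r) * (g x - A1) + r * (geo q (fun j => g (x + 1 + j%:R)) -
    (A1 + A2 / q + A3 * ((2 - q) / q ^+ 2))).
  by rewrite /level_op /A1 /A2 /A3 /m; field; rewrite gt_eqF.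
apply: le_trans (ler_normD _ _) _; rewrite !normrM ger0_norm ?subr_ge0// (ger0_norm r0).
apply: (@le_trans _ _ ((1 - r) * (C * m ^+ 3) + r * (C * (6 / q ^+ 3) + C * m ^+ 3))).
  by rewrite lerD// ler_wpM2l// subr_ge0.
have -> : (1 - r) * (C * m ^+ 3) + r * (C * (6 / q ^+ 3) + C * m ^+ 3) =
  C * (m ^+ 3 + 6 * (r / q ^+ 3)) by field; rewrite gt_eqF.
have -> : 7 * C * (r / q ^+ 3) = C * (r / q ^+ 3 + 6 * (r / q ^+ 3)) by ring.
by rewrite ler_wpM2l// lerD2r.
Qed.

Lemma gsmooth_dist v g x B e : measurable_fun setT g -> (forall y, `|g y| <= B) ->
  forall c, (forall z, `|g (x + Num.sqrt v * z) - c| <= e) -> `|gsmooth v g x - c| <= e.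
Proof.
move=> mg gB c H; have ig := gint_affine x (Num.sqrt v) mg gB.
rewrite -[X in _ - X](gmean_cst c) -(gmeanB ig (gint_cst c)) -[leRHS](gmean_cst e).
by apply: le_norm_gmean; [exact: gintB ig (gint_cst c)|exact: gint_cst|].
Qed.

Lemma gsmooth_lip v L B g : measurable_fun setT g -> (forall y, `|g y| <= B) ->
  (forall x h, `|g (x + h) - g x| <= L * `|h|) ->
  forall x h, `|gsmooth v g (x + h) - gsmooth v g x| <= L * `|h|.
Proof.
move=> mg gB gL x h; have ig y := gint_affine y (Num.sqrt v) mg gB.
rewrite /gsmooth -(gmeanB (ig _) (ig _)) -[leRHS]gmean_cst.
apply: le_norm_gmean; [exact: gintB (ig _) (ig _)|exact: gint_cst|move=> z].
by rewrite (_ : x + h + _ = x + Num.sqrt v * z + h) ?gL//; ring.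
Qed.

Lemma gsmooth_bnd v g : measurable_fun setT g -> (forall y, 0 <= g y <= 1) ->
  forall x, 0 <= gsmooth v g x <= 1.
Proof.
move=> mg g01 x.
have gn y : `|g y| <= 1 by have /andP[? ?] := g01 y; rewrite ger0_norm.
have H y : `|g y - 2^-1| <= 2^-1 by rewrite ler_distl; have /andP[] := g01 y; lra.
have := gsmooth_dist (v := v) (x := x) mg gn (fun z => H _).
by rewrite ler_distl => /andP[]; lra.
Qed.

(** The Taylor inequality is averaged instead of differentiating under the integral; the constant
    [C] is unchanged, so it does not grow along the induction in [lindeberg]. *)
Lemma gsmooth_expand v L C g g1 g2 : test_fun L C g g1 g2 ->
  forall x h, `|gsmooth v g (x + h) - gsmooth v g x - h * gsmooth v g1 x
     - h ^+ 2 / 2 * gsmooth v g2 x| <= C * `|h| ^+ 3.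
Proof.
move=> tg x h.
have mg : measurable_fun setT g by apply: continuous_measurable_fun; exact: test_fun_continuous tg.
have mg1 : measurable_fun setT g1 by apply: continuous_measurable_fun; exact: test_cont1 tg.
have mg2 : measurable_fun setT g2 by apply: continuous_measurable_fun; exact: test_cont2 tg.
have gn y : `|g y| <= 1 by have /andP[? ?] := test_bnd tg y; rewrite ger0_norm.
have [B1 hB1] := test_bnd1 tg; have [B2 hB2] := test_bnd2 tg.
have ig y := gint_affine y (Num.sqrt v) mg gn.
have ig1 := gint_affine x (Num.sqrt v) mg1 hB1.
have ig2 := gint_affine x (Num.sqrt v) mg2 hB2.
have i0 := gintB (ig (x + h)) (ig x).
have i1 := gintZ h ig1; have i2 := gintZ (h ^+ 2 / 2) ig2.
rewrite /gsmooth -(gmeanZ h ig1) -(gmeanZ (h ^+ 2 / 2) ig2) -(gmeanB (ig _) (ig _)).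
rewrite -(gmeanB i0 i1) -(gmeanB (gintB i0 i1) i2) -[leRHS]gmean_cst.
apply: le_norm_gmean; [exact: gintB (gintB i0 i1) i2|exact: gint_cst|move=> z].
by rewrite (_ : x + h + _ = x + Num.sqrt v * z + h) ?(test_taylor tg)//; ring.
Qed.

Variables (r q : nat -> R).
Hypotheses (q0 : forall k, 0 < q k) (q1 : forall k, q k <= 1).
Hypotheses (r0 : forall k, 0 <= r k) (r1 : forall k, r k <= 1).

Fixpoint levels_op (k n : nat) g : R -> R :=
  if n is n'.+1 then level_op (r k) (q k) (levels_op k.+1 n' g) else g.

Definition level_mean k := r k / q k.
Definition level_var k := r k * (2 - q k - r k) / q k ^+ 2.
Definition level_err k := r k / q k ^+ 3.

Lemma levels_op_bnd n k g : (forall y, 0 <= g y <= 1) ->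
  forall x, 0 <= levels_op k n g x <= 1.
Proof.
move=> g01; elim: n k => [|n IH] k x /=; first exact: g01.
by apply: level_op_bnd.
Qed.

Lemma level_var_ge0 k : 0 <= level_var k.
Proof.
rewrite /level_var divr_ge0 ?exprn_ge0 ?(ltW (q0 _))// mulr_ge0//.
by have := q1 k; have := r1 k; lra.
Qed.

Lemma sqrt_level_var_cube k : Num.sqrt (level_var k) ^+ 3 <= 3 * level_err k.
Proof.
set s := Num.sqrt _; have s0 : 0 <= s by rewrite sqrtr_ge0.
have qk := q0 k; have i0 : 0 < (q k)^-1 by rewrite invr_gt0.
have s2 : s ^+ 2 <= 2 * r k * (q k)^-1 ^+ 2.
  rewrite sqr_sqrtr ?level_var_ge0// /level_var -exprVn ler_wpM2r ?exprn_ge0 ?(ltW i0)//.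
  by have := r0 k; have := q0 k; have := r1 k; nra.
(* The factor 3 of the lemma splits as [2 * (3 / 2)]; [3 / 2] works because [r k <= 1] and
   [2 <= (3 / 2) ^+ 2]. *)
have s1 : s <= 3 / 2 * (q k)^-1.
  rewrite -(@ler_pXn2r _ 2) ?nnegrE ?mulr_ge0 ?(ltW i0)//; apply: le_trans s2 _.
  rewrite exprMn ler_wpM2r ?exprn_ge0 ?(ltW i0)//.
  by have := r1 k; lra.
have -> : s ^+ 3 = s ^+ 2 * s by ring.
have -> : 3 * level_err k = (2 * r k * (q k)^-1 ^+ 2) * (3 / 2 * (q k)^-1).
  by rewrite /level_err; field; rewrite gt_eqF.
by apply: ler_pM => //; exact: sqr_ge0.
Qed.

Lemma gcube_ge0 : 0 <= @gcube R.
Proof.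
rewrite /gcube -[leLHS](gmean_cst 0); apply: le_gmean; [exact: gint_cst|exact: gint_cube|].
by move=> z; rewrite exprn_ge0.
Qed.

(** Induction on the number of levels, the later ones being already replaced by a normal variable of
    variance [V]. [level_op] does not increase uniform distances, so their error passes through
    level [k] unchanged ([step1]). Level [k] and a normal variable of the same mean and variance
    have the same second-order expansion on [G] ([step2], [step3]), with errors 7 from
    [level_op_taylor] and [3 * gcube] from [sqrt_level_var_cube]. *)
Lemma lindeberg L C g g1 g2 : 0 <= C -> test_fun L C g g1 g2 -> forall n k x,
  `|levels_op k n g x - gsmooth (\sum_(k <= i < k + n) level_var i) g
      (x + \sum_(k <= i < k + n) level_mean i)|
  <= C * (7 + 3 * gcube) * \sum_(k <= i < k + n) level_err i.
Proof.
move=> C0 tg.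
have mg : measurable_fun setT g by apply: continuous_measurable_fun; exact: test_fun_continuous tg.
have g01 := test_bnd tg.
have gn y : `|g y| <= 1 by have /andP[? ?] := g01 y; rewrite ger0_norm.
elim=> [|n IH] k x.
  rewrite addn0 !big_geq// mulr0 addr0 normr_le0 subr_eq0 /= /gsmooth sqrtr0.
  by under eq_fun do rewrite mul0r addr0; rewrite gmean_cst.
have kn : (k < k.+1 + n)%N by rewrite addSn ltnS leq_addr.
rewrite addnS -addSn !(big_ltn kn) /=.
set V := \sum_(_ <= i < _) level_var i; set M := \sum_(_ <= i < _) level_mean i.
set E := \sum_(_ <= i < _) level_err i.
set G := gsmooth V g.
have V0 : 0 <= V by apply: sumr_ge0 => i _; exact: level_var_ge0.
have G01 := gsmooth_bnd V mg g01.
have Gn y : `|G y| <= 1 by have /andP[? ?] := G01 y; rewrite ger0_norm.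
have mG : measurable_fun setT G.
  apply: continuous_measurable_fun; apply: lip_continuous.
  exact: gsmooth_lip mg gn (test_lip tg).
have on y : `|levels_op k.+1 n g y| <= 1.
  by have /andP[? ?] := levels_op_bnd n k.+1 g01 y; rewrite ger0_norm.
have step1 : `|level_op (r k) (q k) (levels_op k.+1 n g) x -
    level_op (r k) (q k) (fun y => G (y + M)) x| <= C * (7 + 3 * gcube) * E.
  apply: (level_op_dist _ (q0 k) (q1 k) (r0 k) (r1 k) on) => y; [exact: Gn|exact: IH].
have GT := gsmooth_expand V tg; rewrite -/G in GT.
set z := x + (level_mean k + M).
have step2 : `|level_op (r k) (q k) (fun y => G (y + M)) x - G z -
    level_var k / 2 * gsmooth V g2 z| <= 7 * C * level_err k.
  have := @level_op_taylor (r k) (q k) x (gsmooth V g1 z) (gsmooth V g2 z) C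
    (fun y => G (y + M)) (q0 k) (q1 k) (r0 k) (r1 k) C0 (fun=> G01 _).
  have Eh h : x + r k / q k + h + M = z + h by rewrite /z /level_mean; ring.
  have E0 : x + r k / q k + M = z by rewrite /z /level_mean; ring.
  by rewrite /= E0 => H; apply: H => h; rewrite Eh.
have step3 : `|gsmooth (level_var k) G z - G z - level_var k / 2 * gsmooth V g2 z|
    <= C * gcube * Num.sqrt (level_var k) ^+ 3.
  by apply: (gsmooth_taylor (B := 1)) (GT z) => //; exact: level_var_ge0.
have step4 : C * gcube * Num.sqrt (level_var k) ^+ 3 <= C * gcube * (3 * level_err k).
  by rewrite ler_wpM2l ?mulr_ge0 ?gcube_ge0// sqrt_level_var_cube.
have -> : gsmooth (level_var k + V) g z = gsmooth (level_var k) G z.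
  rewrite /G (@gsmooth_semigroup R (level_var k) V z 1 g)//; first exact: level_var_ge0.
  exact: test_fun_continuous tg.
move: step1 step2 step3 step4.
move: (level_op _ _ _ _) (level_op _ _ _ _) (gsmooth (level_var k) G z) (G z) => a b c d.
move: (level_var k / 2 * _) (Num.sqrt _ ^+ 3) (level_err k) => e f h.
have -> : C * (7 + 3 * gcube) * (h + E) = C * (7 + 3 * gcube) * E + (7 * C * h +  C * gcube * (3 * h)) by ring.
move: (C * (7 + 3 * gcube) * E) (7 * C * h) (C * gcube * _) (C * gcube * _) => s1 s2 s3 s4.
rewrite !ler_norml => /andP[? ?] /andP[? ?] /andP[? ?] ?.
by apply/andP; split; lra.
Qed.

End lindeberg.

(** * The normal distribution function *)

Section normal_cdf.
Context {R : realType}.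
Notation mu := (@lebesgue_measure R).
Notation phi := (normal_pdf (0 : R) 1).
Implicit Types (h : R -> R).

Definition normal_cdf (x : R) : R := fine (normal_prob (0 : R) 1 `]-oo, x]).

Lemma normal_cdfE x : normal_cdf x = gmean (\1_`]-oo, x]).
Proof.
rewrite /normal_cdf /normal_prob /gmean /Rintegral; congr fine.
rewrite [LHS]integral_mkcond; apply: eq_integral => z _.
by rewrite patchE indicE; case: ifPn => _; rewrite ?mul1r ?mul0r.
Qed.

Let gint_indic (A : set R) : measurable A -> gint (\1_A : R -> R).
Proof.
move=> mA; apply: (@gint_bounded _ _ 1); first exact: measurable_indic.
by move=> z; rewrite ger0_norm// indicE lern1 leq_b1.
Qed.

Lemma gmean_le_cdf h (y k : R) : measurable_fun setT h -> 0 <= k ->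
  (forall z, 0 <= h z <= 1) -> (forall z, y < z -> h z <= k) ->
  gmean h <= normal_cdf y + k.
Proof.
move=> mh k0 h01 hk.
have ih : gint h.
  apply: (@gint_bounded _ _ 1) => // z.
  by have /andP[? ?] := h01 z; rewrite ger0_norm.
have i1 : gint (\1_`]-oo, y] : R -> R) by exact: gint_indic.
rewrite normal_cdfE -[X in _ + X]gmean_cst -(gmeanD i1 (gint_cst k)).
apply: le_gmean => // [|z]; first exact: gintD i1 (gint_cst k).
rewrite indicE; have [zy|yz] := leP z y.
  by rewrite mem_set ?in_itv//=; have /andP[_ ?] := h01 z; apply: ler_wpDr.
by rewrite memNset ?add0r ?hk//= in_itv/= leNgt yz.
Qed.

Lemma gmean_le_ccdf h (y k : R) : measurable_fun setT h -> 0 <= k ->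
  (forall z, 0 <= h z <= 1) -> (forall z, z <= y -> h z <= k) ->
  gmean h <= 1 - normal_cdf y + k.
Proof.
move=> mh k0 h01 hk.
have ih : gint h.
  apply: (@gint_bounded _ _ 1) => // z.
  by have /andP[? ?] := h01 z; rewrite ger0_norm.
have i1 : gint (\1_`]-oo, y] : R -> R) by exact: gint_indic.
have i2 := gintB (gint_cst 1) i1.
rewrite normal_cdfE -[X in X - _](gmean_cst 1) -[X in _ + X]gmean_cst.
rewrite -(gmeanB (gint_cst 1) i1) -(gmeanD i2 (gint_cst k)).
apply: le_gmean => // [|z]; first exact: gintD i2 (gint_cst k).
rewrite indicE; have [zy|yz] := leP z y.
  by rewrite mem_set ?in_itv//= subrr add0r hk.
rewrite memNset ?subr0; last by rewrite /= in_itv/= leNgt yz.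
by have /andP[_ ?] := h01 z; apply: ler_wpDr.
Qed.

Lemma normal_cdf_lip (x y : R) : x <= y ->
  normal_cdf y <= normal_cdf x + normal_peak (1 : R) * (y - x).
Proof.
move=> xy.
have fp z : normal_prob (0 : R) 1 `]-oo, z] \is a fin_num.
  by apply: fin_num_measure; exact: measurable_itv.
rewrite -lee_fin EFinD /normal_cdf !fineK//.
rewrite (_ : `]-oo, y]%classic = `]-oo, x] `|` `]x, y]); last first.
  by rewrite -itv_bndbnd_setU//= bnd_simp.
rewrite measureU//=; last first.
  apply/seteqP; split => // z /= []; rewrite !in_itv/= => zx /andP[xz _].
  by move: (lt_le_trans xz zx); rewrite ltxx.
rewrite leeD2l// /normal_prob.
apply: (@le_trans _ _ (\int[mu]_(z in `]x, y]) (normal_peak (1 : R))%:E)%E).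
  apply: ge0_le_integral => //=.
  - by move=> z _; rewrite lee_fin normal_pdf_ge0.
  - by apply/measurable_EFinP/measurable_funTS; exact: measurable_normal_pdf.
  - by move=> z _; rewrite lee_fin normal_pdf_ub// oner_eq0.
by rewrite integral_cst//= lebesgue_measure_itv/= lte_fin; case: ltP => [_|yx];
  [rewrite -EFinM|have -> : y = x by [apply/eqP; rewrite eq_le yx xy]; rewrite mule0 subrr mulr0].
Qed.

Lemma normal_cdf_01 (x : R) : 0 <= normal_cdf x <= 1.
Proof.
have mi : measurable (`]-oo, x]%classic : set R) by exact: measurable_itv.
rewrite /normal_cdf fine_ge0 ?measure_ge0//= -lee_fin fineK ?fin_num_measure//.
exact: probability_le1.
Qed.

End normal_cdf.

(** * Tails, telescoping sums and the Markov chain of records *)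

Section tail.
Context {R : realType}.
Variable p : nat -> R.
Hypothesis p0 : forall k, 0 < p k.
Hypothesis p1 : series p @ \oo --> (1 : R).

(** This is P[X >= k], that is y_(k-1). The shift of index makes the value 1 at 0 cover the
    convention for negative indices. *)
Definition upper (k : nat) : R := 1 - \sum_(i < k) p i.

Notation Y := upper.

Lemma upper0 : Y 0 = 1. Proof. by rewrite /upper big_ord0 subr0. Qed.

Lemma upperS k : Y k.+1 = Y k - p k.
Proof. by rewrite /upper big_ord_recr /= opprD addrA. Qed.

Lemma upperE k : Y k = 1 - series p k.
Proof. by rewrite /upper /series/= big_mkord. Qed.

Lemma cvg_upper : Y @ \oo --> (0 : R).
Proof.
rewrite (_ : Y = fun k => 1 - series p k); last by apply/funext => k; rewrite upperE.
by rewrite -[X in _ --> X](subrr 1); apply: cvgB => //; exact: cvg_cst.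
Qed.

Lemma upper_lt k : Y k.+1 < Y k. Proof. by rewrite upperS ltrBlDr ltrDl. Qed.

Lemma upper_anti i j : (i <= j)%N -> Y j <= Y i.
Proof.
by move=> /subnK <-; elim: (j - i)%N => // n IH; rewrite addSn (le_trans _ IH)// ltW// upper_lt.
Qed.

Lemma upper_gt0 k : 0 < Y k.
Proof.
apply: le_lt_trans (upper_lt k); rewrite leNgt; apply/negP => Yk.
have /cvgrPdist_lt /(_ (- Y k.+1)) := cvg_upper; rewrite oppr_gt0 => /(_ Yk) [m _ H].
have := H (maxn m k.+1) (leq_maxl _ _); rewrite /= sub0r ltNge => /negP; apply.
have Ym : Y (maxn m k.+1) <= Y k.+1 by apply: upper_anti; exact: leq_maxr.
by rewrite normrN ltr0_norm ?(le_lt_trans Ym)// lerN2.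
Qed.

Lemma upper_le1 k : Y k <= 1. Proof. by rewrite -upper0 upper_anti. Qed.

Lemma sum_pE i j : (i <= j)%N -> \sum_(i <= k < j) p k = Y i - Y j.
Proof.
move=> ij; rewrite !upperE opprB addrC addrA subrK.
by rewrite -sub_series_geq// addrC.
Qed.

Lemma ytailE k : ytail p k = Y k.+1.
Proof.
apply: cvg_lim => //; rewrite /upper -(big_mkord predT p).
have H : (fun n => series p n - \sum_(0 <= i < k.+1) p i) @ \oo --> 1 - \sum_(0 <= i < k.+1) p i.
  by apply: cvgB => //; exact: cvg_cst.
apply: cvg_trans H; apply: near_eq_cvg; near=> n.
have kn : (k.+1 <= n)%N by near: n; exact: nbhs_infty_ge.
by rewrite -(sub_series_geq _ kn).
Unshelve. all: by end_near. Qed.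

(** Truncated subtraction reproduces the convention: whenever [k - d] is negative, [k.+1 - d] is 0
    and [upper] equals 1 there. *)
Lemma yz_nat k d : yz p (k%:Z - d%:Z)%R = Y (k.+1 - d).
Proof.
have [kd|dk] := ltnP k d.
  have -> : (k%:Z - d%:Z)%R = Negz (d - k.+1) by lia.
  have -> : (k.+1 - d = 0)%N by lia.
  by rewrite upper0.
have -> : (k%:Z - d%:Z)%R = Posz (k - d) by lia.
by rewrite /= ytailE subSn.
Qed.

Lemma pz_nat k d : pz p (k%:Z - d%:Z)%R = Y (k - d) - Y (k.+1 - d).
Proof.
have [kd|dk] := ltnP k d.
  have -> : (k%:Z - d%:Z)%R = Negz (d - k.+1) by lia.
  have -> : (k.+1 - d = 0)%N by lia.
  have -> : (k - d = 0)%N by lia.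
  by rewrite subrr.
have -> : (k%:Z - d%:Z)%R = Posz (k - d) by lia.
rewrite /= subSn// upperS; ring.
Qed.

Lemma rrE k : rr p k = p k / Y k.
Proof. by rewrite /rr (yz_nat k 1) subn1. Qed.

Lemma ssE k d : ss p (- d%:Z) k = (Y (k - d) - Y (k.+1 - d)) / Y k.
Proof. by rewrite /ss pz_nat (yz_nat k 1) subn1. Qed.

Variable d : nat.

(* Probability that an observation exceeding [k - d] exceeds [k]. *)
Definition exit_prob k := Y k.+1 / Y (k.+1 - d).
Definition gap_ratio k := Y (k - d) / Y k.

Notation r := (rr p).
Notation q := exit_prob.
Notation A := gap_ratio.

Lemma exit_prob_gt0 k : 0 < q k.
Proof. by rewrite divr_gt0// upper_gt0. Qed.

Lemma exit_prob_le1 k : q k <= 1.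
Proof. by rewrite ler_pdivrMr ?upper_gt0// mul1r upper_anti// leq_subr. Qed.

Lemma rr_gt0 k : 0 < r k. Proof. by rewrite rrE divr_gt0 ?upper_gt0. Qed.

Lemma rr_compl k : 1 - r k = Y k.+1 / Y k.
Proof. by rewrite rrE upperS mulrBl divff// gt_eqF// upper_gt0. Qed.

Lemma rr_lt1 k : r k < 1.
Proof. by rewrite -subr_gt0 rr_compl divr_gt0 ?upper_gt0. Qed.

Lemma exit_probV k : (q k)^-1 = A k.+1.
Proof. by rewrite /exit_prob invf_div. Qed.

Lemma gap_ratio_ge1 k : 1 <= A k.
Proof. by rewrite ler_pdivlMr ?upper_gt0// mul1r upper_anti// leq_subr. Qed.

Lemma gap_ratio0 : A 0 = 1.
Proof. by rewrite /gap_ratio sub0n divff// gt_eqF// upper_gt0. Qed.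

Lemma level_meanE k : level_mean r q k = r k * A k.+1.
Proof. by rewrite /level_mean exit_probV. Qed.

(** Each level satisfies [r k * A k.+1 = s_k + (A k.+1 - A k)]. *)
Lemma level_mean_theta n :
  \sum_(0 <= k < n) level_mean r q k = \sum_(0 <= k < n) ss p (- d%:Z) k + A n - 1.
Proof.
elim: n => [|n IH]; first by rewrite !big_geq// gap_ratio0; ring.
rewrite !big_nat_recr//= IH level_meanE ssE /gap_ratio rrE upperS.
have := upper_gt0 n; have := upper_gt0 n.+1; rewrite upperS => a b.
by field; rewrite !gt_eqF.
Qed.

(* Summing by parts turns the variance of the paper into the sum of these. *)
Definition abel_var k := ss p (- d%:Z) k * (Y (k.+1 - d) + Y (k - d) - Y k) / Y k.

Lemma level_var_abel n :
  \sum_(0 <= k < n) level_var r q k = \sum_(0 <= k < n) abel_var k + (A n ^+ 2 - A n).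
Proof.
elim: n => [|n IH]; first by rewrite !big_geq// gap_ratio0; ring.
rewrite !big_nat_recr//= IH /level_var /abel_var ssE /gap_ratio /exit_prob rrE.
have := upper_gt0 n; have := upper_gt0 n.+1; rewrite upperS => a b.
have c := upper_gt0 (n.+1 - d).
by field; rewrite !gt_eqF.
Qed.

Definition zz_term i := ss p (- d%:Z) i * (Y (i.+1 - d) + Y (i - d) - Y i).

Lemma zzE k : zz p (- d%:Z) k = limn (fun n => \sum_(k.+1 <= i < n) zz_term i).
Proof.
rewrite /zz; congr (limn _); apply/funext => n; apply: eq_bigr => i _.
rewrite /zz_term yz_nat (yz_nat i 1) subn1 /=.
by rewrite (_ : i%:Z - d%:Z - 1 = i%:Z - d.+1%:Z)%R ?yz_nat//; lia.
Qed.

Lemma zz_lim L k : series zz_term @ \oo --> L -> zz p (- d%:Z) k = L - series zz_term k.+1.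
Proof.
move=> cL; rewrite zzE; apply: cvg_lim => //.
have H : (fun n => series zz_term n - series zz_term k.+1) @ \oo --> L - series zz_term k.+1.
  by apply: cvgB => //; exact: cvg_cst.
apply: cvg_trans H; apply: near_eq_cvg; near=> n.
have kn : (k.+1 <= n)%N by near: n; exact: nbhs_infty_ge.
by rewrite -(sub_series_geq _ kn).
Unshelve. all: by end_near. Qed.

(** Summation by parts: [r k / ytail p k = 1 / Y k.+1 - 1 / Y k], and z_k is a remainder of the
    series of [zz_term]. *)
Lemma zz_abel L n : series zz_term @ \oo --> L ->
  \sum_(0 <= k < n) zz p (- d%:Z) k * r k / ytail p k =
  \sum_(0 <= k < n) abel_var k + ((L - series zz_term n) / Y n - L).
Proof.
move=> cL; elim: n => [|n IH].
  by rewrite /series/= !big_geq// subr0 upper0 divr1 subrr addr0.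
rewrite !big_nat_recr//= IH (zz_lim _ cL) ytailE seriesSr rrE /abel_var -/(zz_term n).
have := upper_gt0 n; have := upper_gt0 n.+1; rewrite upperS => a b.
by field; rewrite !gt_eqF.
Qed.

End tail.

Lemma geo_lip {R : realType} (q c L C : R) (u : nat -> R) : 0 < q -> q <= 1 ->
  (forall j, `|u j| <= C) -> (forall j, `|u j - c| <= L * (j%:R + 1)) ->
  `|geo q u - c| <= L / q.
Proof.
move=> q0 q1 uC uL.
have C0 : 0 <= C by exact: le_trans (normr_ge0 _) (uC 0%N).
have H (z : nat -> R) : (forall j, `|z j| <= C) -> forall j, `|z j| <= C * (j%:R + 1) ^+ 3.
  by move=> zC j; apply: le_trans (zC j) _; rewrite ler_peMr// exprn_ege1// lerDr.
have H1 := geo_le q0 q1 (A1 := c) (A2 := L) (A3 := 0) (lexx 0) (H _ uC).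
have uC2 j : `|- u j| <= C by rewrite normrN.
have H2 := geo_le q0 q1 (A1 := - c) (A2 := L) (A3 := 0) (lexx 0) (H _ uC2).
have {}H1 : geo q u <= c + L / q.
  rewrite -[leRHS]addr0 -[X in _ + X](mul0r (6 / q ^+ 3)) -[X in X + _]addr0.
  rewrite -[X in _ + X + _](mul0r ((2 - q) / q ^+ 2)); apply: H1 => j.
  by rewrite !mul0r !addr0; have := uL j; rewrite ler_distl => /andP[_]; lra.
have {}H2 : - geo q u <= - c + L / q.
  rewrite -(geoN q0 q1 (H _ uC)).
  rewrite -[leRHS]addr0 -[X in _ + X](mul0r (6 / q ^+ 3)) -[X in X + _]addr0.
  rewrite -[X in _ + X + _](mul0r ((2 - q) / q ^+ 2)); apply: H2 => j.
  by rewrite !mul0r !addr0; have := uL j; rewrite ler_distl => /andP[+ _]; lra.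
by rewrite ler_distl; move: H1 H2; set a := L / q; move=> *; apply/andP; split; lra.
Qed.

Section chain.
Context {R : realType}.
Variables (p : nat -> R) (d N : nat).

(* A state records the running maximum and the number of [delta]-records counted
   so far; the count is frozen once the maximum reaches [N]. *)
Definition chain_step (s : nat * nat) (x : nat) : nat * nat :=
  if (N <= s.1)%N then s else if (N <= x)%N then (N, s.2)
  else (maxn s.1 x, s.2 + (s.1 < x + d))%N.

(** Expectation after [n] steps. All observations at least [N] act alike on the chain, so they form
    a single outcome of weight [upper p N] and the sum is finite. *)
Fixpoint chain_mean n (f : nat * nat -> R) s : R :=
  if n is n'.+1 then
    \sum_(0 <= x < N) p x * chain_mean n' f (chain_step s x) +
    upper p N * chain_mean n' f (chain_step s N)
  else f s.

Hypothesis p0 : forall k, 0 < p k.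
Hypothesis p1 : series p @ \oo --> (1 : R).
Notation Y := (upper p).
Notation r := (rr p).
Notation q := (exit_prob p d).

Lemma le_chain_mean n f1 f2 s : (forall s, f1 s <= f2 s) ->
  chain_mean n f1 s <= chain_mean n f2 s.
Proof.
move=> f12; elim: n s => [|n IH] s //=; apply: lerD.
  by apply: ler_sum => x _; rewrite ler_wpM2l// ltW.
by rewrite ler_wpM2l// ltW// upper_gt0.
Qed.

Lemma chain_mean_affine n f a b s :
  chain_mean n (fun s => a * f s + b) s = a * chain_mean n f s + b.
Proof.
elim: n s => [|n IH] s //=.
rewrite IH; under eq_bigr do rewrite IH mulrDr mulrCA.
rewrite big_split/= -mulr_sumr -mulr_suml (sum_pE p)// upper0; ring.
Qed.

Variable g : R -> R.
Hypothesis g01 : forall x, 0 <= g x <= 1.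

Let F k := levels_op r q k (N - k) g.

(** The current level has already received its first record. By lack of memory the number of records
    still due there is geometric from 0, whereas each later level, if visited, starts with one
    record, as in [level_op]. *)
Definition chain_value (s : nat * nat) : R :=
  if (s.1 < N)%N then geo (q s.1) (fun j => F s.1.+1 (s.2%:R + j%:R)) else g s.2%:R.

Let q0 := exit_prob_gt0 p0 p1 d.
Let q1 := exit_prob_le1 p0 p1 d.
Let r0 k : 0 <= r k. Proof. by rewrite ltW// rr_gt0. Qed.
Let r1 k : r k <= 1. Proof. by rewrite ltW// rr_lt1. Qed.

Let F_bnd k x : `|F k x| <= 1.
Proof.
have /andP[a b] := levels_op_bnd q0 q1 r0 r1 (N - k) k g01 x.
by rewrite ger0_norm.
Qed.

Let F_rec k x : (k < N)%N ->
  F k x = (1 - r k) * F k.+1 x + r k * geo (q k) (fun j => F k.+1 (x + 1 + j%:R)).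
Proof. by move=> kN; rewrite /F -(subnSK kN). Qed.

(** Here the jumps of the maximum become independent levels: a variable of law [p] conditioned to be
    at least [j] is the index of the first success in independent trials of probabilities [r j],
    [r j.+1], and so on. A success below [N] is itself a record, hence [c.+1]; reaching [N] freezes
    the count at [c]. *)
Let F_sum c j : (j <= N)%N ->
  \sum_(j <= x < N) p x * chain_value (x, c.+1) + Y N * g c%:R = Y j * F j c%:R.
Proof.
elim/ltn_ind: (N - j)%N {-2}j (erefl (N - j)%N) => n IH {}j nE; rewrite leq_eqVlt.
case/predU1P=> [->|jN]; first by rewrite big_geq// add0r /F subnn.
rewrite big_ltn// -addrA (IH (N - j.+1)%N)//; last by lia.
rewrite (F_rec _ jN) /chain_value /= jN -natr1.
have -> : 1 - r j = Y j.+1 / Y j by rewrite rr_compl.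
rewrite rrE //; have := upper_gt0 p0 p1 j; move=> Yj.
by field; rewrite gt_eqF.
Qed.

Lemma chain_value_step s :
  \sum_(0 <= x < N) p x * chain_value (chain_step s x) +
    Y N * chain_value (chain_step s N) = chain_value s.
Proof.
case: s => k c; rewrite /chain_step /= leqnn.
case: leqP => [Nk|kN].
  rewrite -mulr_suml (sum_pE p)// upper0; ring.
have k1 : (k.+1 - d <= k.+1)%N by exact: leq_subr.
have kN1 : (k.+1 - d <= N)%N by lia.
(* An observation below [k.+1 - d] changes nothing, one from there up to [k] is a record that keeps
   the level, and one above [k] opens a new level. *)
rewrite (big_cat_nat (leq0n _) kN1) /= (big_cat_nat k1 kN) /=.
set S1 := \sum_(_ <= _ < _) _; set S2 := \sum_(_ <= _ < _) _; set S3 := \sum_(_ <= _ < _) _.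
have -> : S1 = (1 - Y (k.+1 - d)) * chain_value (k, c).
  rewrite /S1 -(upper0 p) -(sum_pE p)// mulr_suml; apply: eq_big_nat => x /andP[_ xk].
  have xN : (x < N)%N by lia.
  have kx : (k < x + d)%N = false by lia.
  have mx : maxn k x = k by lia.
  by rewrite leqNgt xN /= kx mx addn0.
have -> : S2 = (Y (k.+1 - d) - Y k.+1) * chain_value (k, c.+1).
  rewrite /S2 -(sum_pE p)// mulr_suml; apply: eq_big_nat => x /andP[kx xk].
  have xN : (x < N)%N by lia.
  have kd : (k < x + d)%N by lia.
  have mx : maxn k x = k by lia.
  by rewrite leqNgt xN /= kd mx addn1.
have -> : S3 = \sum_(k.+1 <= x < N) p x * chain_value (x, c.+1).
  apply: eq_big_nat => x /andP[kx xN].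
  have kd : (k < x + d)%N by lia.
  have mx : maxn k x = x by lia.
  by rewrite leqNgt xN /= kd mx addn1.
have -> : chain_value (N, c) = g c%:R by rewrite /chain_value ltnn.
have FS : S3 = S3 by [].
rewrite -addrA -addrA F_sum//.
rewrite /chain_value /= kN.
(* Given that an observation is at least [k.+1 - d], it leaves the level with probability [q k]:
   this is the first trial of the geometric variable. *)
have E := geo_shift (q0 k) (q1 k) (u := fun j => F k.+1 (c%:R + j%:R)) (fun=> F_bnd _ _).
set G := geo _ (fun j => F _ (c%:R + _)) in E *.
have E2 : geo (q k) (fun j => F k.+1 (c.+1%:R + j%:R)) =
   geo (q k) (fun j => F k.+1 (c%:R + j.+1%:R)).
  by congr geo; apply/funext => j; rewrite -!natr1 addrAC addrA.
rewrite E2; move: E; rewrite addr0; move: (geo _ _) => G' E.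
have Yk := upper_gt0 p0 p1 (k.+1 - d).
have {}E : Y (k.+1 - d) * G = Y k.+1 * F k.+1 c%:R + (Y (k.+1 - d) - Y k.+1) * G'.
  by rewrite E /exit_prob; field; rewrite gt_eqF.
rewrite mulrBl E; ring.
Qed.

Lemma chain_mean_value n s : chain_mean n chain_value s = chain_value s.
Proof.
elim: n s => [|n IH] s //=; rewrite IH.
by under eq_bigr do rewrite IH; exact: chain_value_step.
Qed.

(** The initial maximum 0 makes level 0 look visited before any observation. For [d > 0] one has
    [q 0 = 1 - r 0], and a geometric variable from 0 with this parameter is a Bernoulli([r 0])
    variable times one plus an independent copy of itself, so level 0 has the same form as the
    others. *)
Lemma chain_value0 : (0 < d)%N -> (0 < N)%N -> chain_value (0%N, 0%N) = levels_op r q 0 N g 0.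
Proof.
move=> d0 N0; rewrite /chain_value /= N0 -[N in RHS]subn0 -/(F 0) (F_rec _ N0).
have := geo_shift (q0 0) (q1 0) (u := fun j => F 1 (0 + j%:R)) (fun=> F_bnd _ _).
rewrite addr0 => ->; have -> : q 0 = 1 - r 0.
  have e : (1 - d = 0)%N by lia.
  by rewrite rr_compl// /exit_prob e upper0 divr1.
have -> : 1 - (1 - r 0) = r 0 by ring.
congr (_ + _ * geo _ _).
by apply/funext => j; rewrite -natr1 [j%:R + 1]addrC addrA.
Qed.

Variable L : R.
Hypothesis L0 : 0 <= L.
Hypothesis gL : forall x h, `|g (x + h) - g x| <= L * `|h|.

Let g_bnd x : `|g x| <= 1.
Proof. by have /andP[? ?] := g01 x; rewrite ger0_norm. Qed.

Let geo_g k x : `|geo (q k) (fun j => g (x + j%:R)) - g x| <= L / q k.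
Proof.
apply: (@geo_lip _ _ _ _ 1) => // j; apply: le_trans (gL _ _) _.
by rewrite ger0_norm// ler_wpM2l// lerDl.
Qed.

Let geo_g1 k x : `|geo (q k) (fun j => g (x + 1 + j%:R)) - g x| <= L / q k.
Proof.
apply: (@geo_lip _ _ _ _ 1) => // j.
by rewrite -addrA; apply: le_trans (gL _ _) _; rewrite ger0_norm ?addr_ge0// [1 + _]addrC.
Qed.

Let F_dist k x : (k <= N)%N ->
  `|F k x - g x| <= L * \sum_(k <= i < N) level_mean r q i.
Proof.
elim/ltn_ind: (N - k)%N {-2}k x (erefl (N - k)%N) => n IH {}k x nE; rewrite leq_eqVlt.
case/predU1P=> [->|kN]; first by rewrite big_geq// mulr0 /F subnn subrr normr0.
rewrite big_ltn// mulrDr.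
have -> : F k x = level_op (r k) (q k) (F k.+1) x by rewrite F_rec.
have a : `|level_op (r k) (q k) (F k.+1) x - level_op (r k) (q k) g x| <=
    L * \sum_(k.+1 <= i < N) level_mean r q i.
  apply: (level_op_dist _ (q0 k) (q1 k) (r0 k) (r1 k) (F_bnd _) g_bnd) => y.
  by apply: (IH (N - k.+1)%N) => //; lia.
have b : `|level_op (r k) (q k) g x - g x| <= L * level_mean r q k.
  have -> : level_op (r k) (q k) g x - g x =
    r k * (geo (q k) (fun j => g (x + 1 + j%:R)) - g x) by rewrite /level_op; ring.
  by rewrite normrM (ger0_norm (r0 k)) /level_mean mulrCA ler_wpM2l.
apply: le_trans (ler_distD (level_op (r k) (q k) g x) _ _) _.
by rewrite addrC lerD.
Qed.

(** The Lipschitz bound turns mean counts into errors: [1 / q k] for the records still due at the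
    current level, the sum for the later levels. *)
Lemma chain_value_dist k c : (k < N)%N ->
  `|chain_value (k, c) - g c%:R| <=
  L * ((q k)^-1 + \sum_(k.+1 <= i < N) level_mean r q i).
Proof.
move=> kN; rewrite /chain_value /= kN mulrDr.
have a : `|geo (q k) (fun j => F k.+1 (c%:R + j%:R)) - geo (q k) (fun j => g (c%:R + j%:R))|
    <= L * \sum_(k.+1 <= i < N) level_mean r q i.
  by apply: (@geo_dist _ _ (q0 k) (q1 k) _ _ 1) => // j; exact: F_dist.
apply: le_trans (ler_distD (geo (q k) (fun j => g (c%:R + j%:R))) _ _) _.
by rewrite addrC lerD.
Qed.

Lemma chain_value_ge0 s : 0 <= chain_value s.
Proof.
rewrite /chain_value; case: ifP => _; last by have /andP[] := g01 s.2%:R.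
rewrite /geo; apply: limr_ge.
  apply: (geo_cvg (q0 s.1) (q1 s.1) (C := 1)) => j; apply: le_trans (F_bnd _ _) _.
  by rewrite mul1r exprn_ege1// lerDr.
near=> n; rewrite /series/=; apply: sumr_ge0 => j _.
rewrite mulr_ge0//; first by rewrite /geo_weight mulr_ge0 ?(ltW (q0 _))// exprn_ge0// subr_ge0.
by have /andP[] := levels_op_bnd q0 q1 r0 r1 (N - s.1.+1) s.1.+1 g01 (s.2%:R + j%:R).
Unshelve. all: by end_near. Qed.

End chain.

(** * Law of the chain *)

Section run.
Variables (T : Type) (X : nat -> T -> nat).

Fixpoint run (S : Type) (f : S -> nat -> S) (s : S) (i n : nat) (t : T) : S :=
  if n is n'.+1 then run f (f s (X i t)) i.+1 n' t else s.

Lemma runS (S : Type) (f : S -> nat -> S) s i n t :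
  run f s i n.+1 t = f (run f s i n t) (X (i + n)%N t).
Proof.
by elim: n s i => [|n IH] s i; [rewrite /= addn0|rewrite -addSnnS -IH].
Qed.

Definition record_step (d : nat) (s : nat * nat) (x : nat) : nat * nat :=
  (maxn s.1 x, s.2 + (s.1 < x + d))%N.

Lemma run_record d n t :
  run (record_step d) (0, 0)%N 0 n t = (Mx X n t, Nrec X (- d%:Z) n t).
Proof.
elim: n => [|n IH]; first by rewrite /Mx /Nrec !big_ord0.
rewrite runS IH /record_step /= /Mx /Nrec !big_ord_recr /= add0n.
congr (_, _ + nat_of_bool _)%N; rewrite -/(Mx X n t); lia.
Qed.

Lemma run_chain d N n t : (Mx X n t < N)%N ->
  run (chain_step d N) (0, 0)%N 0 n t = (Mx X n t, Nrec X (- d%:Z) n t).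
Proof.
rewrite -run_record; elim: n => [//|n IH].
have -> : Mx X n.+1 t = maxn (Mx X n t) (X n t) by rewrite /Mx big_ord_recr.
rewrite gtn_max => /andP[MN XN]; rewrite !runS IH// run_record add0n.
by rewrite /chain_step /record_step /= leqNgt MN /= leqNgt XN.
Qed.

Lemma Mx_ltP n J t : (0 < J)%N ->
  reflect (forall i, (i < n)%N -> (X i t < J)%N) (Mx X n t < J)%N.
Proof.
case: J => // J _; rewrite ltnS; apply: (iffP (bigmax_leqP _ _ _)) => H i.
  by move=> iN; exact: (H (Ordinal iN)).
by move=> _; rewrite -ltnS H.
Qed.

End run.

Section law.
Context {R : realType} {dT : measure_display} {T : measurableType dT}.
Variables (P : probability T R) (X : nat -> T -> nat) (p : nat -> R).
Hypothesis mX : forall i k, measurable (X i @^-1` [set k]).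
Hypothesis indX : mutually_independent P X.
Hypothesis lawX : forall i k, P (X i @^-1` [set k]) = (p k)%:E.
Hypothesis p0 : forall k, 0 < p k.

Notation pr E := (fine (P E)).

Lemma prE E : measurable E -> P E = (pr E)%:E.
Proof. by move=> mE; rewrite fineK// fin_num_measure. Qed.

Lemma measurable_obs i (B : set nat) : measurable (X i @^-1` B).
Proof.
rewrite (_ : X i @^-1` B = \bigcup_(k in B) (X i @^-1` [set k])); last first.
  by apply/seteqP; split => t /=; [move=> Bt; exists (X i t)|move=> [k Bk /= ->]].
by apply: bigcup_measurable.
Qed.

Lemma measurable_run S (f : S -> nat -> S) (Q : set S) n s i :
  measurable [set t | Q (run X f s i n t)].
Proof.
elim: n s i => [|n IH] s i /=.
  have [Qs|nQs] := pselect (Q s).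
    by rewrite (_ : [set _ | _] = setT)//; apply/seteqP; split.
  by rewrite (_ : [set _ | _] = set0)//; apply/seteqP; split.
rewrite (_ : [set _ | _] = \bigcup_k (X i @^-1` [set k] `&`
    [set t | Q (run X f (f s k) i.+1 n t)])); last first.
  apply/seteqP; split => t /=; first by move=> Qt; exists (X i t).
  by move=> [k _ [/= ->]].
by apply: bigcup_measurable => k _; exact: measurableI.
Qed.

Lemma pr_lt i J : pr (X i @^-1` [set x | (x < J)%N]) = \sum_(x < J) p x.
Proof.
rewrite (_ : _ @^-1` _ = \big[setU/set0]_(x < J) (X i @^-1` [set (x : nat)])).
  have tX : trivIset setT (fun k => X i @^-1` [set k]).
    by apply/trivIsetP => a b _ _ ab; apply/seteqP; split => // t /= [xa xb]; move: ab; rewrite -xa -xb eqxx.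
  rewrite (measure_bigsetU P (mX i) tX J).
  rewrite (eq_bigr (fun k : 'I_J => (p k)%:E)) ?sumEFin// => k _; exact: lawX.
rewrite -(bigcup_mkord J (fun k => X i @^-1` [set k])); apply/seteqP; split => t /=; first by move=> XJ; exists (X i t).
by move=> [k /= kJ ->].
Qed.

Lemma cvg_law : series p @ \oo --> (1 : R).
Proof.
have /= := @measure_semi_sigma_additive _ _ _ P (fun k => X 0%N @^-1` [set k]) (mX 0%N).
have tX : trivIset setT (fun k => X 0%N @^-1` [set k]).
  by apply/trivIsetP => a b _ _ ab; apply/seteqP; split => // t /= [xa xb]; move: ab; rewrite -xa -xb eqxx.
have UT : \bigcup_k (X 0%N @^-1` [set k]) = setT.
  by apply/seteqP; split => // t _; exists (X 0%N t).
rewrite UT probability_setT => /(_ tX measurableT).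
rewrite (_ : (fun n => _) = EFin \o series p); last first.
  apply/funext => n /=; rewrite /series /= -sumEFin.
  by apply: eq_bigr => k _; exact: lawX.
by move/fine_cvgP => [].
Qed.

Let p1 := cvg_law.

Lemma pr_ge i J : pr (X i @^-1` [set x | (J <= x)%N]) = upper p J.
Proof.
have -> : X i @^-1` [set x | (J <= x)%N] = ~` (X i @^-1` [set x | (x < J)%N]).
  apply/seteqP; split => t /=; first by rewrite leqNgt => /negP.
  by move/negP; rewrite -leqNgt.
have m := measurable_obs i [set x | (x < J)%N].
by rewrite probability_setC// (prE m) -EFinB/= pr_lt.
Qed.

Lemma pr_indep i (B : nat -> set nat) :
  P (\big[setI/setT]_(0 <= j < i) (X j @^-1` B j)) =
  (\prod_(0 <= j < i) pr (X j @^-1` B j))%:E.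
Proof.
rewrite indX ?iota_uniq//.
rewrite (big_morph EFin (id1 := 1%E) (op1 := *%E) EFinM (erefl _))//.
by apply: eq_bigr => j _; rewrite prE//; exact: measurable_obs.
Qed.

Lemma pr_max_lt n J : (0 < J)%N ->
  pr [set t | (Mx X n t < J)%N] = (1 - upper p J) ^+ n.
Proof.
move=> J0.
rewrite (_ : [set _ | _] = \big[setI/setT]_(0 <= j < n) (X j @^-1` [set x | (x < J)%N])).
  rewrite pr_indep /= -[n in _ ^+ n]subn0 -prodr_const_nat.
  by apply: eq_bigr => j _; rewrite pr_lt /upper subKr.
rewrite big_mkord -(bigcap_mkord n (fun j => X j @^-1` [set x | (x < J)%N])).
apply/seteqP; split => t /=; first by move/Mx_ltP => H j /= jn; exact: H.
by move=> H; apply/Mx_ltP.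
Qed.

Lemma measurable_max n (Q : set nat) : measurable [set t | Q (Mx X n t)].
Proof.
have := @measurable_run _ (record_step 0) [set s | Q s.1] n (0, 0)%N 0.
by congr measurable; apply/seteqP; split => t /=; rewrite run_record.
Qed.

Lemma pr_max_lt_le n J : pr [set t | (Mx X n t < J)%N] <= (1 - upper p J) ^+ n.
Proof.
have [->|J0] := posnP J; last by rewrite pr_max_lt.
rewrite (_ : [set _ | _] = set0) ?measure0 /=.
  by rewrite exprn_ge0// upper0 subrr.
by apply/seteqP; split => t.
Qed.

Variables (d N : nat).

Let cell (x : nat) : set nat :=
  if (x < N)%N then [set x] else [set y | (N <= y)%N].

Let pr_cell i x : pr (X i @^-1` cell x) = if (x < N)%N then p x else upper p N.
Proof. by rewrite /cell; case: ifP => _; [rewrite lawX|rewrite pr_ge]. Qed.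

Let chain_step_cell s x y : cell x y -> chain_step d N s y = chain_step d N s (minn x N).
Proof.
rewrite /cell /chain_step; case: ltnP => xN /= => [->//|Ny].
by rewrite leqnn Ny.
Qed.

Let split_cells i E : measurable E ->
  P E = (\sum_(0 <= x < N.+1) P (E `&` (X i @^-1` cell x)))%E.
Proof.
move=> mE; have mF x : measurable (E `&` (X i @^-1` cell x)).
  by apply: measurableI => //; exact: measurable_obs.
have cellN x y : (x <= N)%N -> cell x y -> minn y N = x.
  rewrite leq_eqVlt /cell => /predU1P[->|xN]; first by rewrite ltnn => /= /minn_idPr.
  by rewrite xN => /= ->; exact/minn_idPl/ltnW.
pose F x := if (x <= N)%N then E `&` (X i @^-1` cell x) else set0.
have mF' x : measurable (F x) by rewrite /F; case: ifP.
have tF : trivIset setT F.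
  apply/trivIsetP => a b _ _ ab; apply/seteqP; split => // t; rewrite /F.
  case: ifP => [aN|_ []//]; case: ifP => [bN|_ []//] [[_ ca] [_ cb]].
  by move: ab; rewrite -(cellN _ _ aN ca) -(cellN _ _ bN cb) eqxx.
have -> : (\sum_(0 <= x < N.+1) P (E `&` (X i @^-1` cell x)) = \sum_(x < N.+1) P (F x))%E.
  by rewrite big_mkord; apply: eq_bigr => x _; rewrite /F -ltnS ltn_ord.
rewrite -(measure_bigsetU P mF' tF N.+1) -(bigcup_mkord N.+1 F); congr (P _).
apply/seteqP; split => t.
  move=> Et; exists (minn (X i t) N); first by rewrite /= ltnS geq_minr.
  rewrite /F geq_minr; split => //=; rewrite /cell.
  by case: (ltnP (X i t) N) => XN; rewrite ?XN ?ltnn.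
by move=> [x /= _]; rewrite /F; case: ifP => // _ [].
Qed.

(** This replaces the Markov property. Constraints on the observations before [i] are carried along,
    because independence is available for cylinders only; each induction step moves one observation
    into the cylinder, and the base case is [pr_indep]. *)
Lemma chain_law n s i (Q : set (nat * nat)) (B : nat -> set nat) :
  P (\big[setI/setT]_(0 <= j < i) (X j @^-1` B j) `&`
     [set t | Q (run X (chain_step d N) s i n t)]) =
  ((\prod_(0 <= j < i) pr (X j @^-1` B j)) * chain_mean p d N n (\1_Q) s)%:E.
Proof.
elim: n s i B => [|n IH] s i B /=.
  have [Qs|nQs] := pselect (Q s).
    rewrite (_ : [set _ | _] = setT) ?setIT; last by apply/seteqP; split.
    by rewrite pr_indep indicE mem_set// mulr1.
  rewrite (_ : [set _ | _] = set0) ?setI0; last by apply/seteqP; split.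
  by rewrite measure0 indicE memNset// mulr0.
have mB : measurable (\big[setI/setT]_(0 <= j < i) (X j @^-1` B j)).
  apply: (big_ind (fun A => measurable A)) => [|A C|j _].
  - exact: measurableT.
  - exact: measurableI.
  - exact: measurable_obs.
rewrite (split_cells i); last first.
  by apply: measurableI => //; exact: (measurable_run _ Q n.+1 s i).
transitivity (\sum_(0 <= x < N.+1) ((\prod_(0 <= j < i) pr (X j @^-1` B j)) *
    (pr (X i @^-1` cell x) * chain_mean p d N n (\1_Q) (chain_step d N s (minn x N))))%:E)%E.
  apply: eq_bigr => x _.
  pose B' j := if j == i then cell x else B j.
  have := IH (chain_step d N s (minn x N)) i.+1 B'.
  rewrite !big_nat_recr//= /B' eqxx.
  rewrite (eq_big_nat _ _ (F2 := fun j => X j @^-1` B j)); last first.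
    by move=> j /andP[_ ji]; rewrite ltn_eqF.
  rewrite [in RHS](eq_big_nat _ _ (F2 := fun j => pr (X j @^-1` B j))); last first.
    by move=> j /andP[_ ji]; rewrite ltn_eqF.
  rewrite -mulrA => <-; congr (P _).
  rewrite -!setIA; congr (_ `&` _); rewrite setIC.
  apply/seteqP; split => t /= [Xt Qt]; split => //.
    by rewrite -(chain_step_cell s Xt).
  by rewrite (chain_step_cell s Xt).
rewrite sumEFin -mulr_sumr; congr (_ * _)%:E.
rewrite big_nat_recr//= pr_cell ltnn minnn; congr (_ + _).
by apply: eq_big_nat => x /andP[_ xN]; rewrite pr_cell xN (minn_idPl (ltnW xN)).
Qed.

Lemma pr_chain n s (Q : set (nat * nat)) :
  pr [set t | Q (run X (chain_step d N) s 0 n t)] = chain_mean p d N n (\1_Q) s.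
Proof.
have := chain_law n s 0 Q (fun=> setT).
by rewrite !big_geq// setTI mul1r => ->.
Qed.

Lemma measurable_Nrec n (Q : set nat) :
  measurable [set t | Q (Nrec X (- d%:Z) n t)].
Proof.
have := @measurable_run _ (record_step d) [set s | Q s.2] n (0, 0)%N 0.
congr measurable; apply/seteqP; split => t /=; by rewrite run_record.
Qed.

Lemma pr_Nrec_le n J (Q : set nat) : (0 < N)%N ->
  pr [set t | Q (Nrec X (- d%:Z) n t)] <=
  (1 - (1 - upper p N) ^+ n) + (1 - upper p J) ^+ n +
  chain_mean p d N n (\1_[set s | (J <= s.1 < N)%N /\ Q s.2]) (0, 0)%N.
Proof.
move=> N0; rewrite -pr_chain.
set E := [set t | _]; set C := [set t | _ (run _ _ _ _ _ _)].
pose A := ~` [set t | (Mx X n t < N)%N]; pose B := [set t | (Mx X n t < J)%N].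
have mE : measurable E by exact: measurable_Nrec.
have mA' : measurable [set t | (Mx X n t < N)%N] by exact: (measurable_max n [set x | (x < N)%N]).
have mA : measurable A by exact: measurableC.
have mB : measurable B by exact: (measurable_max n [set x | (x < J)%N]).
have mC : measurable C by exact: measurable_run.
have -> : 1 - (1 - upper p N) ^+ n = pr A.
  by rewrite -pr_max_lt// /A probability_setC// (prE mA') -EFinB.
apply: (@le_trans _ _ (pr A + pr B + pr C)); last by rewrite !lerD2r lerD2l pr_max_lt_le.
rewrite -lee_fin !EFinD -!prE//.
apply: (@le_trans _ _ (P (A `|` B `|` C))).
  apply: le_measure; rewrite ?inE//; first by apply: measurableU => //; exact: measurableU.
  move=> t Et; have [tN|tN] := ltnP (Mx X n t) N; last first.
    by left; left; rewrite /A /= ltnNge tN.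
  have [tJ|tJ] := ltnP (Mx X n t) J; first by left; right.
  by right; rewrite /C /= run_chain// tJ tN.
apply: le_trans (measureU2 _ _ _) _ => //; first exact: measurableU.
by rewrite leeD2r// measureU2.
Qed.

End law.

(** * Asymptotics of the normalization *)

Section asymptotics.
Context {R : realType}.
Variables (p : nat -> R) (d : nat).
Hypothesis p0 : forall k, 0 < p k.
Hypothesis p1 : series p @ \oo --> (1 : R).
Notation Y := (upper p).
Notation r := (rr p).
Notation q := (exit_prob p d).
Notation mean := (level_mean r q).
Notation var := (level_var r q).
Notation err := (level_err r q).

Notation a k := (gap_ratio p d k.+1).
Definition total_var n := \sum_(0 <= k < n) var k.
Notation V := total_var.

(** The index is shifted by one since [ytail p j] is [Y j.+1]; at [j = 0] the second part amounts to
    [1 <= t]. *)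
Lemma mmP (t : R) : 1 <= t ->
  Y (mm p t).+1 < t^-1 /\ forall j, (j <= mm p t)%N -> t^-1 <= Y j.
Proof.
move=> t1; have t0 : 0 < t by apply: lt_le_trans t1.
rewrite /mm; case: pselect => [h|]; last first.
  case; have /cvgrPdist_lt /(_ t^-1) := cvg_upper p1; rewrite invr_gt0 => /(_ t0) [n _ H].
  exists n; rewrite (ytailE p1); have := H n.+1 (leqnSn n); rewrite /= sub0r normrN.
  by apply: le_lt_trans; exact: ler_norm.
case: ex_minnP => m; rewrite (ytailE p1) => Ym mmin; split => // -[_|j jm].
  by rewrite upper0 invf_le1.
by rewrite leNgt; apply/negP => Yj; have := mmin j; rewrite (ytailE p1) => /(_ Yj); lia.
Qed.

Lemma le_mm (t u : R) : 1 <= t -> t <= u -> (mm p t <= mm p u)%N.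
Proof.
move=> t1 tu; have [_ H] := mmP t1; have [K _] := mmP (le_trans t1 tu).
rewrite leqNgt; apply/negP => /H; rewrite leNgt => /negP; apply.
have t0 : 0 < t by apply: lt_le_trans t1.
by apply: lt_le_trans K _; rewrite lef_pV2 ?posrE// (lt_le_trans t0).
Qed.

Lemma mm_large k (t : R) : 1 <= t -> (Y k)^-1 <= t -> (k <= mm p t)%N.
Proof.
move=> t1 kt; have [K _] := mmP t1; rewrite leqNgt; apply/negP => tk.
have := upper_anti p0 tk; rewrite leNgt => /negP; apply; apply: lt_le_trans K _.
by rewrite -[leRHS]invrK lef_pV2 ?posrE ?invr_gt0 ?upper_gt0// (lt_le_trans ltr01).
Qed.

Lemma mm_near (A : R) k : 0 < A -> \forall n \near \oo, (k <= mm p (A * n%:R))%N.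
Proof.
move=> A0; near=> n; apply: mm_large.
  rewrite -ler_pdivrMl// mulr1; near: n; exact: nbhs_infty_ger.
rewrite -ler_pdivrMl//; near: n; exact: nbhs_infty_ger.
Unshelve. all: by end_near. Qed.

Lemma var_ge0 k : 0 <= var k.
Proof.
by apply: level_var_ge0 => j; rewrite ?exit_prob_gt0 ?exit_prob_le1// ltW// ?rr_gt0 ?rr_lt1.
Qed.

Lemma varE k : var k = r k * (2 - q k - r k) * a k ^+ 2.
Proof. by rewrite /level_var -exprVn exit_probV. Qed.

Lemma var_le k : var k <= 2 * r k * a k ^+ 2.
Proof.
rewrite varE ler_wpM2r ?sqr_ge0//.
have := exit_prob_gt0 p0 p1 d k; have := rr_gt0 p0 p1 k; have := rr_lt1 p0 p1 k; nra.
Qed.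

Lemma le_total_var m n : (m <= n)%N -> V m <= V n.
Proof.
by move=> mn; rewrite /V (big_cat_nat (leq0n _) mn) /= lerDl sumr_ge0// => k _; exact: var_ge0.
Qed.

(** Up to [mm p (A n)] the tail is at least [1 / (A n)], so [r i <= A n * p i]; the total mass of
    the [p i] beyond [mm p (n / A)] is at most [A / n]. *)
Lemma window_sum (A : R) n : 1 <= A -> A <= n%:R ->
  \sum_((mm p (n%:R / A)).+1 <= i < (mm p (A * n%:R)).+1) r i <= A ^+ 2.
Proof.
move=> A1 An; have A0 : 0 < A by apply: lt_le_trans A1.
have n0 : 0 < n%:R :> R by apply: lt_le_trans An.
have t1 : 1 <= n%:R / A by rewrite ler_pdivlMr// mul1r.
have tA : n%:R / A <= A * n%:R.
  by rewrite mulrC ler_wpM2r ?(ltW n0)// (le_trans _ A1)// invf_le1.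
set J := mm p _; set N := mm p _.
have JN : (J <= N)%N by exact: le_mm.
have [HJ _] := mmP t1; rewrite -/J invf_div in HJ.
have [_ HN] := mmP (le_trans t1 tA); rewrite -/N in HN.
apply: (@le_trans _ _ (\sum_(J.+1 <= i < N.+1) (A * n%:R) * p i)).
  apply: ler_sum_nat => i /andP[_ iN]; rewrite rrE// mulrC ler_wpM2r//; first exact: ltW.
  have := HN i; rewrite -ltnS => /(_ iN) H.
  by rewrite -[leRHS]invrK lef_pV2 ?posrE ?upper_gt0// invr_gt0 mulr_gt0.
rewrite -mulr_sumr sum_pE//.
apply: (@le_trans _ _ (A * n%:R * (A / n%:R))).
  rewrite ler_wpM2l ?mulr_ge0 ?(ltW A0) ?(ltW n0)//.
  by have := upper_gt0 p0 p1 N.+1; move: HJ; lra.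
by rewrite le_eqVlt; apply/orP; left; apply/eqP; field; rewrite gt_eqF.
Qed.

(** [a k = 1 / q k] is the scale of the count at level [k]. What each case must supply is [aV],
    making a single level negligible against the standard deviation; [cq], keeping [var k]
    comparable to [r k * a k ^+ 2]; and [aC], preventing a jump of the scale between [mm p n] and
    [mm p (A n)]. *)
Variable (c : R).
Hypothesis c0 : 0 < c.
Hypothesis Vy : V n @[n --> \oo] --> +oo.
Hypothesis aV : forall e, 0 < e -> \forall k \near \oo, a k <= e * Num.sqrt (V k.+1).
Hypothesis cq : forall k, c <= 2 - q k - r k.
Hypothesis aC : forall A : R, 1 <= A -> exists C : R, \forall n \near \oo,
  forall k, (mm p n%:R <= k <= mm p (A * n%:R))%N -> a k <= C * a (mm p n%:R).

Notation m n := (mm p n%:R).+1.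

Lemma mm_near1 k : \forall n \near \oo, (k <= mm p n%:R)%N.
Proof.
by have := mm_near k (@ltr01 R); apply: filterS => n; rewrite mul1r.
Qed.

Lemma cvg_m : (fun n => m n) @ \oo --> \oo.
Proof.
move=> S [k _ kS]; have := mm_near1 k; apply: filterS => n kn.
by apply: kS => /=; rewrite (leq_trans kn).
Qed.

Lemma a_gt0 k : 0 < a k. Proof. by rewrite (lt_le_trans ltr01)// gap_ratio_ge1. Qed.

(** Three ranges of [k]: finitely many small ones are beaten by the divergence of [V], those up to
    [mm p n] are handled by [aV] and monotonicity of [V], and those beyond are compared to
    [a (mm p n)] by [aC], whose constant is absorbed in [e']. *)
Lemma uniform_small (A e : R) : 1 <= A -> 0 < e -> \forall n \near \oo,
  forall k, (k <= mm p (A * n%:R))%N -> a k <= e * Num.sqrt (V (m n)).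
Proof.
move=> A1 e0; have [C HC] := aC A1.
have C1 : 0 < `|C| + 1 by rewrite ltr_wpDl.
pose e' := e / (`|C| + 1).
have e'0 : 0 < e' by rewrite divr_gt0.
have e'e : e' <= e by rewrite ler_pdivrMr// ler_peMr// ?(ltW e0)// lerDr.
have [k0 _ Hk0] := aV e'0.
pose S := \sum_(0 <= i < k0) a i.
have sV k l : (k <= l)%N -> Num.sqrt (V k) <= Num.sqrt (V l).
  by move=> kl; rewrite ler_sqrt ?le_total_var// sumr_ge0// => i _; exact: var_ge0.
near=> n => k kA.
have k0m : (k0 <= mm p n%:R)%N by near: n; exact: mm_near1.
have small j : (j <= mm p n%:R)%N -> a j <= e' * Num.sqrt (V (m n)).
  move=> jm; have [k0j|jk0] := leqP k0 j.
    by apply: le_trans (Hk0 j k0j) _; rewrite ler_wpM2l ?(ltW e'0)// sV.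
  apply: (@le_trans _ _ S).
    rewrite /S (bigD1_seq j) ?mem_index_iota ?iota_uniq//= lerDl sumr_ge0// => i _.
    exact/ltW/a_gt0.
  have SV : (S / e') ^+ 2 <= V (m n).
    near: n; have /cvgryPge /(_ ((S / e') ^+ 2)) := Vy.
    exact: cvg_m.
  rewrite -ler_pdivrMl// mulrC -[leLHS]ger0_norm; last first.
    by rewrite divr_ge0 ?(ltW e'0)// sumr_ge0// => i _; exact/ltW/a_gt0.
  by rewrite -sqrtr_sqr ler_sqrt// sumr_ge0// => i _; exact: var_ge0.
have [km|mk] := leqP k (mm p n%:R).
  by apply: le_trans (small k km) _; rewrite ler_wpM2r ?sqrtr_ge0.
have H : a k <= C * a (mm p n%:R).
  have : forall k, (mm p n%:R <= k <= mm p (A * n%:R))%N -> a k <= C * a (mm p n%:R) by near: n.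
  by apply; rewrite (ltnW mk).
apply: le_trans H _.
have := small _ (leqnn _); set b := a (mm p _); set s := Num.sqrt _ => bs.
have b0 : 0 < b by exact: a_gt0.
apply: (@le_trans _ _ ((`|C| + 1) * b)).
  by rewrite ler_wpM2r ?(ltW b0)// (le_trans (ler_norm C))// lerDl.
apply: (@le_trans _ _ ((`|C| + 1) * (e' * s))); first by rewrite ler_wpM2l ?(ltW C1).
by rewrite mulrA /e' mulrC (mulrC _ (e / _)) divfK ?gt_eqF// mulrC.
Unshelve. all: by end_near. Qed.

Let sV (k l : nat) : (k <= l)%N -> Num.sqrt (V k) <= Num.sqrt (V l).
Proof. by move=> kl; rewrite ler_sqrt ?le_total_var// sumr_ge0// => i _; exact: var_ge0. Qed.

Let mean_ge0 k : 0 <= mean k.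
Proof.
by rewrite level_meanE mulr_ge0 ?(ltW (a_gt0 k))// ltW// rr_gt0.
Qed.

Let r_ge0 k : 0 <= r k. Proof. by rewrite ltW// rr_gt0. Qed.

Lemma mm_div_le (A : R) n : 1 <= A -> A <= n%:R ->
  (mm p (n%:R / A) <= mm p n%:R <= mm p (A * n%:R))%N.
Proof.
move=> A1 An; have A0 : 0 < A by apply: lt_le_trans A1.
have n1 : 1 <= n%:R :> R by apply: le_trans An.
apply/andP; split; apply: le_mm => //.
- by rewrite ler_pdivlMr// mul1r.
- by rewrite ler_pdivrMr// ler_peMr// (le_trans _ n1).
- by rewrite ler_peMl// (le_trans _ n1).
Qed.

(* Only the levels reached while the maximum stays within the likely range
   [mm p (n / A), mm p (A n)] matter; [window_sum] bounds their number in mean. *)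
Let window_mean (A e : R) n j : 1 <= A -> A <= n%:R -> 0 <= e ->
  (forall k, (k <= mm p (A * n%:R))%N -> a k <= e) ->
  (mm p (n%:R / A) < j)%N ->
  \sum_(j <= i < (mm p (A * n%:R)).+1) r i * a i <= e * A ^+ 2.
Proof.
move=> A1 An e0 ae Jj.
have [jN|Nj] := leqP j (mm p (A * n%:R)).+1; last first.
  by rewrite big_geq ?(ltnW Nj)// mulr_ge0// sqr_ge0.
apply: (@le_trans _ _ (\sum_(j <= i < (mm p (A * n%:R)).+1) e * r i)).
  apply: ler_sum_nat => i /andP[_ iN].
  by rewrite mulrC ler_wpM2r// ae// -ltnS.
rewrite -mulr_sumr ler_wpM2l//; apply: le_trans (window_sum A1 An).
by rewrite (big_cat_nat Jj jN) /= lerDr sumr_ge0.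
Qed.

Lemma window_small (A e : R) : 1 <= A -> 0 < e -> \forall n \near \oo, forall k,
  (mm p (n%:R / A) <= k < (mm p (A * n%:R)).+1)%N ->
  a k + \sum_(k.+1 <= i < (mm p (A * n%:R)).+1) mean i <= e * Num.sqrt (V (m n)).
Proof.
move=> A1 e0.
have c1 : 0 < 1 + A ^+ 2 by rewrite ltr_pwDl// sqr_ge0.
have e'0 : 0 < e / (1 + A ^+ 2) by rewrite divr_gt0.
near=> n => k /andP[Jk kN].
have An : A <= n%:R by near: n; exact: nbhs_infty_ger.
have H : forall k, (k <= mm p (A * n%:R))%N -> a k <= e / (1 + A ^+ 2) * Num.sqrt (V (m n)).
  by near: n; exact: uniform_small.
have s0 := sqrtr_ge0 (V (m n)).
have := window_mean A1 An (mulr_ge0 (ltW e'0) s0) H (j := k.+1) Jk.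
under eq_bigr do rewrite -(level_meanE p d).
move=> H2; apply: le_trans (lerD (H k kN) H2) _.
rewrite -[X in X + _]mulr1 -mulrDr mulrAC divfK ?gt_eqF//.
Unshelve. all: by end_near. Qed.

(** The Lindeberg condition: [err k = r k * a k ^+ 3] is at most [a k / c] times [var k], and [a k]
    is uniformly small against the standard deviation. *)
Lemma err_small (A e : R) : 1 <= A -> 0 < e -> \forall n \near \oo,
  \sum_(0 <= k < (mm p (A * n%:R)).+1) err k <=
  e * Num.sqrt (V (mm p (A * n%:R)).+1) ^+ 3.
Proof.
move=> A1 e0; have e'0 : 0 < e * c by rewrite mulr_gt0.
near=> n.
have An : A <= n%:R by near: n; exact: nbhs_infty_ger.
have H : forall k, (k <= mm p (A * n%:R))%N -> a k <= e * c * Num.sqrt (V (m n)).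
  by near: n; exact: uniform_small.
have /andP[_ mN] := mm_div_le A1 An.
set N := mm p (A * n%:R) in H mN *; set s := Num.sqrt (V N.+1).
have s0 : 0 <= s by exact: sqrtr_ge0.
have -> : e * s ^+ 3 = e * s * V N.+1.
  by rewrite -[V N.+1]sqr_sqrtr ?sumr_ge0// => [|i _]; [rewrite -/s; ring|exact: var_ge0].
rewrite /V mulr_sumr; apply: ler_sum_nat => k /andP[_ kN].
have -> : err k = r k * a k ^+ 2 * a k by rewrite /level_err -exprVn exit_probV; ring.
have ak : a k <= e * c * s.
  by apply: le_trans (H k kN) _; rewrite ler_wpM2l ?(ltW e'0)// sV.
have vk : c * (r k * a k ^+ 2) <= var k.
  rewrite varE (_ : r k * _ * _ = (2 - q k - r k) * (r k * a k ^+ 2)); last by ring.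
  by rewrite ler_wpM2r// mulr_ge0// sqr_ge0.
have ra0 : 0 <= r k * a k ^+ 2 by rewrite mulr_ge0// sqr_ge0.
apply: (@le_trans _ _ (r k * a k ^+ 2 * (e * c * s))); first by rewrite ler_wpM2l.
have -> : r k * a k ^+ 2 * (e * c * s) = e * s * (c * (r k * a k ^+ 2)) by ring.
by rewrite ler_wpM2l// mulr_ge0 ?(ltW e0).
Unshelve. all: by end_near. Qed.

(** By [level_mean_theta], the difference consists of the boundary term [a (mm p n) - 1] and the
    means of the levels from [mm p n] to [mm p (A n)]. *)
Lemma mean_shift (A e : R) : 1 <= A -> 0 < e -> \forall n \near \oo,
  `|\sum_(0 <= k < (mm p (A * n%:R)).+1) mean k - theta p (- d%:Z) (mm p n%:R)|
  <= e * Num.sqrt (V (m n)).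
Proof.
move=> A1 e0.
have c1 : 0 < 1 + A ^+ 2 by rewrite ltr_pwDl// sqr_ge0.
have e'0 : 0 < e / (1 + A ^+ 2) by rewrite divr_gt0.
near=> n.
have An : A <= n%:R by near: n; exact: nbhs_infty_ger.
have H : forall k, (k <= mm p (A * n%:R))%N -> a k <= e / (1 + A ^+ 2) * Num.sqrt (V (m n)).
  by near: n; exact: uniform_small.
have s0 := sqrtr_ge0 (V (m n)).
have /andP[Jm mN] := mm_div_le A1 An.
rewrite (big_cat_nat (leq0n (m n))) /= ?ltnS// level_mean_theta//.
rewrite /theta -(big_mkord predT (ss p (- d%:Z))).
have H2 := window_mean A1 An (mulr_ge0 (ltW e'0) s0) H (j := m n) Jm.
have H1 := H _ mN.
have a1 : 1 <= a (mm p n%:R) by exact: gap_ratio_ge1.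
have S0 : 0 <= \sum_((mm p n%:R).+1 <= i < (mm p (A * n%:R)).+1) mean i.
  by apply: sumr_ge0 => i _; exact: mean_ge0.
rewrite (eq_bigr mean) in H2; last by move=> i _; rewrite level_meanE.
have E : e / (1 + A ^+ 2) * Num.sqrt (V (m n)) + e / (1 + A ^+ 2) * Num.sqrt (V (m n)) * A ^+ 2 = e * Num.sqrt (V (m n)).
  rewrite -[X in X + _]mulr1 -mulrDr mulrAC divfK ?gt_eqF//.
rewrite -E; move: H1 H2 S0 a1.
set x1 := e / _ * _; set x2 := x1 * _; set S := \sum_(_ <= i < _) mean i.
set S' := \sum_(_ <= i < _) ss _ _ _; set b := a _ => H1 H2 S0 a1.
by rewrite ger0_norm; lra.
Unshelve. all: by end_near. Qed.

Lemma total_var_gt0 n : (0 < n)%N -> 0 < V n.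
Proof.
case: n => // n _; rewrite /V big_nat_recl// ltr_pwDl ?sumr_ge0// => [|i _]; last exact: var_ge0.
rewrite varE mulr_gt0 ?exprn_gt0 ?a_gt0// mulr_gt0 ?rr_gt0//.
exact: lt_le_trans c0 (cq _).
Qed.

Lemma var_ratio (A : R) : 1 <= A ->
  V (m n) / V (mm p (A * n%:R)).+1 @[n --> \oo] --> (1 : R).
Proof.
move=> A1; apply/cvgrPdist_le => e e0.
have A0 : 0 < A by apply: lt_le_trans A1.
(* The extra variance is at most [2 * e' ^+ 2 * A ^+ 2 * V (m n)]; the cap at 1 gives
   [e' ^+ 2 <= e']. *)
pose e' := Num.min 1 (e / (2 * A ^+ 2)).
have e'0 : 0 < e' by rewrite lt_min ltr01 divr_gt0// mulr_gt0// exprn_gt0.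
near=> n.
have An : A <= n%:R by near: n; exact: nbhs_infty_ger.
have H : forall k, (k <= mm p (A * n%:R))%N -> a k <= e' * Num.sqrt (V (m n)).
  by near: n; exact: uniform_small.
have s0 := sqrtr_ge0 (V (m n)).
have /andP[Jm mN] := mm_div_le A1 An.
have H2 := window_mean A1 An (mulr_ge0 (ltW e'0) s0) H (j := m n) Jm.
set N := mm p (A * n%:R) in H mN H2 *.
have VN : V N.+1 = V (m n) + \sum_(m n <= k < N.+1) var k.
  by rewrite /V (big_cat_nat (leq0n (m n))).
have Vm0 : 0 < V (m n) by exact: total_var_gt0.
have VN0 : 0 < V N.+1 by exact: total_var_gt0.
have D0 : 0 <= \sum_(m n <= k < N.+1) var k by apply: sumr_ge0 => i _; exact: var_ge0.
have D1 : \sum_(m n <= k < N.+1) var k <= e * V (m n).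
  apply: (@le_trans _ _ (\sum_(m n <= k < N.+1) 2 * (e' * Num.sqrt (V (m n))) * (r k * a k))).
    apply: ler_sum_nat => k /andP[_ kN]; apply: le_trans (var_le k) _.
    have -> : 2 * r k * a k ^+ 2 = 2 * a k * (r k * a k) by ring.
    have ra0 : 0 <= r k * a k by rewrite mulr_ge0 ?(ltW (a_gt0 k)).
    rewrite ler_wpM2r ?ler_wpM2l//.
    exact: H.
  rewrite -mulr_sumr.
  apply: (@le_trans _ _ (2 * (e' * Num.sqrt (V (m n))) * (e' * Num.sqrt (V (m n)) * A ^+ 2))).
    by rewrite ler_wpM2l// mulr_ge0// mulr_ge0// ltW.
  have -> : 2 * (e' * Num.sqrt (V (m n))) * (e' * Num.sqrt (V (m n)) * A ^+ 2) =
    e' * e' * (2 * A ^+ 2) * Num.sqrt (V (m n)) ^+ 2 by ring.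
  rewrite sqr_sqrtr ?(ltW Vm0)// ler_wpM2r ?(ltW Vm0)//.
  have e1 : e' <= 1 by rewrite ge_min lexx.
  have e2 : e' * (2 * A ^+ 2) <= e.
    by rewrite -ler_pdivlMr ?mulr_gt0 ?exprn_gt0// ge_min lexx orbT.
  rewrite -mulrA; apply: le_trans e2.
  have z0 : 0 <= e' * (2 * A ^+ 2) by apply: mulr_ge0; [exact: ltW|apply: mulr_ge0 => //; exact: sqr_ge0].
  exact: ler_piMl.
have -> : 1 - V (m n) / V N.+1 = (\sum_(m n <= k < N.+1) var k) / V N.+1.
  by rewrite -[X in X - _](@divff _ (V N.+1)) ?gt_eqF// -mulrBl VN addrAC subrr add0r.
rewrite ger0_norm ?divr_ge0 ?(ltW VN0)// ler_pdivrMr//.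
by apply: le_trans D1 _; rewrite ler_wpM2l ?(ltW e0)// VN lerDl.
Unshelve. all: by end_near. Qed.

Variable W : nat -> R.
Hypothesis WV : W n / V n @[n --> \oo] --> (1 : R).

Lemma normalization_gt0 : \forall n \near \oo, 0 < W (m n).
Proof.
have H : \forall n \near \oo, 0 < W n.
  near=> n; have n0 : (0 < n)%N by near: n; exact: nbhs_infty_gt.
  have : 0 < W n / V n.
    near: n; apply: (cvgr_gt _ WV); exact: ltr01.
  by rewrite pmulr_lgt0// invr_gt0 total_var_gt0.
exact: cvg_m H.
Unshelve. all: by end_near. Qed.

(** Rewrites the threshold for the count in the centring and scale of the levels up to [mm p (A n)],
    the ones [lindeberg] speaks of. *)
Lemma threshold_cvg (A x : R) : 1 <= A ->
  (theta p (- d%:Z) (mm p n%:R) + x * Num.sqrt (W (m n)) -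
    \sum_(0 <= k < (mm p (A * n%:R)).+1) mean k) / Num.sqrt (V (mm p (A * n%:R)).+1)
  @[n --> \oo] --> x.
Proof.
move=> A1.
pose N n := (mm p (A * n%:R)).+1.
have c1 : x * Num.sqrt (W (m n) / V (N n)) @[n --> \oo] --> x.
  rewrite -[X in _ --> X]mulr1; apply: cvgM; first exact: cvg_cst.
  rewrite -[X in _ --> X]sqrtr1; apply: (cvg_comp _ Num.sqrt); last exact: sqrt_continuous.
  have H : W (m n) / V (m n) * (V (m n) / V (N n)) @[n --> \oo] --> (1 : R).
    rewrite -[X in _ --> X]mulr1; apply: cvgM; last exact: var_ratio.
    exact: (cvg_comp (fun n => m n) (fun n => W n / V n) cvg_m).
  apply: cvg_trans H; apply: near_eq_cvg; near=> n.
  by rewrite mulrA divfK// gt_eqF// total_var_gt0.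
rewrite -[X in _ --> X]subr0.
have c2 : (\sum_(0 <= k < N n) mean k - theta p (- d%:Z) (mm p n%:R)) / Num.sqrt (V (N n))
    @[n --> \oo] --> (0 : R).
  apply/cvgrPdist_le => e e0; near=> n.
  have An : A <= n%:R by near: n; exact: nbhs_infty_ger.
  have /andP[Jm mN] := mm_div_le A1 An.
  have s0 : 0 < Num.sqrt (V (N n)) by rewrite sqrtr_gt0 total_var_gt0.
  rewrite sub0r normrN normrM normfV [X in _ / X]ger0_norm ?(ltW s0)// ler_pdivrMr//.
  apply: (@le_trans _ _ (e * Num.sqrt (V (m n)))); last by rewrite ler_wpM2l ?(ltW e0)// sV.
  by near: n; exact: mean_shift.
have H : x * Num.sqrt (W (m n) / V (N n)) -
    (\sum_(0 <= k < N n) mean k - theta p (- d%:Z) (mm p n%:R)) / Num.sqrt (V (N n))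
  @[n --> \oo] --> x - 0 by exact: cvgB c1 c2.
apply: cvg_trans H; apply: near_eq_cvg; near=> n.
have s0 : 0 < Num.sqrt (V (N n)) by rewrite sqrtr_gt0 total_var_gt0.
have Wm : 0 < W (m n) by near: n; exact: normalization_gt0.
rewrite sqrtrM ?(ltW Wm)// sqrtrV ?(ltW (total_var_gt0 _))// /N.
by field; rewrite gt_eqF.
Unshelve. all: by end_near. Qed.

End asymptotics.

(** * The limit theorem under abstract conditions *)

Section limit.
Context {R : realType} {dT : measure_display} {T : measurableType dT}.
Variables (P : probability T R) (X : nat -> T -> nat) (p : nat -> R).
Hypothesis mX : forall i k, measurable (X i @^-1` [set k]).
Hypothesis indX : mutually_independent P X.
Hypothesis lawX : forall i k, P (X i @^-1` [set k]) = (p k)%:E.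
Hypothesis p0 : forall k, 0 < p k.
Variable d : nat.
Hypothesis d0 : (0 < d)%N.

Let p1 : series p @ \oo --> (1 : R) := cvg_law mX lawX.
Notation Y := (upper p).
Notation r := (rr p).
Notation q := (exit_prob p d).
Notation mean := (level_mean r q).
Notation V := (total_var p d).
Notation err := (level_err r q).
Notation pr E := (fine (P E)).
Notation a k := (gap_ratio p d k.+1).

Lemma logistic_lb (u l : R) : u <= - l -> 1 <= (1 + expR (- l)) * logistic u.
Proof.
move=> ul; rewrite /logistic ler_pdivlMr ?addr_gt0 ?expR_gt0// mul1r.
by rewrite lerD2l ler_expR.
Qed.

Lemma logistic_ub (u l : R) : l <= u -> logistic u <= expR (- l).
Proof.
move=> lu; rewrite /logistic expRN lef_pV2 ?posrE ?addr_gt0 ?expR_gt0//.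
by apply: ler_wpDl => //; rewrite ler_expR.
Qed.

Let q0 := exit_prob_gt0 p0 p1 d.
Let q1 := exit_prob_le1 p0 p1 d.
Let r0 k : 0 <= r k. Proof. by rewrite ltW// rr_gt0. Qed.
Let r1 k : r k <= 1. Proof. by rewrite ltW// rr_lt1. Qed.

(** On the event, [1 <= (1 + expR (- l)) * g c <= (1 + expR (- l)) * (H + |al| W)]; elsewhere the
    right side is nonnegative. The chain mean of [H] is its initial value, to which [lindeberg]
    applies. *)
Lemma count_tail_le (al be l W : R) n N J (Q : set nat) : (0 < N)%N -> 0 <= W ->
  (forall c, Q c -> al * c%:R + be <= - l) ->
  (forall k, (J <= k < N)%N -> a k + \sum_(k.+1 <= i < N) mean i <= W) ->
  pr [set t | Q (Nrec X (- d%:Z) n t)] <=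
  (1 - (1 - Y N) ^+ n) + (1 - Y J) ^+ n +
  (1 + expR (- l)) * (gsmooth (V N) (fun x => logistic (al * x + be)) (\sum_(0 <= k < N) mean k)
    + `|al| ^+ 3 * (7 + 3 * gcube) * \sum_(0 <= k < N) err k + `|al| * W).
Proof.
move=> N0 W0 HQ HW; set g := fun x => logistic (al * x + be).
apply: le_trans (pr_Nrec_le mX indX lawX d n J Q N0) _.
rewrite lerD2l.
have tg : test_fun _ _ g _ _ := test_fun_logistic al be.
have g01 := test_bnd tg; have gL := test_lip tg.
have k0 : 0 <= 1 + expR (- l) by rewrite addr_ge0 ?expR_ge0.
pose H := chain_value p d N g.
have H0 s : 0 <= H s by exact: chain_value_ge0.
apply: (@le_trans _ _ (chain_mean p d N n
    (fun s => (1 + expR (- l)) * H s + (1 + expR (- l)) * (`|al| * W)) (0, 0)%N)).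
  apply: (le_chain_mean d N p0 p1) => -[k c]; rewrite indicE.
  have [|_] := boolP (_ \in _); last by rewrite -mulrDr !mulr_ge0// addr_ge0// mulr_ge0.
  rewrite inE /= => -[/andP[Jk kN] Qc].
  apply: (le_trans (logistic_lb (HQ c Qc))); rewrite -mulrDr ler_wpM2l//.
  have := chain_value_dist d p0 p1 g01 (normr_ge0 al) gL c kN.
  rewrite exit_probV -/H ler_distlC => /andP[_ h].
  apply: le_trans h _; rewrite lerD2l ler_wpM2l// HW//.
  by rewrite Jk.
rewrite (chain_mean_affine p d N n H (1 + expR (- l)) ((1 + expR (- l)) * (`|al| * W))).
rewrite (chain_mean_value d N p0 p1 g01) -mulrDr ler_wpM2l// lerD2r.
rewrite (chain_value0 p0 p1 g01 d0 N0).
have := lindeberg q0 q1 r0 r1 (exprn_ge0 3 (normr_ge0 al)) tg N 0 0.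
by rewrite add0n add0r ler_distl => /andP[].
Qed.

Lemma one_sub_pow_ge (y : R) n : 0 <= y -> y <= 1 -> 1 - (1 - y) ^+ n <= n%:R * y.
Proof.
move=> y0 y1; elim: n => [|n IH]; first by rewrite expr0 subrr mul0r.
have := exprn_ge0 n (_ : 0 <= 1 - y); rewrite subr_ge0 => /(_ y1).
have : (1 - y) ^+ n <= 1 by rewrite exprn_ile1 ?subr_ge0// gerBl.
by rewrite exprS -natr1; move: IH; set z := (1 - y) ^+ n; nra.
Qed.

Lemma one_sub_pow_le (y A : R) n : 0 < A -> 0 <= y -> y <= 1 -> A <= n%:R * y ->
  (1 - y) ^+ n <= A^-1.
Proof.
move=> A0 y0 y1 Ay.
apply: (@le_trans _ _ (expR (- (n%:R * y)))).
  rewrite -mulrN mulrC expRM_natr; apply: lerXn2r; rewrite ?nnegrE ?subr_ge0 ?expR_ge0//.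
  exact: expR_ge1Dx.
rewrite expRN lef_pV2 ?posrE ?expR_gt0//.
by apply: le_trans Ay _; apply: le_trans (expR_ge1Dx _); rewrite lerDr.
Qed.

Variable (c : R).
Hypothesis c0 : 0 < c.
Hypothesis Vy : V n @[n --> \oo] --> +oo.
Hypothesis aV : forall e, 0 < e -> \forall k \near \oo, a k <= e * Num.sqrt (V k.+1).
Hypothesis cq : forall k, c <= 2 - q k - r k.
Hypothesis aC : forall A : R, 1 <= A -> exists C : R, \forall n \near \oo,
  forall k, (mm p n%:R <= k <= mm p (A * n%:R))%N -> a k <= C * a (mm p n%:R).
Variable W : nat -> R.
Hypothesis WV : W n / V n @[n --> \oo] --> (1 : R).

Notation m n := (mm p n%:R).+1.
Let stat n (k : nat) := (k%:R - theta p (- d%:Z) (mm p n%:R)) / Num.sqrt (W (m n)).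

(** Of the distance [3 * eta] from [x], one [eta] allows for the error of the threshold, one lets
    the logistic function come close to 1, and one lets it fall below [expR (- l)]. The normal
    density bounds the cost of moving [x] that far. *)
Lemma cutoff_mean_le (b : bool) (x lam eta l : R) : 0 < lam -> 0 < eta -> lam * eta = l ->
  gmean (fun z => logistic ((if b then -1 else 1) * lam * (z - x) - 2 * l)) <=
  (if b then 1 - normal_cdf x else normal_cdf x) + normal_peak (1 : R) * (3 * eta) + expR (- l).
Proof.
move=> lam0 eta0 <-.
have mh s : measurable_fun setT (fun z : R => logistic (s * lam * (z - x) - 2 * (lam * eta))).
  rewrite (_ : (fun z => _) = fun z => logistic (- s * lam * x - 2 * (lam * eta) + s * lam * z)).
    by apply: measurable_affine; apply: continuous_measurable_fun; exact: continuous_logistic.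
  by apply/funext => z; congr logistic; ring.
have h01 s (z : R) : 0 <= logistic (s * lam * (z - x) - 2 * (lam * eta)) <= 1.
  by rewrite logistic_le1 andbT ltW// logistic_gt0.
have k0 := expR_ge0 (- (lam * eta)).
case: b.
  have xe : x - 3 * eta <= x by lra.
  have := normal_cdf_lip xe; rewrite (_ : x - (x - 3 * eta) = 3 * eta); last by ring.
  move=> H; apply: le_trans (gmean_le_ccdf (y := x - 3 * eta) (mh (-1)) k0 (h01 (-1)) _) _; last by lra.
  by move=> z zx; apply: logistic_ub; nra.
have xe : x <= x + 3 * eta by lra.
have := normal_cdf_lip xe; rewrite (_ : x + 3 * eta - x = 3 * eta); last by ring.
move=> H; apply: le_trans (gmean_le_cdf (y := x + 3 * eta) (mh 1) k0 (h01 1) _) _; last by lra.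
by move=> z zx; apply: logistic_ub; nra.
Qed.

(** [k] enters three times: in the bound on [G], multiplied by [F <= 1], and as [k ^+ 2 <= k]; hence
    the assumption on [3 * k]. *)
Lemma error_budget (k e F G S u1 u2 : R) : 0 <= k <= 1 -> 3 * k <= e / 8 -> 0 < e ->
  0 <= F <= 1 -> u1 <= e / 8 -> u2 <= e / 8 -> G <= F + e / 8 + k -> S <= e / 32 ->
  u1 + u2 + (1 + k) * (G + S + e / 32) <= F + e.
Proof. move=> /andP[? ?] ? ? /andP[? ?] ? ? ? ?; nra. Qed.

(** [b] selects the tail, so one argument gives both one-sided bounds. [A] makes the early and late
    escapes of the maximum at most [e / 8] each, [eta] does the same for the moved threshold, [l]
    for the logistic residue, and [s1], [s2] for the replacement error and the displacement of the
    count. *)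
Lemma tail_le (x e : R) (b : bool) : 0 < e ->
  \forall n \near \oo,
    pr [set t | if b then x < stat n (Nrec X (- d%:Z) n t)
                else stat n (Nrec X (- d%:Z) n t) <= x] <=
    (if b then 1 - normal_cdf x else normal_cdf x) + e.
Proof.
move=> e0.
pose A : R := Num.max 1 (8 / e).
have A1 : 1 <= A by rewrite le_max lexx.
have A0 : 0 < A by apply: lt_le_trans A1.
have Ae : A^-1 <= e / 8.
  by rewrite -[leRHS]invrK lef_pV2 ?posrE ?invr_gt0 ?divr_gt0// invf_div le_max lexx orbT.
pose pk := normal_peak (1 : R).
have pk0 : 0 < pk by rewrite normal_peak_gt0// oner_eq0.
pose eta := e / 8 / (3 * pk).
have eta0 : 0 < eta by apply: divr_gt0; [exact: divr_gt0|exact: mulr_gt0].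
pose l := Num.max 1 (24 / e).
have l0 : 0 < l by rewrite lt_max ltr01.
pose lam := l / eta.
have lam0 : 0 < lam by rewrite divr_gt0.
have le : lam * eta = l by rewrite /lam divfK// gt_eqF.
set kap := expR (- l).
have kap0 : 0 <= kap by exact: expR_ge0.
have kap1 : kap <= 1 by rewrite -expR0 ler_expR oppr_le0 ltW.
have kape : 3 * kap <= e / 8.
  have : kap <= e / 24.
    rewrite /kap expRN -[leRHS]invrK lef_pV2 ?posrE ?expR_gt0 ?invr_gt0 ?divr_gt0//.
    rewrite invf_div (@le_trans _ _ l)//; first by rewrite le_max lexx orbT.
    by apply: le_trans (expR_ge1Dx l); rewrite lerDr.
  by lra.
pose K := lam ^+ 3 * (7 + 3 * @gcube R).
have K0 : 0 <= K.
  by rewrite mulr_ge0 ?exprn_ge0 ?(ltW lam0)// addr_ge0// mulr_ge0// gcube_ge0.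
pose s1 := e / 32 / (K + 1); pose s2 := e / 32 / lam.
have s10 : 0 < s1 by apply: divr_gt0; [exact: divr_gt0|exact: ltr_wpDl].
have s20 : 0 < s2 by apply: divr_gt0 => //; exact: divr_gt0.
have Ks1 : K * s1 <= e / 32.
  rewrite /s1 mulrA ler_pdivrMr ?ltr_wpDl// mulrC ler_wpM2l//; last by rewrite lerDl.
  by rewrite divr_ge0 ?(ltW e0).
have ls2 : lam * s2 = e / 32 by rewrite /s2 mulrC divfK// gt_eqF.
near=> n.
have An : A <= n%:R by near: n; exact: nbhs_infty_ger.
have Wm : 0 < W (m n) by near: n; exact: (normalization_gt0 p0 p1 c0 cq WV).
have tauE : `|x - (theta p (- d%:Z) (mm p n%:R) + x * Num.sqrt (W (m n)) -
    \sum_(0 <= k < (mm p (A * n%:R)).+1) mean k) /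
    Num.sqrt (V (mm p (A * n%:R)).+1)| <= eta.
  near: n; have /cvgrPdist_le := @threshold_cvg R p d p0 p1 c c0 Vy aV cq aC W WV A x A1.
  by move=> /(_ eta eta0).
have ws : forall k, (mm p (n%:R / A) <= k < (mm p (A * n%:R)).+1)%N ->
    a k + \sum_(k.+1 <= i < (mm p (A * n%:R)).+1) mean i <= s2 * Num.sqrt (V (m n)).
  by near: n; exact: (window_small p0 p1 Vy aV aC A1 s20).
have esmall : \sum_(0 <= k < (mm p (A * n%:R)).+1) err k <=
    s1 * Num.sqrt (V (mm p (A * n%:R)).+1) ^+ 3.
  by near: n; exact: (err_small p0 p1 c0 Vy aV cq aC A1 s10).
set N := (mm p (A * n%:R)).+1 in tauE ws esmall; set J := mm p (n%:R / A) in ws.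
set B := Num.sqrt (V N) in tauE esmall; set M := \sum_(0 <= k < N) mean k in tauE.
set tau := theta p (- d%:Z) (mm p n%:R) + x * Num.sqrt (W (m n)) in tauE.
have n0 : 0 < n%:R :> R by apply: lt_le_trans An.
have sW : 0 < Num.sqrt (W (m n)) by rewrite sqrtr_gt0.
have VN : 0 < V N by exact: (total_var_gt0 p0 p1 c0 cq).
have B0 : 0 < B by rewrite sqrtr_gt0.
have Bn0 : B != 0 by rewrite gt_eqF.
have wsmall k : (J <= k < N)%N -> a k + \sum_(k.+1 <= i < N) mean i <= s2 * B.
  move=> /ws /le_trans; apply; rewrite ler_wpM2l ?(ltW s20)// ler_sqrt ?(ltW VN)//.
  apply: (le_total_var d p0 p1); rewrite ltnS; by have /andP[] := mm_div_le p1 A1 An.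
have early : 1 - (1 - Y N) ^+ n <= e / 8.
  apply: le_trans (one_sub_pow_ge n (ltW (upper_gt0 p0 p1 N)) (upper_le1 p0 N)) _.
  apply: le_trans Ae; have An1 : 1 <= A * n%:R by rewrite mulr_ege1// (le_trans A1).
  have [H _] := mmP p1 An1.
  apply: (@le_trans _ _ (n%:R * (A * n%:R)^-1)); first by rewrite ler_wpM2l ?(ltW n0)// ltW.
  by rewrite invfM mulrCA mulfV ?gt_eqF// mulr1.
have late : (1 - Y J) ^+ n <= e / 8.
  apply: le_trans Ae; apply: one_sub_pow_le => //; first exact: ltW (upper_gt0 p0 p1 J).
    exact: upper_le1.
  have t1 : 1 <= n%:R / A by rewrite ler_pdivlMr// mul1r.
  have [_ /(_ J (leqnn _))] := mmP p1 t1; rewrite invf_div => H.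
  by rewrite mulrC -ler_pdivrMr.
(* [lindeberg] is applied to a logistic cut-off of slope [lam] in the normalized
   count, centered [2 eta] beyond [x]. *)
pose sg : R := if b then -1 else 1.
have sg1 : `|sg| = 1 by rewrite /sg; case: ifP; rewrite ?normrN normr1.
pose al := sg * lam / B; pose be := - sg * lam * (M / B + x) - 2 * l.
have alE : `|al| = lam / B by rewrite /al -mulrA normrM sg1 mul1r gtr0_norm// divr_gt0.
pose Q := [set k : nat | if b then x < stat n k else stat n k <= x].
have HQ k : Q k -> al * k%:R + be <= - l.
  have E : al * k%:R + be = sg * lam * ((k%:R - M) / B - x) - 2 * l by rewrite /al /be; field.
  rewrite E; move: tauE; rewrite ler_distlC /Q /stat /sg /= => /andP[t1 t2].
  have iB : 0 < B^-1 by rewrite invr_gt0.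
  case: (boolP b) => bE.
    rewrite ltr_pdivlMr// => H.
    have : (tau - M) / B <= (k%:R - M) / B.
      by rewrite ler_wpM2r ?(ltW iB)// lerD2r /tau addrC -lerBrDr ltW.
    move: t1 t2; set z1 := (tau - M) / B; set z2 := (k%:R - M) / B.
    by nra.
  rewrite ler_pdivrMr// => H.
  have : (k%:R - M) / B <= (tau - M) / B.
    by rewrite ler_wpM2r ?(ltW iB)// lerD2r /tau addrC -lerBlDr.
  move: t1 t2; set z1 := (tau - M) / B; set z2 := (k%:R - M) / B.
  by nra.
have := count_tail_le n (ltn0Sn _) (mulr_ge0 (ltW s20) (ltW B0)) HQ wsmall.
rewrite -/N -/M -/kap alE.
set G := gsmooth _ _ _; set S := \sum_(0 <= k < N) err k => main.
have Gle : G <= (if b then 1 - normal_cdf x else normal_cdf x) + e / 8 + kap.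
  have pe : pk * (3 * eta) = e / 8 by rewrite /eta; field; rewrite gt_eqF.
  rewrite -pe /G /gsmooth; apply: le_trans (cutoff_mean_le b x lam0 eta0 le).
  rewrite le_eqVlt; apply/orP; left; apply/eqP; congr gmean; apply/funext => z.
  by congr logistic; rewrite /al /be -/B /sg; field.
have Sle : (lam / B) ^+ 3 * (7 + 3 * gcube) * S <= e / 32.
  apply: le_trans Ks1; rewrite expr_div_n.
  have -> : lam ^+ 3 / B ^+ 3 * (7 + 3 * gcube) * S = K * (S / B ^+ 3) by rewrite /K; field.
  by rewrite ler_wpM2l// ler_pdivrMr// exprn_gt0.
have Wle : lam / B * (s2 * B) = e / 32 by rewrite -ls2; field.
have G0 : 0 <= (if b then 1 - normal_cdf x else normal_cdf x) <= 1.
  have /andP[c0' c1'] := normal_cdf_01 x.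
  by case: ifP => _; rewrite ?subr_ge0 ?gerBl ?c0' ?c1'.
rewrite Wle in main; apply: le_trans main _.
have kap01 : 0 <= kap <= 1 by rewrite kap0.
exact: (error_budget kap01 kape e0 G0 early late Gle Sle).
Unshelve. all: by end_near. Qed.

Lemma record_clt (x : R) :
  P [set t | stat n (Nrec X (- d%:Z) n t) <= x] @[n --> \oo] --> normal_prob (0 : R) 1 `]-oo, x].
Proof.
have mE n : measurable [set t | stat n (Nrec X (- d%:Z) n t) <= x].
  exact: (measurable_Nrec mX d n [set k | stat n k <= x]).
have -> : normal_prob (0 : R) 1 `]-oo, x] = (normal_cdf x)%:E.
  by rewrite /normal_cdf fineK// fin_num_measure//; exact: measurable_itv.
rewrite (_ : (fun n => _) = EFin \o (fun n => pr [set t | stat n (Nrec X (- d%:Z) n t) <= x])); last first.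
  by apply/funext => n /=; rewrite fineK// fin_num_measure.
apply/fine_cvgP; split; first by near=> n.
apply/cvgrPdist_le => e e0; near=> n.
rewrite /= ler_distlC.
have up : pr [set t | stat n (Nrec X (- d%:Z) n t) <= x] <= normal_cdf x + e.
  by near: n; exact: (@tail_le x e false).
have low : pr [set t | x < stat n (Nrec X (- d%:Z) n t)] <= 1 - normal_cdf x + e.
  by near: n; exact: (@tail_le x e true).
rewrite up andbT.
have E : [set t | x < stat n (Nrec X (- d%:Z) n t)] = ~` [set t | stat n (Nrec X (- d%:Z) n t) <= x].
  by apply/seteqP; split => t /=; rewrite ltNge => /negP.
move: low; rewrite E probability_setC// (prE P (mE n)) -EFinB /=; lra.
Unshelve. all: by end_near. Qed.

End limit.

(** * Case (a): hazards bounded away from 1 *)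

Lemma dist1_div {R : realType} (x y : R) : 0 < y -> `|1 - x / y| = `|y - x| / y.
Proof.
move=> y0; have yn0 : y != 0 by rewrite gt_eqF.
by rewrite -{1}(divff yn0) -mulrBl normrM normfV [X in _ / X]gtr0_norm.
Qed.

(** * Divergence of the variance, common to both cases *)

Section divergence.
Context {R : realType}.
Variable p : nat -> R.
Hypothesis p0 : forall k, 0 < p k.
Hypothesis p1 : series p @ \oo --> (1 : R).
Notation Y := (upper p).
Notation r := (rr p).

(** From any [n], going on until the tail has dropped below [Y n / 2] adds at least [1 / 2], since
    [r i >= p i / Y n] for [i >= n]. *)
Lemma dvg_sum_rr (B : R) : exists n, B <= \sum_(0 <= k < n) r k.
Proof.
suff H (M : nat) : exists n, M%:R / 2 <= \sum_(0 <= k < n) r k.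
  have [n Hn] := H (Num.bound (2 * `|B|)); exists n; apply: le_trans Hn.
  rewrite ler_pdivlMr// mulrC; apply: ltW.
  apply: le_lt_trans (archi_boundP _); last by rewrite mulr_ge0.
  by rewrite ler_wpM2l// ler_norm.
elim: M => [|M [n Hn]]; first by exists 0%N; rewrite big_geq// mul0r.
have Yn := upper_gt0 p0 p1 n; have Yn2 : 0 < Y n / 2 by rewrite divr_gt0.
have /cvgrPdist_lt /(_ _ Yn2) [k _ Hk] := cvg_upper p1.
have := Hk (maxn k n) (leq_maxl _ _); rewrite /= sub0r normrN.
set N := maxn k n; have nN : (n <= N)%N by exact: leq_maxr.
rewrite ger0_norm ?(ltW (upper_gt0 p0 p1 _))// => YN.
exists N; rewrite (big_cat_nat (leq0n _) nN) /= -natr1 mulrDl lerD//.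
apply: (@le_trans _ _ (\sum_(n <= i < N) (Y n)^-1 * p i)).
  rewrite -mulr_sumr sum_pE// [leRHS]mulrC ler_pdivlMr//; lra.
apply: ler_sum_nat => i /andP[ni _]; rewrite rrE// mulrC ler_wpM2l ?(ltW (p0 i))//.
by rewrite lef_pV2 ?posrE ?upper_gt0// upper_anti.
Qed.

Variable d : nat.
Hypothesis d0 : (0 < d)%N.
Notation q := (exit_prob p d).
Notation a k := (gap_ratio p d k.+1).
Notation V := (total_var p d).

(** As [d > 0], the denominator [Y (k.+1 - d)] is at least [Y k]. This provides the constant [c = 1]
    in both cases. *)
Lemma exit_prob_le k : q k <= 1 - r k.
Proof.
rewrite rr_compl// /exit_prob ler_wpM2l ?(ltW (upper_gt0 _ _ _))//.
rewrite lef_pV2 ?posrE ?upper_gt0//; apply: upper_anti => //; lia.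
Qed.

Lemma var_coef_ge1 k : 1 <= 2 - q k - r k.
Proof. by have := exit_prob_le k; lra. Qed.

Lemma total_var_ge n : \sum_(0 <= k < n) r k * a k ^+ 2 <= V n.
Proof.
apply: ler_sum => k _; rewrite varE//.
rewrite ler_wpM2r ?sqr_ge0// ler_peMr ?var_coef_ge1// ltW// rr_gt0//.
Qed.

Lemma cvgy_total_var : V n @[n --> \oo] --> +oo.
Proof.
apply/cvgryPge => B; have [n Hn] := dvg_sum_rr B.
exists n => // N /= nN; apply: le_trans Hn _.
apply: le_trans (le_total_var d p0 p1 nN); apply: le_trans (total_var_ge n).
apply: ler_sum => k _; rewrite ler_peMr ?(ltW (rr_gt0 p0 p1 _))//.
by rewrite exprn_ege1// gap_ratio_ge1.
Qed.

End divergence.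

Lemma stolz {R : realType} (v w : nat -> R) :
  (forall k, 0 < v k) -> \sum_(0 <= k < n) v k @[n --> \oo] --> +oo ->
  w k / v k @[k --> \oo] --> (1 : R) ->
  (\sum_(0 <= k < n) w k) / (\sum_(0 <= k < n) v k) @[n --> \oo] --> (1 : R).
Proof.
move=> v0 Vy wv; apply/cvgrPdist_le => e e0.
have e2 : 0 < e / 2 by rewrite divr_gt0.
move/cvgrPdist_le: wv => /(_ _ e2) [k0 _ H].
pose K := \sum_(0 <= k < k0) `|v k - w k|.
near=> n.
have k0n : (k0 <= n)%N by near: n; exact: nbhs_infty_ge.
have VK : 2 * K / e <= \sum_(0 <= k < n) v k by near: n; move/cvgryPge: Vy; apply.
have V1 : 1 <= \sum_(0 <= k < n) v k by near: n; move/cvgryPge: Vy; apply.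
move: VK V1; set S := \sum_(0 <= k < n) v k => VK V1.
have S0 : 0 < S by apply: lt_le_trans V1.
have D : `|S - \sum_(0 <= k < n) w k| <= e * S.
  rewrite /S -sumrB; apply: le_trans (ler_norm_sum _ _ _) _.
  rewrite (big_cat_nat (leq0n _) k0n) /=.
  apply: (@le_trans _ _ (K + \sum_(k0 <= k < n) e / 2 * v k)).
    rewrite lerD2l; apply: ler_sum_nat => k /andP[kk _].
    by have := H k kk; rewrite /= dist1_div// ler_pdivrMr.
  rewrite -mulr_sumr.
  have : \sum_(k0 <= k < n) v k <= S.
    by rewrite /S (big_cat_nat (leq0n _) k0n) /= lerDr sumr_ge0// => k _; exact: ltW.
  move: VK; rewrite ler_pdivrMr// -/S; set S' := \sum_(k0 <= k < n) v k; nra.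
by rewrite dist1_div// ler_pdivrMr.
Unshelve. all: by end_near. Qed.

Section bounded_hazard.
Context {R : realType}.
Variables (p : nat -> R) (d : nat) (rho : R).
Hypothesis p0 : forall k, 0 < p k.
Hypothesis p1 : series p @ \oo --> (1 : R).
Hypothesis d0 : (0 < d)%N.
Hypothesis rho1 : rho < 1.
Hypothesis r_rho : forall k, rr p k <= rho.
Notation Y := (upper p).
Notation r := (rr p).
Notation q := (exit_prob p d).
Notation A := (gap_ratio p d).
Notation V := (total_var p d).
Notation zterm := (zz_term p d).

Let C := (1 - rho) ^- d.

Let rho_ge0 : 0 < 1 - rho. Proof. by rewrite subr_gt0. Qed.

(** Each of the [d] steps from [k - d] to [k] multiplies the tail by at least [1 - rho]; steps
    truncated at 0 cost nothing, because [rho >= 0]. *)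
Lemma gap_ratio_le k : A k <= C.
Proof.
rewrite /gap_ratio ler_pdivrMr ?upper_gt0// /C -ler_pdivrMl ?invr_gt0 ?exprn_gt0// invrK.
elim: (d) => [|n IH]; first by rewrite expr0 mul1r subn0.
apply: le_trans IH; rewrite exprSr -mulrA ler_wpM2l ?exprn_ge0 ?(ltW rho_ge0)//.
rewrite subnS; case: (k - n)%N => [|j] /=.
  by rewrite upper0 mulr1; have := le_trans (ltW (rr_gt0 p0 p1 0)) (r_rho 0); lra.
rewrite mulrC -ler_pdivlMl ?upper_gt0// mulrC -(rr_compl p0 p1).
by rewrite lerD2l lerN2.
Qed.

Let C0 : 0 <= C. Proof. by rewrite invr_ge0 exprn_ge0// ltW. Qed.

Lemma zz_term_ge0 i : 0 <= zterm i.
Proof.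
have h1 : Y i <= Y (i - d) by apply: upper_anti => //; exact: leq_subr.
have h2 : Y (i.+1 - d) <= Y (i - d) by apply: upper_anti => //; rewrite leq_sub2r.
have h3 := upper_gt0 p0 p1 (i.+1 - d).
rewrite /zz_term ssE//; apply: mulr_ge0; last by lra.
by apply: divr_ge0; [rewrite subr_ge0|exact: ltW (upper_gt0 p0 p1 i)].
Qed.

Lemma zz_term_le i : zterm i <= 2 * C * (Y (i - d) - Y (i.+1 - d)).
Proof.
have h2 : Y (i.+1 - d) <= Y (i - d) by apply: upper_anti => //; rewrite leq_sub2r.
have Yi := upper_gt0 p0 p1 i.
have h3 : Y (i - d) <= C * Y i.
  by have := gap_ratio_le i; rewrite /gap_ratio ler_pdivrMr.
rewrite /zz_term ssE// -mulrA mulrC ler_wpM2r ?subr_ge0//.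
rewrite mulrC ler_pdivrMr//; nra.
Qed.

Lemma zz_sum_le m n : (m <= n)%N -> \sum_(m <= i < n) zterm i <= 2 * C ^+ 2 * Y m.
Proof.
move=> mn.
apply: (@le_trans _ _ (\sum_(m <= i < n) 2 * C * (Y (i - d) - Y (i.+1 - d)))).
  by apply: ler_sum => i _; exact: zz_term_le.
rewrite -mulr_sumr (telescope_sumr_eq (fun i => - Y (i - d)))//; last first.
  by move=> k _; ring.
have h3 : Y (m - d) <= C * Y m.
  by have := gap_ratio_le m; rewrite /gap_ratio ler_pdivrMr// upper_gt0.
have Yn := upper_gt0 p0 p1 (n - d).
have -> : 2 * C ^+ 2 * Y m = 2 * C * (C * Y m) by ring.
by rewrite ler_wpM2l ?mulr_ge0//; lra.
Qed.

Lemma cvg_zz : exists L, series zterm @ \oo --> L /\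
  forall n, `|L - series zterm n| <= 2 * C ^+ 2 * Y n.
Proof.
have nd : nondecreasing_seq (series zterm).
  by apply: nondecreasing_series => i _ _; exact: zz_term_ge0.
have cz : cvgn (series zterm).
  apply: nondecreasing_is_cvgn => //; exists (2 * C ^+ 2 * Y 0) => _ [n _ <-].
  exact: zz_sum_le.
exists (limn (series zterm)); split => // n.
have Sn : series zterm n <= limn (series zterm) by exact: nondecreasing_cvgn_le.
rewrite ger0_norm ?subr_ge0// lerBlDl; apply: limr_le => //; near=> k.
have nk : (n <= k)%N by near: k; exact: nbhs_infty_ge.
by rewrite -lerBlDl sub_series_geq// zz_sum_le.
Unshelve. all: by end_near. Qed.

(** By [zz_abel] and [level_var_abel] both sums equal the sum of [abel_var] up to boundary terms.
    These stay bounded while [V] diverges. *)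
Lemma zz_var_ratio :
  (\sum_(0 <= k < n) zz p (- d%:Z) k * r k / ytail p k) / V n @[n --> \oo] --> (1 : R).
Proof.
have [L [cL HL]] := cvg_zz.
pose K := `|L| + 2 * C ^+ 2 + C ^+ 2 + C.
apply/cvgrPdist_le => e e0; near=> n.
have V1 : 1 <= V n.
  by near: n; have /cvgryPge := cvgy_total_var p0 p1 d0; apply.
have VK : K / e <= V n.
  by near: n; have /cvgryPge := cvgy_total_var p0 p1 d0; apply.
have V0 : 0 < V n by apply: lt_le_trans V1.
rewrite dist1_div// ler_pdivrMr//.
apply: (@le_trans _ _ K); last by rewrite mulrC -ler_pdivrMr.
rewrite (zz_abel p0 p1 n cL) /total_var level_var_abel//.
have h1 : `|(L - series zterm n) / Y n| <= 2 * C ^+ 2.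
  by rewrite normrM normfV [X in _ / X]gtr0_norm ?upper_gt0// ler_pdivrMr ?upper_gt0.
have h2 := gap_ratio_le n; have h3 := gap_ratio_ge1 p0 p1 d n.
have h4 : A n ^+ 2 <= C ^+ 2 by rewrite ler_pXn2r ?nnegrE// (le_trans _ h3).
move: h1; set z := (_ / Y n); set S := \sum_(0 <= k < n) _.
have -> : S + (A n ^+ 2 - A n) - (S + (z - L)) = A n ^+ 2 - A n - z + L by ring.
move=> h1.
apply: le_trans (ler_normD _ _) _; rewrite /K.
have := ler_normB (A n ^+ 2 - A n) z.
have := ler_normB (A n ^+ 2) (A n).
rewrite (ger0_norm (sqr_ge0 _)) (ger0_norm (le_trans ler01 h3)); lra.
Unshelve. all: by end_near. Qed.

Lemma bounded_gap_small e : 0 < e -> \forall k \near \oo,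
  A k.+1 <= e * Num.sqrt (V k.+1).
Proof.
move=> e0; near=> k; apply: le_trans (gap_ratio_le _) _.
have : (C / e) ^+ 2 <= V k.+1.
  near: k; have /cvgryPge /(_ ((C / e) ^+ 2)) [N _ HN] := cvgy_total_var p0 p1 d0.
  by exists N => // k /= Nk; apply: HN; rewrite /= (leq_trans Nk).
move=> H; rewrite mulrC -ler_pdivrMr// -[leLHS]ger0_norm ?divr_ge0 ?(ltW e0)//.
by rewrite -sqrtr_sqr ler_sqrt// (le_trans _ H)// sqr_ge0.
Unshelve. all: by end_near. Qed.

Lemma bounded_gap_comp (B : R) : exists D : R, \forall n \near \oo,
  forall k, (mm p n%:R <= k <= mm p (B * n%:R))%N -> A k.+1 <= D * A (mm p n%:R).+1.
Proof.
exists C; near=> n => k _; apply: le_trans (gap_ratio_le _) _.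
by rewrite ler_peMr// gap_ratio_ge1.
Unshelve. all: by end_near. Qed.

End bounded_hazard.

(** * Case (b): hazards tending to 1 *)

Lemma cvgnX {R : realType} (f : nat -> R) (l : R) m :
  f n @[n --> \oo] --> l -> f n ^+ m @[n --> \oo] --> l ^+ m.
Proof.
move=> fl; elim: m => [|m IH]; first by under eq_fun do rewrite expr0; exact: cvg_cst.
by under eq_fun do rewrite exprS; rewrite exprS; exact: cvgM.
Qed.

Lemma cvgn_sum {R : realType} (f : nat -> nat -> R) (l : R) m :
  (forall j, f j n @[n --> \oo] --> l) ->
  \sum_(j < m) f j n @[n --> \oo] --> m%:R * l.
Proof.
move=> fl; elim: m => [|m IH].
  by under eq_fun do rewrite big_ord0; rewrite mul0r; exact: cvg_cst.
under eq_fun do rewrite big_ord_recr.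
by rewrite -natr1 mulrDl mul1r; exact: cvgD.
Qed.

Section hazard_to_one.
Context {R : realType}.
Variables (p : nat -> R) (d : nat).
Hypothesis p0 : forall k, 0 < p k.
Hypothesis p1 : series p @ \oo --> (1 : R).
Hypothesis d0 : (0 < d)%N.
Notation Y := (upper p).
Notation r := (rr p).
Notation q := (exit_prob p d).
Notation a k := (gap_ratio p d k.+1).
Notation V := (total_var p d).
Notation var := (level_var r q).
Notation u k := (1 - r k).
Hypothesis r_to1 : r k @[k --> \oo] --> (1 : R).
Hypothesis u_ratio1 : u k.+1 / u k @[k --> \oo] --> (1 : R).

Let u0 k : 0 < u k. Proof. by rewrite subr_gt0 rr_lt1. Qed.
Let un0 k : u k != 0. Proof. by rewrite gt_eqF. Qed.

Lemma hazard_to0 : u k @[k --> \oo] --> (0 : R).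
Proof. by rewrite -[X in _ --> X](subrr 1); apply: cvgB => //; exact: cvg_cst. Qed.

Lemma hazard_ratio i j : u (n + i)%N / u (n + j)%N @[n --> \oo] --> (1 : R).
Proof.
have H i' : u (n + i')%N / u n @[n --> \oo] --> (1 : R).
  elim: i' => [|k IH].
    by under eq_fun do rewrite addn0 divff//; exact: cvg_cst.
  rewrite (_ : (fun n => _) = fun n => (u (n + k).+1 / u (n + k)%N) * (u (n + k)%N / u n)).
    rewrite -[X in _ --> X]mulr1; apply: cvgM => //.
    by have := u_ratio1; rewrite -(cvg_shiftn k).
  by apply/funext => n; rewrite addnS mulrA divfK.
rewrite (_ : (fun n => _) = fun n => (u (n + i)%N / u n) * (u (n + j)%N / u n)^-1).
  rewrite -[X in _ --> X]mulr1; apply: cvgM => //.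
  by rewrite -[X in _ --> X]invr1; apply: cvgV; rewrite ?oner_eq0.
by apply/funext => n; rewrite invf_div mulrA divfK.
Qed.

(** Leading order of [a k]: consecutive tails have ratios [u], and [d] consecutive values of [u] are
    asymptotically equal. Since [2 - q k - r k] tends to 1, [var k] is then equivalent to
    [b k ^+ 2]. *)
Let b k := (u k)^-1 ^+ d.

Let b0 k : 0 < b k. Proof. by rewrite exprn_gt0// invr_gt0. Qed.

Let gap_upper i j : Y n / Y (n + j)%N * u (n + i)%N ^+ j @[n --> \oo] --> (1 : R).
Proof.
elim: j => [|j IH].
  under eq_fun do rewrite addn0 divff ?gt_eqF ?upper_gt0// expr0 mulr1.
  exact: cvg_cst.
rewrite (_ : (fun n => _) = fun n =>
    (Y n / Y (n + j)%N * u (n + i)%N ^+ j) * (u (n + i)%N / u (n + j)%N)).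
  by rewrite -[X in _ --> X]mulr1; apply: cvgM => //; exact: hazard_ratio.
apply/funext => n; rewrite [u (n + j)%N]rr_compl// exprS addnS.
have := upper_gt0 p0 p1 (n + j)%N; have := upper_gt0 p0 p1 (n + j).+1 => ? ?.
by field; rewrite !gt_eqF.
Qed.

Let gap_b : a k / b k @[k --> \oo] --> (1 : R).
Proof.
rewrite -(cvg_shiftn d.-1).
have H := @gap_upper d.-1 d; apply: cvg_trans H; apply: near_eq_cvg; near=> n.
rewrite /b /= exprVn invrK /gap_ratio; congr (_ * _).
by rewrite -addnS prednK// addnK.
Unshelve. all: by end_near. Qed.

Let q_to0 : q k @[k --> \oo] --> (0 : R).
Proof.
apply: (@squeeze_cvgr _ _ _ _ (fun=> 0) (fun k => u k)).
- by near=> k; rewrite exit_prob_le// ltW// exit_prob_gt0.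
- exact: cvg_cst.
- exact: hazard_to0.
Unshelve. all: by end_near. Qed.

Let var_b : var k / b k ^+ 2 @[k --> \oo] --> (1 : R).
Proof.
rewrite (_ : (fun k => _) = fun k => r k * (2 - q k - r k) * (a k / b k) ^+ 2); last first.
  apply/funext => k; rewrite varE; move: (gap_ratio _ _ _) => g.
  by have := b0 k; move: (b k) => z z0; field; rewrite gt_eqF.
have E : 1 * (2 - 0 - 1) * 1 ^+ 2 = 1 :> R by ring.
rewrite -[X in _ --> X]E.
apply: cvgM; last by apply: cvgnX; exact: gap_b.
by apply: cvgM => //; apply: cvgB => //; apply: cvgB => //; exact: cvg_cst.
Qed.

Let b_ratio i j : b (n + i)%N / b (n + j)%N @[n --> \oo] --> (1 : R).
Proof.
rewrite (_ : (fun n => _) = fun n => (u (n + j)%N / u (n + i)%N) ^+ d); last first.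
  by apply/funext => n; rewrite /b -expr_div_n invrK mulrC.
by rewrite -[X in _ --> X](expr1n _ d); apply: cvgnX; exact: hazard_ratio.
Qed.

Lemma hazard_var_ratio :
  (\sum_(0 <= k < n) u k ^ (2 * - d%:Z)) / V n @[n --> \oo] --> (1 : R).
Proof.
apply: stolz => [k||].
- rewrite varE mulr_gt0 ?exprn_gt0//; last by rewrite (lt_le_trans ltr01)// gap_ratio_ge1.
  by rewrite mulr_gt0 ?rr_gt0// (lt_le_trans ltr01)// var_coef_ge1.
- exact: cvgy_total_var.
rewrite (_ : (fun k => _) = fun k => (var k / b k ^+ 2)^-1).
  by rewrite -[X in _ --> X]invr1; apply: cvgV; rewrite ?oner_eq0.
apply/funext => k.
have -> : u k ^ (2 * - d%:Z) = b k ^+ 2.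
  by rewrite /b -exprM mulrN -PoszM -exprnN exprVn mulnC.
by move: (var k) => v; rewrite invfM invrK mulrC.
Qed.

Let gap_shift i j : a (n + i)%N / a (n + j)%N @[n --> \oo] --> (1 : R).
Proof.
rewrite (_ : (fun n => _) = fun n => (a (n + i)%N / b (n + i)%N) *
    (a (n + j)%N / b (n + j)%N)^-1 * (b (n + i)%N / b (n + j)%N)); last first.
  apply/funext => n.
  have aj : a (n + j)%N != 0 by rewrite gt_eqF// (lt_le_trans ltr01)// gap_ratio_ge1.
  by field; rewrite aj !gt_eqF.
have H l : a (n + l)%N / b (n + l)%N @[n --> \oo] --> (1 : R).
  by have := gap_b; rewrite -(cvg_shiftn l).
rewrite -[X in _ --> X]mulr1; apply: cvgM; last exact: b_ratio.
rewrite -[X in _ --> X]mulr1; apply: cvgM => //.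
by rewrite -[X in _ --> X]invr1; apply: cvgV; rewrite ?oner_eq0.
Qed.

(** As [u] tends to 0, the tail drops by more than a factor [B] in a single step, so only [mm p n]
    and its successor can lie in the range; one step changes [a] by a factor close to 1, hence the
    witness 2. *)
Lemma hazard_gap_comp (B : R) : 1 <= B -> exists D : R, \forall n \near \oo,
  forall k, (mm p n%:R <= k <= mm p (B * n%:R))%N -> a k <= D * a (mm p n%:R).
Proof.
move=> B1; have B0 : 0 < B by apply: lt_le_trans B1.
exists 2.
have H1 : \forall k \near \oo, a k.+1 <= 2 * a k.
  have /cvgrPdist_le /(_ 1 ltr01) := gap_shift 1 0; apply: filterS => k.
  rewrite addn0 addn1 ler_distlC => /andP[_]; rewrite ler_pdivrMr// (lt_le_trans ltr01)//.
  exact: gap_ratio_ge1.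
have H2 : \forall k \near \oo, u k < B^-1.
  have /cvgrPdist_lt /(_ B^-1) := hazard_to0; rewrite invr_gt0 => /(_ B0).
  by apply: filterS => k; rewrite sub0r normrN ger0_norm// ltW.
have [k1 _ H1'] := H1; have [k2 _ H2'] := H2.
near=> n => k /andP[mk kB].
have m1 : (k1 <= mm p n%:R)%N by near: n; exact: (mm_near1 p0 p1).
have m2 : (k2 <= mm p n%:R)%N by near: n; exact: (mm_near1 p0 p1).
have n1 : 1 <= n%:R :> R by near: n; exact: nbhs_infty_ger.
have n0 : 0 < n%:R :> R by apply: lt_le_trans n1.
have Bn1 : 1 <= B * n%:R by rewrite mulr_ege1.
have am := gap_ratio_ge1 p0 p1 d (mm p n%:R).+1.
have [->|km] := eqVneq k (mm p n%:R); first by lra.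
have [->|km1] := eqVneq k (mm p n%:R).+1; first exact: H1'.
have mk2 : ((mm p n%:R).+2 <= k)%N by lia.
exfalso.
have [Hm _] := mmP p1 n1; have [_ /(_ k kB) Hk] := mmP p1 Bn1.
have uk := H2' (mm p n%:R).+1 (leq_trans m2 (leqnSn _)).
have Yk : Y k <= Y (mm p n%:R).+2 by exact: upper_anti p0 _ _ mk2.
have YE : Y (mm p n%:R).+2 = u (mm p n%:R).+1 * Y (mm p n%:R).+1.
  by rewrite rr_compl// divfK// gt_eqF// upper_gt0.
have : u (mm p n%:R).+1 * Y (mm p n%:R).+1 < (B * n%:R)^-1.
  by rewrite invfM; apply: ltr_pM => //; [exact: ltW (u0 _)|exact: ltW (upper_gt0 p0 p1 _)].
by rewrite -YE => /(le_lt_trans Yk); rewrite ltNge Hk.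
Unshelve. all: by end_near. Qed.

(** Each of the [L] levels preceding [k] has variance equivalent to [a k ^+ 2], so [V k.+1] is
    eventually at least [L / 2 * a k ^+ 2]; [L] is chosen above [2 / e ^+ 2]. *)
Lemma hazard_gap_small e : 0 < e -> \forall k \near \oo, a k <= e * Num.sqrt (V k.+1).
Proof.
move=> e0; pose L := (Num.bound (2 / e ^+ 2)).+1.
have L2 : 2 / e ^+ 2 <= L%:R.
  apply: ltW; apply: lt_le_trans (archi_boundP _) _; first by rewrite divr_ge0 ?sqr_ge0.
  by rewrite ler_nat.
have cS : \sum_(j < L) var (n + j)%N / a (n + L)%N ^+ 2 @[n --> \oo] --> L%:R * (1 : R).
  apply: (@cvgn_sum _ (fun j n => var (n + j)%N / a (n + L)%N ^+ 2)) => j.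
  rewrite (_ : (fun n => _) = fun n => (var (n + j)%N / b (n + j)%N ^+ 2) *
    (b (n + j)%N / b (n + L)%N) ^+ 2 * ((a (n + L)%N / b (n + L)%N)^-1) ^+ 2); last first.
    apply/funext => n.
    have aj : a (n + L)%N != 0 by rewrite gt_eqF// (lt_le_trans ltr01)// gap_ratio_ge1.
    by field; rewrite aj !gt_eqF.
  have E : 1 * 1 ^+ 2 * 1^-1 ^+ 2 = 1 :> R by rewrite invr1; ring.
  rewrite -[X in _ --> X]E.
  apply: cvgM; last first.
    apply: cvgnX; apply: cvgV; first by rewrite oner_eq0.
    by have := gap_b; rewrite -(cvg_shiftn L).
  apply: cvgM; first by have := var_b; rewrite -(cvg_shiftn j).
  by apply: cvgnX; exact: b_ratio.
rewrite mulr1 in cS.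
have L0 : 0 < L%:R :> R by rewrite ltr0n.
have : \forall n \near \oo, L%:R / 2 <= \sum_(j < L) var (n + j)%N / a (n + L)%N ^+ 2.
  have L20 : 0 < L%:R / 2 :> R by rewrite divr_gt0.
  have /cvgrPdist_le /(_ _ L20) := cS; apply: filterS => n.
  by rewrite ler_distlC => /andP[+ _]; lra.
move=> [N _ HN]; near=> k.
have kL : (L <= k)%N by near: k; exact: nbhs_infty_ge.
have kN : (N <= k - L)%N by rewrite leq_subRL//; near: k; exact: nbhs_infty_ge.
have := HN _ kN; rewrite /= subnK//.
under eq_bigr do rewrite mulrC.
have ak : 0 < a k by rewrite (lt_le_trans ltr01)// gap_ratio_ge1.
rewrite -mulr_sumr [leRHS]mulrC ler_pdivlMr ?exprn_gt0// => H.
have VS : \sum_(j < L) var (k - L + j)%N <= V k.+1.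
  have h1 : (k - L <= k)%N by exact: leq_subr.
  rewrite /total_var (big_cat_nat (leq0n _) (leq_trans h1 (leqnSn k))) /=.
  rewrite (big_cat_nat h1 (leqnSn k)) /=.
  have -> : \sum_(j < L) var (k - L + j)%N = \sum_(k - L <= i < k) var i.
    rewrite -{2}[(k - L)%N]add0n big_addn subKn// big_mkord.
    by apply: eq_bigr => j _; rewrite addnC.
  have H0 m n : 0 <= \sum_(m <= i < n) var i by apply: sumr_ge0 => i _; exact: var_ge0.
  have := H0 0%N (k - L)%N; have := H0 k k.+1; lra.
have V0 : 0 <= V k.+1 by rewrite sumr_ge0// => i _; exact: var_ge0.
have H2 : a k ^+ 2 <= e ^+ 2 * V k.+1.
  have e20 : 0 < e ^+ 2 by rewrite exprn_gt0.
  rewrite mulrC -ler_pdivrMr//.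
  apply: le_trans VS; apply: le_trans H.
  have -> : a k ^+ 2 / e ^+ 2 = 2 / e ^+ 2 / 2 * a k ^+ 2 by field; rewrite gt_eqF.
  by rewrite ler_wpM2r ?sqr_ge0// ler_wpM2r.
have es : 0 <= e * Num.sqrt (V k.+1) by rewrite mulr_ge0 ?(ltW e0)// sqrtr_ge0.
rewrite -(@ler_pXn2r _ 2) ?nnegrE ?(ltW ak)//.
by rewrite [leRHS]exprMn sqr_sqrtr.
Unshelve. all: by end_near. Qed.

End hazard_to_one.

(** The supremum of some tail of [f] is below [l], and the finitely many remaining values are below
    [l] one by one; the maximum of all these is a uniform bound. *)
Lemma limn_esup_lt {R : realType} (f : nat -> R) (l : R) :
  (limn_esup (fun k => (f k)%:E) < l%:E)%E -> (forall k, f k < l) ->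
  exists2 rho, rho < l & forall k, f k <= rho.
Proof.
move=> H fl; have [_ [S [n _ nS] <-] Hn] := ereal_inf_lt H.
have fn k : (n <= k)%N -> ((f k)%:E <= ereal_sup ((fun k => (f k)%:E) @` S))%E.
  by move=> nk; apply: ereal_sup_ubound; exists k => //; exact: nS.
move: Hn fn; case: (ereal_sup _) => [s| |]; last 2 first.
- by move=> /ltW; rewrite leye_eq.
- by move=> _ /(_ n (leqnn n)); rewrite leeNy_eq.
rewrite lte_fin => sl fs.
pose M := \big[Num.max/s]_(k < n) f k; exists M => [|k].
  by rewrite /M; elim/big_ind: _ => // a b al bl; rewrite gt_max al bl.
have [kn|nk] := ltnP k n; first by rewrite /M (le_bigmax s (fun k : 'I_n => f k) (Ordinal kn)).
apply: (@le_trans _ _ s); first by rewrite -lee_fin fs.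
exact: bigmax_ge_id.
Qed.
Unset Implicit Arguments.

Theorem theorem3p1 (R : realType) (d : measure_display) (T : measurableType d)
    (P : probability T R) (X : nat -> T -> nat) (p : nat -> R) (delta : int) :
  (forall i k, measurable (X i @^-1` [set k])) ->
  mutually_independent P X ->
  (forall i k, P (X i @^-1` [set k]) = (p k)%:E) ->
  (forall k, 0 < p k) ->
  delta < 0 ->
  ((limn_esup (fun k => (rr p k)%:E) < 1%:E)%E ->
    forall x : R,
      P [set t | ((Nrec X delta n t)%:R - theta p delta (mm p n%:R))
                 / Num.sqrt (\sum_(k < (mm p n%:R).+1)
                               (zz p delta k * rr p k / ytail p k)) <= x]
        @[n --> \oo] --> normal_prob (0 : R) 1 `]-oo, x])
  /\
  (rr p k @[k --> \oo] --> (1 : R) ->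
   (1 - rr p k.+1) / (1 - rr p k) @[k --> \oo] --> (1 : R) ->
    forall x : R,
      P [set t | ((Nrec X delta n t)%:R - theta p delta (mm p n%:R))
                 / Num.sqrt (\sum_(k < (mm p n%:R).+1)
                               (1 - rr p k) ^ (2 * delta)) <= x]
        @[n --> \oo] --> normal_prob (0 : R) 1 `]-oo, x]).
Proof.
move=> mX indX lawX p0 delta0.
pose m := absz delta.
have m0 : (0 < m)%N by lia.
have {delta0} -> : delta = - m%:Z by lia.
have p1 := cvg_law mX lawX.
have cq := var_coef_ge1 p0 p1 m0; have Vy := cvgy_total_var p0 p1 m0.
split => [Hr x|r1 u1 x].
- have [rho rho1 rrho] := limn_esup_lt Hr (rr_lt1 p0 p1).
  have := @record_clt _ _ _ P X p mX indX lawX p0 m m0 1 ltr01 Vy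
    (bounded_gap_small p0 p1 m0 rho1 rrho) cq
    (fun B _ => bounded_gap_comp m p0 p1 rho1 rrho B) _
    (zz_var_ratio p0 p1 m0 rho1 rrho) x.
  by under eq_fun do rewrite big_mkord.
have := @record_clt _ _ _ P X p mX indX lawX p0 m m0 1 ltr01 Vy
    (hazard_gap_small p0 p1 m0 r1 u1) cq
    (hazard_gap_comp p0 p1 m0 r1 u1) _
    (hazard_var_ratio p0 p1 m0 r1 u1) x.
by under eq_fun do rewrite big_mkord.
Qed.
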